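(* Let $K\subset\mathbb C$ be a subfield and let $\mathbf G$ be a $K$-group with Lie algebra $\mathfrak g$. Suppose there are two decompositions $\mathbf G=\prod_{i=1}^r\mathbf G_i=\prod_{j=1}^s\mathbf H_j$ into direct products of closed $K$-subgroups, with corresponding decompositions of the Lie algebra $$\mathfrak g=\mathfrak g_1\oplus\mathfrak g_2\oplus\cdots\oplus\mathfrak g_r=\mathfrak h_1\oplus\mathfrak h_2\oplus\cdots\oplus\mathfrak h_s$$ into $K$-algebraic Lie ideals ($\mathfrak g_i=\operatorname{Lie}(\mathbf G_i)$, $\mathfrak h_j=\operatorname{Lie}(\mathbf H_j)$), each of which is non-zero and $K$-algebraically indecomposable. Let $\pi_i$ (resp. $\rho_j$) denote the projection onto $\mathfrak g_i$ (resp. $\mathfrak h_j$) along the first (resp. second) decomposition. Then $r=s$, and there exists a permutation $\sigma\in\mathcal S_r$ such that whenever $j=\sigma(i)$: (1) the projection $\pi_i|_{\mathfrak h_j}\colon\mathfrak h_j\to\mathfrak g_i$ is a $K$-algebraic Lie algebra isomorphism; (2) $[\mathfrak g_i,\mathfrak g_i]=[\mathfrak h_j,\mathfrak h_j]$; (3) $\mathfrak h_j\subset\mathfrak g_i\oplus Z\big(\bigoplus_{k\ne i}\mathfrak g_k\big)$. If moreover the $\mathfrak g_i$ are all non-abelian, then $\sigma\in\mathcal S_r$ is unique, in (1) the projection $\rho_j|_{\mathfrak g_i}\colon\mathfrak g_i\to\mathfrak h_j$ is also a $K$-algebraic Lie algebra isomorphism, and in (3) we also have $\mathfrak g_i\subset\mathfrak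 h_j\oplus Z\big(\bigoplus_{k\ne j}\mathfrak h_k\big)$.
   Context: A $K$-group (linear algebraic group defined over $K$) is a subgroup $\mathbf G\subset\operatorname{GL}_n(\mathbb C)$ that is the zero set of finitely many polynomials over $K$, with the Zariski topology. A $K$-morphism of $K$-groups is a morphism of algebraic groups defined over $K$. $\operatorname{Lie}(\mathbf G)$ is the complex Lie algebra of $\mathbf G$ and $\Phi_*$ denotes the differential at the identity of a $K$-morphism $\Phi$. A Lie algebra morphism $f\colon\mathfrak g\to\mathfrak h$ between Lie algebras of $K$-groups $\mathbf G,\mathbf H$ is $K$-algebraic if $f=\Phi_*$ for some $K$-morphism $\Phi\colon\mathbf G\to\mathbf H$; a $K$-algebraic isomorphism is a $K$-algebraic morphism that is bijective. A Lie subalgebra (or ideal) of $\mathfrak g$ is $K$-algebraic if it is the Lie algebra of a Zariski closed $K$-subgroup of $\mathbf G$. $\mathfrak g$ is $K$-algebraically indecomposable if it is not a direct sum of two non-zero $K$-algebraic ideals. $Z(\cdot)$ denotes the center and $\mathcal S_r$ the symmetric group on $r$ letters. *)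

(* Defs.v *)
(* The field of complex numbers is [R[i]] for [R : realType]. *)
From HB Require Import structures.
From mathcomp Require Import all_boot all_order all_algebra.
From mathcomp Require Import fingroup perm mpoly complex.
From mathcomp Require Import boolp classical_sets reals.

Set Implicit Arguments.
Unset Strict Implicit.
Unset Printing Implicit Defensive.

Import GRing.Theory.
Local Open Scope ring_scope.
Local Open Scope complex_scope.

Section Span.
Variables (F : fieldType) (vT : vectType F).
Implicit Types (S : set vT) (U W : {vspace vT}).

Lemma vspan_exists S : exists U, (forall v, S v -> v \in U) /\
  (forall W, (forall v, S v -> v \in W) -> (U <= W)%VS).
Proof.
pose P d := `[< exists U, (forall v, S v -> v \in U) /\ \dim U = d >].
have exP : exists d, P d.
  by exists (\dim {:vT}); apply/asboolP; exists fullv; split=> // v _; exact: memvf.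
case: (ex_minnP exP) => d /asboolP[U [SU <-]] minU.
exists U; split=> // W SW; apply/capv_idPl/eqP.
rewrite eqEdim capvSl /= minU //; apply/asboolP.
by exists (U :&: W)%VS; split=> // v Sv; rewrite memv_cap SU ?SW.
Qed.

Definition vspan S : {vspace vT} := projT1 (cid (vspan_exists S)).

Lemma mem_vspan S v : S v -> v \in vspan S.
Proof. by rewrite /vspan; case: cid => U [SU _] /= /SU. Qed.

Lemma vspan_sub S W : (forall v, S v -> v \in W) -> (vspan S <= W)%VS.
Proof. by rewrite /vspan; case: cid => U [_ minU] /= /minU. Qed.

Lemma vspanP S v : S 0 -> (forall a u w, S u -> S w -> S (a *: u + w)) ->
  (v \in vspan S) <-> S v.
Proof.
move=> S0 SL; split; last exact: mem_vspan.
pose P d := `[< exists U, (forall u, u \in U -> S u) /\ \dim U = d >].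
have exP : exists d, P d.
  exists 0; apply/asboolP; exists 0%VS; rewrite dimv0; split=> // u.
  by rewrite memv0 => /eqP->.
have ubP d : P d -> (d <= \dim {:vT})%N.
  by case/asboolP=> U [_ <-]; apply/dimvS/subvf.
case: (ex_maxnP exP ubP) => d /asboolP[U [US <-]] maxU.
suff SU u : S u -> u \in U by move=> /(subvP (vspan_sub SU))/US.
move=> Su; pose W := (<[u]> + U)%VS.
have WS w : w \in W -> S w.
  by case/memv_addP=> _ /vlineP[a ->] [u' /US Su' ->]; apply: SL.
have UW : U = W.
  apply/eqP; rewrite eqEdim addvSr /= maxU //; apply/asboolP.
  by exists W.
by rewrite UW; apply: (subvP (addvSl _ _)); exact: memv_line.
Qed.

End Span.

Section LieMatrix.
Variables (F : fieldType) (n : nat).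
Implicit Types (X Y : 'M[F]_n) (g a : {vspace 'M[F]_n}).

Definition bracket X Y : 'M[F]_n := X *m Y - Y *m X.

Definition derived g : {vspace 'M[F]_n} :=
  vspan [set Z | exists X Y, [/\ X \in g, Y \in g & Z = bracket X Y]].

Definition lie_center g : {vspace 'M[F]_n} :=
  vspan [set X | X \in g /\ forall Y, Y \in g -> bracket X Y = 0].

Definition lie_ideal g a :=
  (a <= g)%VS /\ forall X Y, X \in g -> Y \in a -> bracket X Y \in a.

Definition lie_abelian g :=
  forall X Y, X \in g -> Y \in g -> bracket X Y = 0.

Lemma lie_centerP g X : (X \in lie_center g) <->
  (X \in g /\ forall Y, Y \in g -> bracket X Y = 0).
Proof.
apply: (vspanP (S := fun X => X \in g /\ forall Y, Y \in g -> bracket X Y = 0)).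
  by split=> [|Y _]; rewrite ?mem0v // /bracket mul0mx mulmx0 subr0.
move=> c U W [Ug U0] [Wg W0]; split=> [|Y Yg]; first by rewrite memvD ?memvZ.
have /eqP := U0 Y Yg; have /eqP := W0 Y Yg.
rewrite /bracket !subr_eq0 => /eqP eW /eqP eU; apply/eqP.
by rewrite subr_eq0 mulmxDl mulmxDr -scalemxAl -scalemxAr eU eW.
Qed.

End LieMatrix.

Definition lie_morphism (F : fieldType) (m n : nat)
    (h : {vspace 'M[F]_m}) (g : {vspace 'M[F]_n}) (f : 'M[F]_m -> 'M[F]_n) :=
  [/\ forall X, X \in h -> f X \in g,
      forall (a : F) X Y, X \in h -> Y \in h -> f (a *: X + Y) = a *: f X + f Y
    & forall X Y, X \in h -> Y \in h -> f (bracket X Y) = bracket (f X) (f Y)].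

Definition lie_bijective (F : fieldType) (m n : nat)
    (h : {vspace 'M[F]_m}) (g : {vspace 'M[F]_n}) (f : 'M[F]_m -> 'M[F]_n) :=
  [/\ forall X, X \in h -> f X \in g,
      forall X Y, X \in h -> Y \in h -> f X = f Y -> X = Y
    & forall Y, Y \in g -> exists2 X, X \in h & f X = Y].

(* The projection onto the i-th summand along a direct sum decomposition
   (meaningful only when the sum is direct). *)
Definition summand_proj (F : fieldType) (vT : vectType F) (r : nat)
    (V : 'I_r -> {vspace vT}) (i : 'I_r) : vT -> vT :=
  sumv_pi_for (erefl (\sum_(k < r) V k)%VS) i.

(* Regular functions on GL_n are the polynomials in the n * n matrix entries
   and one further variable that stands for 1 / det. *)
Section RegularFunctions.
Variables (F : fieldType) (n : nat).

Definition gl_coord (A : 'M[F]_n) : 'I_(n * n + 1) -> F :=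
  row_mx (mxvec A) (\det A)^-1%:M 0.

(* Derivative at t = 0 of [gl_coord (1 + t X)]: 1 / det has derivative - tr
   at the identity. *)
Definition gl_tangent (X : 'M[F]_n) : 'I_(n * n + 1) -> F :=
  row_mx (mxvec X) (- \tr X)%:M 0.

Definition diff_at_1 (p : {mpoly F[n * n + 1]}) (X : 'M[F]_n) : F :=
  \sum_(k < n * n + 1) (mderiv k p).@[gl_coord 1%:M] * gl_tangent X k.

Lemma gl_tangent_linear a X Y k :
  gl_tangent (a *: X + Y) k = a * gl_tangent X k + gl_tangent Y k.
Proof.
rewrite /gl_tangent; case: (splitP k) => j jk.
  have -> : k = lshift 1 j by apply: val_inj.
  by rewrite !row_mxEl linearP !mxE.
have -> : k = rshift (n * n) j by apply: val_inj.
rewrite !row_mxEr !mxE !ord1 eqxx !mulr1n mxtraceD mxtraceZ.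
by rewrite opprD mulrN.
Qed.

Lemma diff_at_1_linear p a X Y :
  diff_at_1 p (a *: X + Y) = a * diff_at_1 p X + diff_at_1 p Y.
Proof.
rewrite /diff_at_1 mulr_sumr -big_split /=; apply: eq_bigr => k _.
by rewrite gl_tangent_linear mulrDr mulrCA.
Qed.

Lemma diff_at_1B p q X : diff_at_1 (p - q) X = diff_at_1 p X - diff_at_1 q X.
Proof.
rewrite /diff_at_1 -sumrB; apply: eq_bigr => k _.
by rewrite mderivB mevalB mulrBl.
Qed.

End RegularFunctions.

Section KGroups.
Variables (R : realType) (K : divringClosed R[i]).
Notation C := R[i].

Record Kgroup (n : nat) := MkKgroup {
  Kgroup_set :> 'M[C]_n -> Prop;
  Kgroup1 : Kgroup_set 1%:M;
  KgroupM : forall A B, Kgroup_set A -> Kgroup_set B -> Kgroup_set (A *m B);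
  KgroupV : forall A, Kgroup_set A -> Kgroup_set (invmx A);
  Kgroup_zeros : exists ps : seq {mpoly C[n * n]},
    (forall p, p \in ps -> p \is a mpolyOver (n * n) K) /\
    (forall A, Kgroup_set A <->
       A \in unitmx /\ forall p, p \in ps -> p.@[mxvec A 0] = 0)
}.

(* The tangent space at the identity, cut out by the differentials of all
   complex regular functions on GL_n vanishing on G. *)
Definition Lie n (G : Kgroup n) : {vspace 'M[C]_n} :=
  vspan [set X | forall p : {mpoly C[n * n + 1]},
    (forall A, G A -> p.@[gl_coord A] = 0) -> diff_at_1 p X = 0].

Lemma LieP n (G : Kgroup n) X : (X \in Lie G) <->
  (forall p : {mpoly C[n * n + 1]},
    (forall A, G A -> p.@[gl_coord A] = 0) -> diff_at_1 p X = 0).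
Proof.
apply: (vspanP (S := fun X => forall p : {mpoly C[n * n + 1]},
  (forall A, G A -> p.@[gl_coord A] = 0) -> diff_at_1 p X = 0)).
  move=> p _; have := diff_at_1_linear p (-1) 0 0.
  by rewrite scaler0 addr0 mulN1r addNr.
by move=> a U W U0 W0 p p0; rewrite diff_at_1_linear U0 // W0 // mulr0 addr0.
Qed.

(* A K-morphism comes with regular functions over K presenting its matrix
   entries; by [Kdiff_unique] its differential on [Lie G] depends only on the
   induced map. *)
Definition reg_map m n (f : 'I_n -> 'I_n -> {mpoly C[m * m + 1]})
    (A : 'M[C]_m) : 'M[C]_n :=
  \matrix_(i, j) (f i j).@[gl_coord A].

Record Kmorphism m n (G : Kgroup m) (H : Kgroup n) := MkKmorphism {
  Kmor_poly : 'I_n -> 'I_n -> {mpoly C[m * m + 1]};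
  Kmor_over : forall i j, Kmor_poly i j \is a mpolyOver (m * m + 1) K;
  Kmor_in : forall A, G A -> H (reg_map Kmor_poly A);
  Kmor_M : forall A B, G A -> G B ->
    reg_map Kmor_poly (A *m B) = reg_map Kmor_poly A *m reg_map Kmor_poly B
}.

Definition Kmor_fun m n (G : Kgroup m) (H : Kgroup n) (Phi : Kmorphism G H) :=
  reg_map (Kmor_poly Phi).
Coercion Kmor_fun : Kmorphism >-> Funclass.

Definition Kdiff m n (G : Kgroup m) (H : Kgroup n) (Phi : Kmorphism G H)
    (X : 'M[C]_m) : 'M[C]_n :=
  \matrix_(i, j) diff_at_1 (Kmor_poly Phi i j) X.

Lemma Kdiff_unique m n (G : Kgroup m) (H : Kgroup n) (Phi Psi : Kmorphism G H) :
  (forall A, G A -> Phi A = Psi A) ->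
  forall X, X \in Lie G -> Kdiff Phi X = Kdiff Psi X.
Proof.
move=> eqPP X /LieP LX; apply/matrixP=> i j; rewrite !mxE; apply/eqP.
rewrite -subr_eq0 -diff_at_1B LX // => A GA.
by have /matrixP/(_ i j) := eqPP A GA; rewrite !mxE mevalB => ->; rewrite subrr.
Qed.

Definition Kalgebraic m n (G : Kgroup m) (H : Kgroup n)
    (f : 'M[C]_m -> 'M[C]_n) :=
  lie_morphism (Lie G) (Lie H) f /\
  exists Phi : Kmorphism G H, forall X, X \in Lie G -> f X = Kdiff Phi X.

Definition Kalgebraic_iso m n (G : Kgroup m) (H : Kgroup n)
    (f : 'M[C]_m -> 'M[C]_n) :=
  Kalgebraic G H f /\ lie_bijective (Lie G) (Lie H) f.

Definition Ksubgroup n (H G : Kgroup n) := forall A, H A -> G A.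

Definition Kalgebraic_ideal n (G : Kgroup n) (a : {vspace 'M[C]_n}) :=
  lie_ideal (Lie G) a /\ exists H : Kgroup n, Ksubgroup H G /\ Lie H = a.

Definition Kindecomposable n (G : Kgroup n) :=
  ~ exists a b : {vspace 'M[C]_n},
      [/\ Kalgebraic_ideal G a /\ Kalgebraic_ideal G b,
          a != 0%VS /\ b != 0%VS,
          Lie G = (a + b)%VS & directv (a + b)].

(* G is the internal direct product of the Gs i, as an algebraic group: the
   factors commute and the multiplication map from their product to G has an
   inverse, whose components p i are K-morphisms. *)
Definition Kdirect_product n (G : Kgroup n) r (Gs : 'I_r -> Kgroup n) :=
  [/\ forall i, Ksubgroup (Gs i) G,
      forall i k A B, i != k -> Gs i A -> Gs k B -> A *m B = B *m A
    & exists p : forall i, Kmorphism G (Gs i),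
        (forall A, G A -> \big[mulmx/1%:M]_(i < r) p i A = A) /\
        (forall B : 'I_r -> 'M[C]_n, (forall i, Gs i (B i)) ->
           forall i, p i (\big[mulmx/1%:M]_(k < r) B k) = B i)].

Definition lie_decomposition n (G : Kgroup n) r (Gs : 'I_r -> Kgroup n) :=
  [/\ Lie G = (\sum_(i < r) Lie (Gs i))%VS,
      directv (\sum_(i < r) Lie (Gs i))
    & forall i, Kalgebraic_ideal G (Lie (Gs i))].

End KGroups.

(* Main.v *)
Require Import Defs.
From HB Require Import structures.
From mathcomp Require Import all_boot all_order all_algebra.
From mathcomp Require Import fingroup perm mpoly complex.
From mathcomp Require Import zify ring lra.
From mathcomp Require Import boolp classical_sets reals.

(** A Krull-Schmidt argument. The projections pi_i and rho_j of the Lie algebra g of G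
    are differentials of K-endomorphisms of G and commute with all adjoint maps. Such
    endomorphisms of g are closed under composition ([normal_endomorphism]); let W be
    the set of them.

    The heart is Fitting's lemma ([fitting]): such an endomorphism phi of an
    indecomposable factor is nilpotent or bijective, because for large k the Lie
    algebra is the direct sum of the kernel and the image of the k-th power of phi, and
    both are K-algebraic ideals. Hence pi_i w pi_i is nilpotent or bijective on g_i for
    w in W, and likewise for the h_j.

    The matching is linear algebra over traces ([matching]). If rho_j and pi_i do not
    induce a bijection between h_j and g_i, then all products of rho_j pi_i with words
    have trace zero. For a set of indices i whose bijective partners j all lie in a set
    B, the product of the sum of these pi_i and the sum of the rho_j outside B is
    therefore nilpotent, which bounds the dimension of the sum of these g_i by that of
    the sum of the h_j with j in B ([rank_le_neighbours]). For summands of equal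
    dimension this is Hall's condition, and Hall's theorem gives injections both ways,
    hence a permutation. Once pi_i maps h_j bijectively onto g_i, moving projections
    between the arguments of a bracket gives the equality of the derived algebras and
    the statement on centres ([matched_derived], [matched_center]). If g_i is not
    abelian, its derived algebra is nonzero and lies in h_j: this determines j, and
    shows that rho_j pi_i rho_j is not nilpotent ([nonabelian_converse]).

    It remains to see that kernels and images are algebraic, which is done without
    exponential maps. To a subspace L of g belongs the ideal of the polynomials all of
    whose derivatives along left-invariant vector fields from L vanish at the identity
    ([jet_ideal]). It is prime ([prime_jet_ideal]), so a Nullstellensatz for prime
    ideals, which has a short proof over an uncountable field, describes it by its zeros
    ([jet_point]). For a kernel L this shows that the kernel subgroup has Lie algebra L
    ([kernel_algebraic]). For an image L with phi(L) = L, the zeros of the ideal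
    form a group, and a tangent vector of this group outside L would give a nonzero
    derivation that kills the image of the comorphism of phi. This is impossible, since
    a count of dimensions in bounded degree shows that all functions are algebraic over
    this image ([lder_dominant_eq0], [tangent_image]). The group is defined over K
    because its ideal is stable under all automorphisms of the field over K, whose fixed
    field is K ([exists_automorphism_moving], [finite_equations], [image_algebraic]). *)

Set Implicit Arguments.
Unset Strict Implicit.
Unset Printing Implicit Defensive.
Import Order.TTheory GRing.Theory Num.Theory.
Local Open Scope ring_scope.

(** * Field automorphisms that move a given element *)

Section Zorn.
Local Open Scope classical_set_scope.

(** Zorn's lemma is applied to the sets A0 `|` X rather than to the sets of the
    family, so that the chain condition has to be checked on nonempty chains only. *)
Lemma zorn_above (T : Type) (P : set (set T)) (A0 : set T) : P A0 ->
  (forall F : set (set T), F !=set0 -> F `<=` P -> total_on F subset ->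
     P (\bigcup_(X in F) X)) ->
  exists A, [/\ P A, A0 `<=` A & forall B, P B -> A `<=` B -> B `<=` A].
Proof.
move=> PA0 Pchain.
have [F FQ totF|A [PA maxA]] := @Zorn_bigcup T [set X | P (A0 `|` X)].
  have [[X0 FX0]|F0] := pselect (F !=set0); last first.
    suff -> : \bigcup_(X in F) X = set0 by rewrite /= setU0.
    by apply/seteqP; split=> // x [X FX]; case: F0; exists X.
  rewrite /=; have -> : A0 `|` \bigcup_(X in F) X =
      \bigcup_(Y in [set A0 `|` X | X in F]) Y.
    apply/seteqP; split=> [x [A0x|[X FX Xx]]|x [_ [X FX <-] [A0x|Xx]]].
    - by exists (A0 `|` X0); [exists X0 | left].
    - by exists (A0 `|` X); [exists X | right].
    - by left.
    - by right; exists X.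
  apply: Pchain; first by exists (A0 `|` X0), X0.
  - by move=> _ [X FX <-]; exact: FQ.
  move=> _ _ [X FX <-] [Y FY <-].
  by case: (totF _ _ FX FY) => ?; [left|right]; exact: setUS.
exists (A0 `|` A); split=> // B PB AB; apply: contrapT => nBA.
apply: (maxA B); last first.
  by rewrite /= (_ : A0 `|` B = B) //; apply/setUidPr => x A0x; apply: AB; left.
split=> [x Ax|BA]; first by apply: AB; right.
by apply: nBA => x /BA; right.
Qed.

Lemma bigcup_chain2 (T : Type) (F : set (set T)) x y :
  total_on F subset -> (\bigcup_(X in F) X) x -> (\bigcup_(X in F) X) y ->
  exists X, [/\ F X, X x & X y].
Proof.
move=> totF [X FX Xx] [Y FY Yy]; have [XY|YX] := totF X Y FX FY.
  by exists Y; split=> //; exact: XY.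
by exists X; split=> //; exact: YX.
Qed.

End Zorn.

Section FieldAutomorphisms.
Variable C : numClosedFieldType.

Lemma poly_eq0_points (p : {poly C}) : (forall x, p.[x] = 0) -> p = 0.
Proof.
move=> p0; apply/eqP; apply: contraTT isT => nz.
pose s := [seq i%:R : C | i <- iota 0 (size p)].
have := @max_poly_roots _ p s nz; rewrite size_map size_iota ltnn; apply.
  by apply/allP => x _; rewrite rootE p0.
by rewrite map_inj_uniq ?iota_uniq //; exact: mulrIn (oner_neq0 _).
Qed.

Lemma expr_homog (a b : C) i e : b != 0 -> (i <= e)%N ->
  a ^+ i * b ^+ (e - i) = b ^+ e * (a / b) ^+ i.
Proof.
move=> b0 le_ie; rewrite expr_div_n mulrCA; congr (_ * _).
by rewrite -{2}(subnK le_ie) exprD mulfK ?expf_neq0.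
Qed.

Definition algebraic_over (F : {pred C}) (a : C) :=
  exists p : {poly C}, [/\ p \is a polyOver F, p != 0 & p.[a] = 0].

Lemma divringClosed_of (P : C -> Prop) :
  P 1 -> (forall x y, P x -> P y -> P (x - y)) ->
  (forall x y, P x -> P y -> P (x / y)) ->
  exists F : divringClosed C, forall x, x \in F <-> P x.
Proof.
move=> P1 PB PV; pose F0 : {pred C} := fun x => `[< P x >].
have F0P : divring_closed F0.
  by split=> [|x y|x y]; rewrite -!topredE /=;
    [exact/asboolP | move=> /asboolP ? /asboolP ?; exact/asboolP/PB
    | move=> /asboolP ? /asboolP ?; exact/asboolP/PV].
pose F1 := GRing.isDivringClosed.Build C F0 F0P.
pose F : divringClosed C := HB.pack F0 F1.
by exists F => x; rewrite -topredE /=; split=> /asboolP.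
Qed.

Lemma subringClosed_of (A : nzRingType) (P : A -> Prop) :
  P 1 -> (forall x y, P x -> P y -> P (x - y)) ->
  (forall x y, P x -> P y -> P (x * y)) ->
  exists G : subringClosed A, forall x, x \in G <-> P x.
Proof.
move=> P1 PB PM; pose G0 : {pred A} := fun x => `[< P x >].
have G0P : subring_closed G0.
  by split=> [|x y|x y]; rewrite -!topredE /=;
    [exact/asboolP | move=> /asboolP ? /asboolP ?; exact/asboolP/PB
    | move=> /asboolP ? /asboolP ?; exact/asboolP/PM].
pose G1 := GRing.isSubringClosed.Build A G0 G0P.
pose G : subringClosed A := HB.pack G0 G1.
by exists G => x; rewrite -topredE /=; split=> /asboolP.
Qed.

Lemma adjoin_subfield (F : divringClosed C) (d : C) :
  exists E : divringClosed C, forall x, x \in E <->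
    exists p q, [/\ p \is a polyOver F, q \is a polyOver F, q.[d] != 0
                  & x = p.[d] / q.[d]].
Proof.
apply: divringClosed_of.
- exists 1, 1; rewrite !rpred1 hornerC divr1; split=> //; exact: oner_neq0.
- move=> _ _ [p [q [Fp Fq q0 ->]]] [p' [q' [Fp' Fq' q'0 ->]]].
  exists (p * q' - p' * q), (q * q').
  rewrite rpredB ?rpredM // hornerM mulf_neq0 // hornerD hornerN !hornerM.
  by split=> //; rewrite -mulNr addf_div // mulNr.
- move=> _ _ [p [q [Fp Fq q0 ->]]] [p' [q' [Fp' Fq' q'0 ->]]].
  have [p'0|p'0] := eqVneq p'.[d] 0.
    by exists 0, 1; rewrite p'0 mul0r invr0 mulr0 rpred0 rpred1 !hornerE oner_neq0.
  exists (p * q'), (q * p'); rewrite !rpredM // !hornerM mulf_neq0 //.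
  by split=> //; rewrite invf_div mulf_div.
Qed.

Section Maximal.
Variables (F : divringClosed C) (c : C).
Hypothesis cF : c \notin F.
Hypothesis maxF : forall E : divringClosed C,
  {subset F <= E} -> c \notin E -> {subset E <= F}.

Lemma adjoin_max d : d \notin F -> exists p q,
  [/\ p \is a polyOver F, q \is a polyOver F, q.[d] != 0 & c = p.[d] / q.[d]].
Proof.
move=> dF; have [E EP] := adjoin_subfield F d; apply/EP.
apply: contraNT dF => cE; apply: (maxF _ cE).
  move=> x Fx; apply/EP; exists x%:P, 1.
  by rewrite polyOverC rpred1 Fx !hornerC divr1 oner_neq0.
by apply/EP; exists 'X, 1; rewrite polyOverX rpred1 hornerX hornerC divr1 oner_neq0.
Qed.

(** A subfield F that is maximal among those that avoid c has the whole field
    algebraic over it, because c lies in F(d) for every d outside F. For d = c ^ 2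
    this gives an equation c * q(c ^ 2) = p(c ^ 2), which is not trivial since its two
    sides have different parity. For a general d write c = p(d) / q(d): an equation r of c
    over F becomes the equation q ^ deg r * r(p / q) of d. If this vanished, p would
    be a constant multiple z * q as a polynomial, and c = z a quotient of
    coefficients in F. *)
Lemma max_algebraic d : algebraic_over F d.
Proof.
have algF x : x \in F -> algebraic_over F x.
  move=> Fx; exists ('X - x%:P).
  by rewrite polyOverXsubC Fx polyXsubC_eq0 hornerXsubC subrr.
have algc : algebraic_over F c.
  have [c2F|/adjoin_max[p [q [Fp Fq q0 cE]]]] := boolP (c ^+ 2 \in F).
    exists ('X^2 - (c ^+ 2)%:P).
    by rewrite rpredB ?rpredX ?polyOverX ?polyOverC // -size_poly_gt0 size_XnsubC
      // !hornerE subrr.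
  have {}cE : c * q.[c ^+ 2] = p.[c ^+ 2] by rewrite {1}cE divfK.
  exists ((q \Po 'X^2) * 'X - (p \Po 'X^2)); split.
  - have FX : ('X^2 : {poly C}) \is a polyOver F by rewrite rpredX ?polyOverX.
    by rewrite rpredB ?rpredM ?polyOverX ?polyOver_comp.
  - have q_neq0 : q != 0 by apply: contraNneq q0 => ->; rewrite horner0.
    apply: contraNneq q_neq0 => /(congr1 (fun t : {poly C} => t`_(size q).-1.*2.+1)).
    rewrite coefB coefMX /= !comp_poly_Xn // !coef_poly dvdn2 /= odd_double dvdn2 /= odd_double if_same.
    rewrite subr0 coef0 -muln2 mulnK // ltn_mul2r /=.
    have [->//|q_neq0] := eqVneq q 0.
    by rewrite prednK ?size_poly_gt0 // leqnn => /eqP; rewrite lead_coef_eq0 (negPf q_neq0).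
  - by rewrite hornerD hornerN hornerMX !horner_comp !hornerXn mulrC cE subrr.
have [dF|/adjoin_max[p [q [Fp Fq q0 cE]]]] := boolP (d \in F); first exact: algF.
have [r [Fr r0 rc]] := algc; have [rs rE] := closed_field_poly_normal r.
exists (\sum_(i < size r) r`_i *: (p ^+ i * q ^+ ((size r).-1 - i))); split.
- rewrite rpred_sum // => i _; rewrite polyOverZ ?rpredM ?rpredX //.
  exact: (polyOverP Fr).
- apply: contraNneq cF => s0.
  have homE z : q.[z] != 0 ->
      (\sum_(i < size r) r`_i *: (p ^+ i * q ^+ ((size r).-1 - i))).[z] =
      q.[z] ^+ (size r).-1 * r.[p.[z] / q.[z]].
    move=> qz; rewrite horner_sum (horner_coef r) mulr_sumr; apply: eq_bigr => i _.
    rewrite hornerZ hornerM !horner_exp [RHS]mulrCA; congr (_ * _).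
    have le_i : (i <= (size r).-1)%N by rewrite -ltnS prednK ?size_poly_gt0.
    exact: expr_homog.
  have : (\prod_(z <- rs) (p - z *: q)) * q = 0.
    apply: poly_eq0_points => z; rewrite hornerM; have [->|qz] := eqVneq q.[z] 0.
      exact: mulr0.
    have := homE z qz; rewrite s0 horner0 => /esym/eqP.
    rewrite mulf_eq0 expf_eq0 (negPf qz) andbF /= rE hornerZ mulf_eq0 lead_coef_eq0.
    rewrite (negPf r0) /= horner_prod prodf_seq_eq0 => /hasP[t trs] /=.
    rewrite hornerXsubC subr_eq0 => /eqP pq; rewrite horner_prod (big_rem t) //=.
    by rewrite !hornerE -pq divfK // subrr !mul0r.
  have q_neq0 : q != 0 by apply: contraNneq q0 => ->; rewrite horner0.
  move/eqP; rewrite mulf_eq0 (negPf q_neq0) orbF prodf_seq_eq0 => /hasP[t _] /=.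
  rewrite subr_eq0 => /eqP pE.
  have -> : c = p`_(size q).-1 / lead_coef q.
    by rewrite cE pE hornerZ coefZ !mulfK // lead_coef_eq0.
  by rewrite rpred_div //; apply: (polyOverP _).
- rewrite horner_sum; transitivity (q.[d] ^+ (size r).-1 * r.[c]); last first.
    by rewrite rc mulr0.
  rewrite (horner_coef r) mulr_sumr; apply: eq_bigr => i _.
  rewrite hornerZ hornerM !horner_exp [RHS]mulrCA; congr (_ * _).
  have le_i : (i <= (size r).-1)%N by rewrite -ltnS prednK ?size_poly_gt0.
  by rewrite cE; exact: expr_homog.
Qed.
End Maximal.

Lemma exists_max_subfield (K : divringClosed C) c : c \notin K ->
  exists F : divringClosed C, [/\ {subset K <= F}, c \notin F &
    forall E : divringClosed C, {subset F <= E} -> c \notin E -> {subset E <= F}].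
Proof.
move=> cK; pose P (X : set C) :=
  exists E : divringClosed C, c \notin E /\ forall x, x \in E <-> X x.
have [||A [[E [cE EA]] KA maxA]] := @zorn_above C P [set x | x \in K].
- by exists K.
- move=> G [X0 GX0] GP totG.
  have cl2 (f : C -> C -> C) : (forall X x y, P X -> X x -> X y -> X (f x y)) ->
      forall x y, (\bigcup_(X in G) X)%classic x -> (\bigcup_(X in G) X)%classic y ->
      (\bigcup_(X in G) X)%classic (f x y).
    move=> fP x y Gx Gy; have [X [GX Xx Xy]] := bigcup_chain2 totG Gx Gy.
    by exists X => //; apply: fP => //; exact: GP.
  have [E EP] : exists E : divringClosed C, forall x, x \in E <->
      (\bigcup_(X in G) X)%classic x.
    apply: divringClosed_of.
    - by exists X0 => //; have [E [_ EX]] := GP _ GX0; apply/EX/rpred1.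
    - by apply: cl2 => X x y [E [_ EX]] /EX ? /EX ?; apply/EX/rpredB.
    - by apply: cl2 => X x y [E [_ EX]] /EX ? /EX ?; apply/EX/rpred_div.
  exists E; split=> //; apply/negP => /EP[X GX Xc].
  by have [E' [cE' EX]] := GP _ GX; move/EX: Xc; apply/negP.
exists E; split=> // [x Kx|E' EE' cE' x E'x]; first exact/EA/KA.
suff E'A : ([set y | y \in E'] `<=` A)%classic by apply/EA/E'A.
by apply: maxA => [|y /EA/EE'//]; exists E'.
Qed.

Section PartialHom.
Variable F : divringClosed C.
Hypothesis algF : forall d, algebraic_over F d.

(** The graph of a homomorphism to C, the identity on F, from a subring of C that
    contains F. Graphs are subrings of C * C, so that extending a homomorphism is
    enlarging a subring, and unions of chains come for free. *)
Definition partial_hom (G : subringClosed (C * C)%type) :=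
  (forall x, x \in F -> (x, x) \in G) /\ (forall y, (0, y) \in G -> y = 0).

Lemma algF_nz d : d != 0 ->
  exists p : {poly C}, [/\ p \is a polyOver F, p.[d] = 0 & p`_0 != 0].
Proof.
move=> d0; have [p [Fp p0 pd]] := algF d; elim/poly_ind: p Fp p0 pd => [|p a IH].
  by rewrite eqxx.
have [->|a0] := eqVneq a 0; last first.
  by move=> Fp _ pd; exists (p * 'X + a%:P); rewrite coefD coefMX coefC /= add0r.
rewrite addr0 => FpX pX /eqP; rewrite hornerMX mulf_eq0 (negPf d0) orbF => /eqP.
apply: IH; last by apply: contraNneq pX => ->; rewrite mul0r.
by apply/polyOverP => i; have := polyOverP FpX i.+1; rewrite coefMX.
Qed.

Lemma poly_pair (T : {poly C * C}) (x : C * C) :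
  T.[x] = ((map_poly fst T).[x.1], (map_poly snd T).[x.2]).
Proof. by apply: injective_projections => /=; rewrite horner_map. Qed.

Lemma diag_poly (G : subringClosed (C * C)%type) (p : {poly C}) x :
  (forall x, x \in F -> (x, x) \in G) -> p \is a polyOver F -> x \in G ->
  (p.[x.1], p.[x.2]) \in G.
Proof.
move=> FG Fp Gx; pose T : {poly C * C} := \poly_(i < size p) (p`_i, p`_i).
have TG : T \is a polyOver G.
  by apply/polyOverP => i; rewrite coef_poly; case: ifP => _;
    [exact/FG/(polyOverP Fp) | exact: rpred0].
have := rpred_horner TG Gx; rewrite poly_pair; congr ((_.[_], _.[_]) \in G).
- apply/polyP => i; rewrite coef_map_id0 // coef_poly; case: ltnP => //= le_i.
  by rewrite nth_default.
- apply/polyP => i; rewrite coef_map_id0 // coef_poly; case: ltnP => //= le_i.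
  by rewrite nth_default.
Qed.

(** An equation over F of a nonzero x, with nonzero constant term, is satisfied by
    the image of x as well, which is thus nonzero. *)
Lemma partial_hom_inj (G : subringClosed (C * C)%type) x y :
  partial_hom G -> (x, y) \in G -> (x == 0) = (y == 0).
Proof.
move=> [FG G0] Gxy; have [x0|x0] := eqVneq x 0.
  by rewrite (G0 y) ?eqxx // -x0.
have [p [Fp px p0]] := algF_nz x0; apply/esym/negP => /eqP y0.
have := diag_poly FG Fp Gxy; rewrite /= px y0 horner_coef0 => /G0/eqP.
exact/negP.
Qed.

(** A substitute for the minimal polynomial of d over the domain of the homomorphism,
    which need not be a field. *)
Definition minimal_at (G : {pred C * C}) (T : {poly C * C}) d :=
  [/\ T \is a polyOver G, T != 0, (map_poly fst T).[d] = 0 &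
    forall T', T' \is a polyOver G -> (map_poly fst T').[d] = 0 ->
      (size T' < size T)%N -> T' = 0].

Lemma exists_minimal_at (G : subringClosed (C * C)%type) d :
  partial_hom G -> exists T, minimal_at G T d.
Proof.
move=> [FG _]; pose Q k := `[< exists T : {poly C * C}, [/\ T \is a polyOver G,
  T != 0, (map_poly fst T).[d] = 0 & size T = k] >].
have exQ : exists k, Q k.
  have [p [Fp p0 pd]] := algF d; pose T : {poly C * C} := map_poly (fun a => (a, a)) p.
  have TE i : T`_i = (p`_i, p`_i) by rewrite coef_map_id0.
  exists (size T); apply/asboolP; exists T; split=> //.
  - by apply/polyOverP => i; rewrite TE; apply/FG/(polyOverP Fp).
  - apply: contraNneq p0 => T0; apply/eqP/polyP => i.
    by have /(congr1 fst) := TE i; rewrite T0 !coef0.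
  - have -> : map_poly fst T = p by apply/polyP => i; rewrite coef_map TE.
    by [].
case: (ex_minnP exQ) => k /asboolP[T [GT T0 Td sT]] minT.
exists T; split=> // T' GT' T'd; rewrite sT ltnNge => lt.
apply/eqP; apply: contraNT lt => T'0; apply: minT.
by apply/asboolP; exists T'.
Qed.

Lemma partial_hom_lead (G : subringClosed (C * C)%type) (T : {poly C * C}) :
  partial_hom G -> T \is a polyOver G -> T != 0 ->
  (lead_coef T).1 != 0 /\ (lead_coef T).2 != 0.
Proof.
move=> GP GT T0; have GlT : lead_coef T \in G by apply: (polyOverP GT).
have eqT : ((lead_coef T).1 == 0) = ((lead_coef T).2 == 0).
  by apply: partial_hom_inj GP _; rewrite -surjective_pairing.
suff lT : (lead_coef T).1 != 0 by split=> //; rewrite -eqT.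
apply: contra T0 => lT; rewrite -lead_coef_eq0; apply/eqP.
by apply: injective_projections; apply/eqP; rewrite -?eqT.
Qed.

(** The pair (d, d') can be adjoined as soon as d' is a zero of the transported
    minimal polynomial of d: by pseudo-division, a polynomial over the graph whose
    first component vanishes at d has a second component that vanishes at d'. *)
Lemma partial_hom_adjoin (G : subringClosed (C * C)%type) T d d' :
  partial_hom G -> minimal_at G T d -> (map_poly snd T).[d'] = 0 ->
  exists G' : subringClosed (C * C)%type,
    [/\ partial_hom G', {subset G <= G'} & (d, d') \in G'].
Proof.
move=> GP [GT T0 Td minT] Td'; have [lT1 lT2] := partial_hom_lead GP GT T0.
have vanish T' : T' \is a polyOver G -> (map_poly fst T').[d] = 0 ->
    (map_poly snd T').[d'] = 0.
  move: {2}(size T') (leqnn (size T')) => k; elim: k T' => [|k IH] T' sT' GT' T'd.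
    by move: sT'; rewrite size_poly_leq0 => /eqP->; rewrite rmorph0 horner0.
  have [/minT|le_T] := ltnP (size T') (size T).
    by move=> -> //; rewrite rmorph0 horner0.
  pose U := lead_coef T *: T' - T'`_k *: ('X^(k.+1 - size T) * T).
  have GU : U \is a polyOver G.
    by rewrite rpredB ?polyOverZ ?rpredM ?rpredX ?polyOverX //; apply: (polyOverP _).
  have le_Tk : (size T <= k.+1)%N by exact: leq_trans le_T sT'.
  have sU : (size U <= k)%N.
    apply/leq_sizeP => j le_kj; rewrite coefB !coefZ coefXnM.
    have T_gt0 : (0 < size T)%N by rewrite size_poly_gt0.
    have -> : (j < k.+1 - size T)%N = false by lia.
    have [->|ne_jk] := eqVneq j k.
      have -> : (k - (k.+1 - size T))%N = (size T).-1 by lia.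
      by rewrite mulrC subrr.
    have lt_kj : (k < j)%N by lia.
    have le_T' : (size T <= j - (k.+1 - size T))%N by lia.
    by rewrite [T'`_j]nth_default ?(leq_trans sT') // mulr0 [X in _ * X]nth_default // mulr0 subrr.
  pose x := (d, d').
  have Tx : T.[x] = 0 by rewrite poly_pair Td Td'.
  have Ux : U.[x] = lead_coef T * T'.[x].
    by rewrite hornerD hornerN !hornerZ hornerM Tx !mulr0 subr0.
  have Ud : (map_poly fst U).[d] = 0.
    by have /(congr1 fst) := Ux; rewrite !poly_pair /= T'd mulr0.
  have Ud' := IH U sU GU Ud; have /(congr1 snd) := Ux; rewrite !poly_pair /= Ud'.
  by move/esym/eqP; rewrite mulf_eq0 (negPf lT2) => /eqP.
have [G' G'P] : exists G' : subringClosed (C * C)%type, forall z, z \in G' <->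
    exists2 U, U \is a polyOver G & z = U.[(d, d')].
  apply: subringClosed_of.
  - by exists 1; rewrite ?rpred1 ?hornerC.
  - move=> _ _ [U GU ->] [V GV ->]; exists (U - V); first exact: rpredB.
    by rewrite hornerD hornerN.
  - move=> _ _ [U GU ->] [V GV ->]; exists (U * V); first exact: rpredM.
    by rewrite hornerM.
exists G'; split.
- split=> [a Fa|y /G'P[U GU]].
    apply/G'P; exists (a, a)%:P; last by rewrite hornerC.
    by rewrite polyOverC; apply: GP.1.
  by rewrite poly_pair => -[/esym /(vanish _ GU)-> ->].
- by move=> z Gz; apply/G'P; exists z%:P; rewrite ?polyOverC ?hornerC.
- by apply/G'P; exists 'X; rewrite ?polyOverX ?hornerX.
Qed.

Lemma size_map_partial_hom (G : subringClosed (C * C)%type) (T : {poly C * C}) :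
  partial_hom G -> T \is a polyOver G ->
  size (map_poly fst T) = size T /\ size (map_poly snd T) = size T.
Proof.
move=> GP GT; have [->|T0] := eqVneq T 0; first by rewrite !rmorph0 !size_poly0.
have [l1 l2] := partial_hom_lead GP GT T0.
by split; exact: size_poly_eq.
Qed.

Lemma size_minimal_at (G : subringClosed (C * C)%type) T d :
  partial_hom G -> minimal_at G T d -> (1 < size T)%N.
Proof.
move=> GP [GT T0 Td _]; have [<- _] := size_map_partial_hom GP GT.
apply: (@root_size_gt1 _ d); last by rewrite rootE Td.
by rewrite -size_poly_gt0 (size_map_partial_hom GP GT).1 size_poly_gt0.
Qed.

Lemma partial_hom_extend (G : subringClosed (C * C)%type) d : partial_hom G ->
  exists d' (G' : subringClosed (C * C)%type),
    [/\ partial_hom G', {subset G <= G'} & (d, d') \in G'].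
Proof.
move=> GP; have [T minT] := exists_minimal_at d GP; have [GT _ _ _] := minT.
have /closed_rootP[d' /eqP Td'] : size (map_poly snd T) != 1%N.
  rewrite (size_map_partial_hom GP GT).2.
  by rewrite neq_ltn (size_minimal_at GP minT) orbT.
by exists d'; exact: partial_hom_adjoin Td'.
Qed.

(** The image of c is a zero of its minimal polynomial other than c itself. There is
    one because the minimal polynomial is not linear, c being outside F, and its zero
    c is simple, the derivative being a shorter polynomial. *)
Lemma partial_hom_moving c : c \notin F ->
  exists c' (G : subringClosed (C * C)%type),
    [/\ partial_hom G, (c, c') \in G & c' != c].
Proof.
move=> cF.
have [G GE] : exists G : subringClosed (C * C)%type, forall z, z \in G <->
    exists2 x, x \in F & z = (x, x).
  apply: subringClosed_of.
  - by exists 1; rewrite ?rpred1.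
  - by move=> _ _ [x Fx ->] [y Fy ->]; exists (x - y); rewrite ?rpredB.
  - by move=> _ _ [x Fx ->] [y Fy ->]; exists (x * y); rewrite ?rpredM.
have GP : partial_hom G.
  by split=> [x Fx|y /GE[x _ [<- ->]]//]; apply/GE; exists x.
have [T minT] := exists_minimal_at c GP; have [GT T0 Tc minT'] := minT.
have [sP sP2] := size_map_partial_hom GP GT; have sT := size_minimal_at GP minT.
pose P := map_poly fst T.
have TP : map_poly snd T = P.
  apply/polyP => i; rewrite !coef_map /=.
  by have /GE[x _ ->] : T`_i \in G by apply: (polyOverP GT).
have FP i : P`_i \in F.
  rewrite coef_map /=.
  by have /GE[x Fx ->] : T`_i \in G by apply: (polyOverP GT).
have P'c : P^`().[c] != 0.
  apply/negP => /eqP P'c; have GT' : T^`() \is a polyOver G by exact: polyOver_deriv.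
  have : T^`() = 0.
    by apply: minT' => //; [rewrite -deriv_map | exact: lt_size_deriv].
  move/(congr1 (map_poly fst)); rewrite -deriv_map rmorph0 -/P => P'0.
  have [k sTk] : exists k, size T = k.+2.
    by case: (size T) sT => [|[|k]] // _; exists k.
  have := coef_deriv P k; rewrite P'0 coef0 => /esym/eqP; rewrite mulrn_eq0 /=.
  have -> : P`_k.+1 = lead_coef P by rewrite lead_coefE sP sTk.
  by rewrite lead_coef_eq0 -size_poly_eq0 sP sTk.
have [Q PQ] : exists Q, P = Q * ('X - c%:P) by apply/factor_theorem; rewrite /root Tc.
have Qc : Q.[c] != 0.
  by move: P'c; rewrite PQ derivM derivXsubC hornerD !hornerM !hornerE subrr mulr0 add0r.
have [sQ|/closed_rootP[c' Qc']] := eqVneq (size Q) 1%N.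
  have /size_poly1P[a a0 QE] : size Q == 1%N by rewrite sQ.
  have := FP 0%N; have := FP 1%N.
  rewrite PQ QE mul_polyC !coefZ !coefB !coefX !coefC /= subr0 mulr1 sub0r mulrN.
  rewrite rpredN => Fa Fac; case/negP: cF.
  by rewrite -(mulKf a0 c) mulrC rpred_div.
have c'P : (map_poly snd T).[c'] = 0 by rewrite TP PQ hornerM (eqP Qc') mul0r.
have [G' [G'P _ G'c]] := partial_hom_adjoin GP minT c'P.
by exists c', G'; split=> //; apply: contraNneq Qc => <-; rewrite (eqP Qc').
Qed.

Lemma partial_hom_total (G0 : subringClosed (C * C)%type) : partial_hom G0 ->
  exists G : subringClosed (C * C)%type, [/\ partial_hom G, {subset G0 <= G} &
    forall d, exists d', (d, d') \in G].
Proof.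
move=> G0P; pose P (X : set (C * C)) := exists G : subringClosed (C * C)%type,
  partial_hom G /\ forall z, z \in G <-> X z.
have [||A [[G [GP GA]] G0A maxA]] := @zorn_above _ P [set z | z \in G0].
- by exists G0.
- move=> S [X0 SX0] SP totS.
  have cl2 (f : C * C -> C * C -> C * C) :
      (forall X x y, P X -> X x -> X y -> X (f x y)) ->
      forall x y, (\bigcup_(X in S) X)%classic x -> (\bigcup_(X in S) X)%classic y ->
      (\bigcup_(X in S) X)%classic (f x y).
    move=> fP x y Sx Sy; have [X [SX Xx Xy]] := bigcup_chain2 totS Sx Sy.
    by exists X => //; apply: fP => //; exact: SP.
  have [G GP] : exists G : subringClosed (C * C)%type, forall z, z \in G <->
      (\bigcup_(X in S) X)%classic z.
    apply: subringClosed_of.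
    - by exists X0 => //; have [G [_ GX]] := SP _ SX0; apply/GX/rpred1.
    - by apply: cl2 => X x y [G [_ GX]] /GX ? /GX ?; apply/GX/rpredB.
    - by apply: cl2 => X x y [G [_ GX]] /GX ? /GX ?; apply/GX/rpredM.
  exists G; split=> //; split=> [x Fx|y /GP[X SX Xy]].
    have [G' [[FG' _] GX]] := SP _ SX0; apply/GP; exists X0 => //; exact/GX/FG'.
  by have [G' [[_ G'0] GX]] := SP _ SX; apply/G'0/GX.
exists G; split=> // [z Gz|d]; first exact/GA/G0A.
have [d' [G' [G'P GG' G'd]]] := partial_hom_extend d GP; exists d'; apply/GA.
suff G'A : ([set z | z \in G'] `<=` A)%classic by exact: G'A.
by apply: maxA => [|z /GA/GG'//]; exists G'.
Qed.

(** A total homomorphism over F is onto: it permutes the finite set of zeros of any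
    polynomial over F, and C is algebraic over F. *)
Lemma algebraic_automorphism c : c \notin F ->
  exists s : {rmorphism C -> C},
    [/\ bijective s, forall x, x \in F -> s x = x & s c != c].
Proof.
move=> cF; have [c' [G0 [G0P G0c c'c]]] := partial_hom_moving cF.
have [G [GP G0G totG]] := partial_hom_total G0P.
have [s sG] : {s : C -> C | forall x, (x, s x) \in G}.
  by exists (fun x => projT1 (cid (totG x))) => x; case: cid.
have sE x y : (x, y) \in G -> s x = y.
  move=> Gxy; have : (x, s x) - (x, y) \in G by exact: rpredB.
  rewrite (_ : _ - _ = (0, s x - y)); last by congr pair; rewrite /= ?subrr.
  by move/GP.2/eqP; rewrite subr_eq0 => /eqP.
have sB : {morph s : x y / x - y}.
  by move=> x y; apply: sE; have := rpredB (sG x) (sG y).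
have sM : {morph s : x y / x * y}.
  by move=> x y; apply: sE; have := rpredM (sG x) (sG y).
have s1 : s 1 = 1 by apply: sE; exact: rpred1.
pose sA := GRing.isZmodMorphism.Build C C s sB.
pose sR := GRing.isMonoidMorphism.Build C C s (s1, sM).
pose f : {rmorphism C -> C} := HB.pack s sA sR.
exists f; split; last by rewrite /= (sE c c') //; exact: G0G.
  have fI : injective f by exact: fmorph_inj.
  have fF x : x \in F -> f x = x by move=> Fx; apply: sE; exact: GP.1.
  have onto y : exists x, f x = y.
    have [p [Fp p0 py]] := algF y; have [rs rE] := closed_field_poly_normal p.
    have rootP z : (z \in rs) = (p.[z] == 0).
      rewrite rE hornerZ mulf_eq0 lead_coef_eq0 (negPf p0) /= horner_prod prodf_seq_eq0.
      apply/idP/hasP => [zs|[t ts]]; first by exists z; rewrite //= hornerXsubC subrr.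
      by rewrite /= hornerXsubC subr_eq0 => /eqP->.
    have fp z : p.[f z] = f p.[z].
      rewrite -horner_map; congr (_.[_]); apply/polyP => i; rewrite coef_map.
      by apply/esym/fF/(polyOverP Fp).
    have fs : {subset map f (undup rs) <= undup rs}.
      move=> _ /mapP[z + ->]; rewrite !mem_undup !rootP fp => /eqP->.
      by rewrite rmorph0.
    have us : uniq (map f (undup rs)) by rewrite map_inj_uniq ?undup_uniq.
    have [|_ eqs] := uniq_min_size us fs; first by rewrite size_map.
    have : y \in map f (undup rs) by rewrite eqs mem_undup rootP py.
    by case/mapP => x _ ->; exists x.
  exists (fun y => projT1 (cid (onto y))) => [x|y]; last by case: cid.
  by case: cid => z /= /fI.
by move=> x Fx; apply: sE; exact: GP.1.
Qed.

End PartialHom.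

(** K is the fixed field of the automorphisms of C over K. The extension is first
    made algebraic by enlarging K to a maximal subfield that avoids c. *)
Lemma exists_automorphism_moving (K : divringClosed C) c : c \notin K ->
  exists s : {rmorphism C -> C},
    [/\ bijective s, forall x, x \in K -> s x = x & s c != c].
Proof.
move=> /exists_max_subfield[F [KF cF maxF]].
have [s [sbij sF sc]] := algebraic_automorphism (max_algebraic cF maxF) cF.
by exists s; split=> // x /KF; exact: sF.
Qed.

End FieldAutomorphisms.

(** * The Nullstellensatz for prime ideals *)

Section BoundedDegree.
Variables (C : fieldType) (N : nat).
Notation S := {mpoly C[N]}.

Lemma card_bmultinom d : (#|{: 'X_{1..N < d}}| <= d ^ N)%N.
Proof.
have lt_m (m : 'X_{1..N < d}) i : (m i < d)%N.
  by apply: leq_ltn_trans (bmdeg m); rewrite mdegE (bigD1 i) //= leq_addr.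
pose f (m : 'X_{1..N < d}) : {ffun 'I_N -> 'I_d} := [ffun i => Ordinal (lt_m m i)].
have fI : injective f.
  move=> m m' /ffunP ff; apply/val_inj/mnmP => i.
  by have := ff i; rewrite !ffunE => /(congr1 val).
by rewrite (leq_trans (leq_card f fI)) // card_ffun !card_ord.
Qed.

Lemma bounded_dependent (T : finType) (f : T -> S) d :
  (forall t, (msize (f t) <= d)%N) -> (#|{: 'X_{1..N < d}}| < #|T|)%N ->
  exists2 c : T -> C, exists t, c t != 0 & \sum_t c t *: f t = 0.
Proof.
move=> fd ltT; pose M := \matrix_(i < #|T|, j < #|{: 'X_{1..N < d}}|)
  (f (enum_val i))@_(enum_val j).
have : kermx M != 0.
  rewrite -mxrank_eq0 mxrank_ker -lt0n subn_gt0.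
  exact: leq_ltn_trans (rank_leq_col M) ltT.
move=> /rowV0Pn[v /sub_kermxP vM v0].
exists (fun t => v 0 (enum_rank t)).
  have /rV0Pn[i vi] := v0; exists (enum_val i); by rewrite enum_valK.
apply/mpolyP => m; rewrite mcoeff0 raddf_sum /=.
have [lt_m|le_m] := ltnP (mdeg m) d; last first.
  rewrite big1 // => t _; rewrite mcoeffZ memN_msupp_eq0 ?mulr0 //.
  by rewrite msize_mdeg_ge // (leq_trans (fd t)).
have /matrixP/(_ 0 (enum_rank (BMultinom lt_m))) := vM; rewrite !mxE => vM0.
transitivity (\sum_(j < #|T|) v 0 j * M j (enum_rank (BMultinom lt_m))) => //.
rewrite (reindex (@enum_val T predT)) /=; last first.
  by apply: onW_bij; exact: enum_val_bij.
by apply: eq_bigr => i _; rewrite enum_valK mcoeffZ !mxE enum_rankK.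
Qed.

End BoundedDegree.

Section Ideals.
Variables (C : fieldType) (N : nat).
Notation S := {mpoly C[N]}.

Definition ideal (I : S -> Prop) :=
  [/\ I 0, forall p q, I p -> I q -> I (p + q) & forall a p, I p -> I (a * p)].

Definition prime_ideal (I : S -> Prop) :=
  [/\ ideal I, ~ I 1 & forall p q, I (p * q) -> I p \/ I q].

Lemma idealN I p : ideal I -> I p -> I (- p).
Proof. by move=> [_ _ IM] Ip; rewrite -mulN1r; exact: IM. Qed.

Lemma idealB I p q : ideal I -> I p -> I q -> I (p - q).
Proof. by move=> II Ip Iq; have [_ ID _] := II; apply: ID => //; exact: idealN. Qed.

Lemma ideal_sum I (T : Type) (s : seq T) (P : pred T) (f : T -> S) :
  ideal I -> (forall t, P t -> I (f t)) -> I (\sum_(t <- s | P t) f t).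
Proof. by move=> [I0 ID _] If; elim/big_ind: _. Qed.

Lemma idealBK I p q : ideal I -> I (p - q) -> I q -> I p.
Proof. by move=> [_ ID _] Ipq Iq; have := ID _ _ Ipq Iq; rewrite subrK. Qed.

Lemma prime_exp I p k : prime_ideal I -> I (p ^+ k) -> I p.
Proof.
by move=> [_ I1 IP]; elim: k => [/I1//|k IH]; rewrite exprS => /IP[|/IH].
Qed.

Lemma prime_prod I (T : Type) (s : seq T) (f : T -> S) :
  prime_ideal I -> I (\prod_(t <- s) f t) -> exists t, I (f t).
Proof.
move=> [_ I1 IP]; elim: s => [|t s IH]; first by rewrite big_nil => /I1.
by rewrite big_cons => /IP[|/IH//]; exists t.
Qed.

(** Zorn's lemma for the ideals that contain I and no power of p; a maximal one meets
    the powers of p after the adjunction of any further element, which makes it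
    prime. *)
Lemma maximal_avoiding (I : S -> Prop) (p : S) : prime_ideal I -> ~ I p ->
  exists M : S -> Prop, [/\ forall q, I q -> M q, prime_ideal M, ~ M p &
    forall a, ~ M a -> exists g k, M (p ^+ k - g * a)].
Proof.
move=> PI Ip; pose P (X : set S) := ideal X /\ forall k, ~ X (p ^+ k).
have [||M [[IM Mp] subIM maxM]] := @zorn_above _ P (I : set S).
- by split=> [|k /(prime_exp PI)]; first by case: PI.
- move=> F [X0 FX0] FP totF; split; last by move=> k [X FX]; exact: (FP _ FX).2.
  split=> [|q r Fq Fr|a q [X FX Xq]].
  + by exists X0 => //; have [[]] := FP _ FX0.
  + have [X [FX Xq Xr]] := bigcup_chain2 totF Fq Fr.
    by exists X => //; have [[_ XD _] _] := FP _ FX; exact: XD.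
  + by exists X => //; have [[_ _ XM] _] := FP _ FX; exact: XM.
have [M0 MD MM] := IM.
have avoid a : ~ M a -> exists g k, M (p ^+ k - g * a).
  move=> Ma; apply: contrapT => Na; apply: Ma.
  pose X : set S := fun q => exists g, M (q - g * a).
  have XX : P X.
    split; last by move=> k [g gk]; apply: Na; exists g, k.
    split=> [|q r [g Mq] [h Mr]|b q [g Mq]].
    - by exists 0; rewrite mul0r subr0.
    - exists (g + h); rewrite mulrDl opprD addrACA; exact: MD.
    - by exists (b * g); rewrite -mulrA -mulrBr; exact: MM.
  apply: (maxM _ XX); last by exists 1; rewrite mul1r subrr.
  by move=> q Mq; exists 0; rewrite mul0r subr0.
exists M; split=> //; last by move/(Mp 1%N).
split=> //; first by move/(Mp 0%N).
move=> a b Mab; apply: contrapT => /not_orP[/avoid[g [k ga]] /avoid[h [l hb]]].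
apply: (Mp (k + l)%N); rewrite exprD.
apply: (idealBK IM (q := (g * h) * (a * b))); last exact: MM.
rewrite (_ : _ - _ = p ^+ l * (p ^+ k - g * a) + (g * a) * (p ^+ l - h * b)); last first.
  by ring.
by apply: MD; exact: MM.
Qed.

End Ideals.

Section Nullstellensatz.
Variables (C : closedFieldType) (N : nat).
Notation S := {mpoly C[N]}.

(* Uncountability of the field enters only in this form. *)
Hypothesis pigeonhole : forall h : C -> nat, exists v, forall m,
  exists s : seq C, [/\ uniq s, size s = m & forall x, x \in s -> h x = v].

(** Suppose that no 'X_i - c belongs to M. Then p ^ k is a multiple g_c ('X_i - c)
    modulo M for every c, where k and the degree of g_c take countably many values;
    hence both are constant on arbitrarily large finite sets of c. Over such a set
    the g_c are linearly dependent, and clearing denominators in the relation between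
    the p ^ k / ('X_i - c) = g_c yields a nonzero polynomial in 'X_i alone that
    belongs to M. Its linear factors contradict the assumption. *)
Lemma ideal_contains_linear (M : S -> Prop) (p : S) (i : 'I_N) :
  prime_ideal M -> ~ M p ->
  (forall a, ~ M a -> exists g k, M (p ^+ k - g * a)) ->
  exists c, M ('X_i - c%:MP).
Proof.
move=> PM Mp avoid; have [IM M1 MP] := PM; have [M0 MD MM] := IM.
apply: contrapT => /forallNP Mi.
have /choice[g /choice[k gk]] c : exists g k, M (p ^+ k - g * ('X_i - c%:MP)).
  exact/avoid/Mi.
pose h c := pickle (k c, msize (g c)).
have [v hv] := pigeonhole h; pose kd : nat * nat := odflt (0, 0)%N (unpickle v).
have [s [us ss sv]] := hv (kd.2 ^ N).+1.
have sh c : c \in s -> k c = kd.1 /\ msize (g c) = kd.2.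
  by move=> /sv hc; rewrite /kd -hc pickleK.
pose f (t : 'I_(size s)) := g s`_t.
have sP (t : 'I_(size s)) : s`_t \in s by exact: mem_nth.
have fd t : (msize (f t) <= kd.2)%N by rewrite /f (sh _ (sP t)).2.
have lt_s : (#|{: 'X_{1..N < kd.2}}| < #|'I_(size s)|)%N.
  by rewrite card_ord ss ltnS card_bmultinom.
have [a [t0 at0] af] := bounded_dependent fd lt_s.
pose u : {poly C} := \sum_t a t *: \prod_(t' | t' != t) ('X - (s`_t')%:P).
have u0 : u != 0.
  apply: contraNneq at0 => /(congr1 (horner^~ s`_t0)); rewrite horner0 horner_sum.
  rewrite (bigD1 t0) //= [X in _ + X]big1  => [|t tt0].
    rewrite addr0 => /eqP; rewrite hornerZ mulf_eq0 horner_prod => /orP[//|].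
    rewrite prodf_seq_eq0 => /hasP[t _ /andP[tt0]].
    by rewrite hornerXsubC subr_eq0 nth_uniq // => /eqP/val_inj tE; rewrite tE eqxx in tt0.
  rewrite hornerZ horner_prod (bigD1 t0) ?[t0 == t]eq_sym //= hornerXsubC subrr.
  by rewrite mul0r mulr0.
pose ev : {rmorphism {poly C} -> S} := horner_alg ('X_i : S).
have evC c : ev c%:P = c%:MP by rewrite /= horner_algC alg_mpolyC.
have evX c : ev ('X - c%:P) = 'X_i - c%:MP.
  by rewrite rmorphB evC /= horner_algX.
have Mu : M (ev u).
  have : M (p ^+ kd.1 * ev u); last by case/MP => [/(prime_exp PM)|].
  have -> : p ^+ kd.1 * ev u = \sum_t a t *: ((p ^+ kd.1 - f t * ('X_i - (s`_t)%:MP)) *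
      \prod_(t' | t' != t) ('X_i - (s`_t')%:MP)).
    have evu : ev u = \sum_t a t *: \prod_(t' | t' != t) ('X_i - (s`_t')%:MP).
      rewrite /u rmorph_sum; apply: eq_bigr => t _.
      rewrite -mul_polyC rmorphM evC mul_mpolyC rmorph_prod; congr (_ *: _).
      by apply: eq_bigr => t' _; rewrite evX.
    pose W : S := \prod_(t < size s) ('X_i - (s`_t)%:MP).
    transitivity (p ^+ kd.1 * ev u - (\sum_t a t *: f t) * W).
      by rewrite af mul0r subr0.
    rewrite evu mulr_sumr mulr_suml -sumrB.
    apply: eq_bigr => t _; rewrite -scalerAr -scalerAl -scalerBr mulrBl; congr (_ *: (_ - _)).
    by rewrite -mulrA /W (bigD1 t).
  apply: ideal_sum => // t _; rewrite -mul_mpolyC; apply: (MM); rewrite mulrC; apply: (MM).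
  by have := gk s`_t; rewrite (sh _ (sP t)).1.
have [rs uE] := closed_field_poly_normal u.
have : M (\prod_(r <- rs) ('X_i - r%:MP)).
  have -> : \prod_(r <- rs) ('X_i - r%:MP) = ((lead_coef u)^-1)%:MP * ev u.
    have {2}-> : u = (lead_coef u)%:P * \prod_(r <- rs) ('X - r%:P).
      by rewrite mul_polyC.
    rewrite rmorphM evC mulrA -mpolyCM mulVf ?lead_coef_eq0 // mpolyC1 mul1r.
    by rewrite rmorph_prod; apply: eq_bigr => r _; rewrite evX.
  exact: MM.
by move/(prime_prod PM) => [r /Mi].
Qed.

(** Modulo a prime ideal that avoids p and contains 'X_i - v_i for all i, every
    polynomial is congruent to its value at v. *)
Theorem prime_nullstellensatz (I : S -> Prop) (p : S) : prime_ideal I -> ~ I p ->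
  exists v : 'I_N -> C, (forall q, I q -> q.@[v] = 0) /\ p.@[v] != 0.
Proof.
move=> PI /(maximal_avoiding PI)[M [IM PM Mp avoid]].
have /choice[v vP] i := ideal_contains_linear i PM Mp avoid.
have [[M0 MD MM] M1 _] := PM.
have MevalM q r : M (q - (q.@[v])%:MP) -> M (r - (r.@[v])%:MP) ->
    M (q * r - ((q * r).@[v])%:MP).
  move=> Mq Mr; rewrite mevalM mpolyCM.
  rewrite (_ : _ - _ = q * (r - (r.@[v])%:MP) + (r.@[v])%:MP * (q - (q.@[v])%:MP)).
    by apply: MD; exact: MM.
  by ring.
have MevalC c : M (c%:MP - ((c%:MP_[N]).@[v])%:MP) by rewrite mevalC subrr.
have Meval q : M (q - (q.@[v])%:MP).
  elim/mpolyind: q => [|c m q _ _ Mq]; first by rewrite meval0 subr0.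
  rewrite mevalD mpolyCD opprD addrACA -mul_mpolyC; apply: (MD) => //; apply: (MevalM) => //.
  rewrite mpolyXE_id; elim/big_ind: _ => [|q1 q2 M1' M2'|i _]; [exact: (MevalC 1) | exact: MevalM |].
  elim: (m i) => [|k IH]; first exact: (MevalC 1).
  by rewrite exprS; apply: (MevalM); rewrite ?mevalXU.
have evM q : M q -> q.@[v] = 0.
  move=> Mq; apply/eqP; apply: contrapT => /negP q0; apply: M1.
  rewrite (_ : 1 = (q.@[v])^-1%:MP * (q.@[v])%:MP); last by rewrite -mpolyCM mulVf.
  by apply: MM; have [II _ _] := PM; have := idealB II Mq (Meval q); rewrite subKr.
exists v; split=> [q /IM/evM//|]; apply/negP => /eqP pv; apply: Mp.
by have := Meval p; rewrite pv subr0.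
Qed.

End Nullstellensatz.

(** * Uncountability of the complex numbers *)

Section Uncountable.
Variable R : realType.

Lemma subinterval_avoiding (a b : R) (s : seq R) : a < b ->
  exists a' b', [/\ a <= a', a' < b', b' <= b & forall x, x \in s -> ~~ (a' <= x <= b')].
Proof.
move=> lt_ab; elim: s => [|y s [a' [b' [aa' lt' bb' avoid]]]].
  by exists a, b.
pose m := (a' + b') / 2.
have am : a' < m by rewrite /m; lra.
have mb : m < b' by rewrite /m; lra.
have [ym|my] := leP y m.
  have mm' : m < (m + b') / 2 by lra.
  have mb' : (m + b') / 2 < b' by lra.
  exists ((m + b') / 2), b'; split=> //; first lra.
  move=> x; rewrite inE => /predU1P[->|/avoid]; first by lra.
  by apply: contra => /andP[mx ->]; rewrite andbT; lra.
exists a', m; split=> //; first lra.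
move=> x; rewrite inE => /predU1P[->|/avoid]; first by lra.
by apply: contra => /andP[-> xm]; rewrite /=; lra.
Qed.

(** Nested intervals, the next one chosen to avoid the next finite set. *)
Lemma real_not_countable_union (s : nat -> seq R) : exists x, forall v, x \notin s v.
Proof.
have /choice[f fP] (vI : nat * (R * R)) : exists J : R * R, vI.2.1 < vI.2.2 ->
    [/\ vI.2.1 <= J.1, J.1 < J.2, J.2 <= vI.2.2 &
        forall x, x \in s vI.1 -> ~~ (J.1 <= x <= J.2)].
  have [lt|ge] := boolP (vI.2.1 < vI.2.2); last by exists (0, 0).
  by have [a' [b' J]] := subinterval_avoiding (s vI.1) lt; exists (a', b').
pose I := fix I v := if v is v'.+1 then f (v', I v') else (0, 1).
have ltI v : (I v).1 < (I v).2.
  by elim: v => [|v /(fP (v, I v))[]//]; rewrite /= ltr01.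
have stepI v : [/\ (I v).1 <= (I v.+1).1, (I v.+1).2 <= (I v).2 &
    forall x, x \in s v -> ~~ ((I v.+1).1 <= x <= (I v.+1).2)].
  by have [] := fP (v, I v) (ltI v).
have monoI v k : (I v).1 <= (I (v + k)%N).1 /\ (I (v + k)%N).2 <= (I v).2.
  elim: k => [|k [IH1 IH2]]; first by rewrite addn0.
  rewrite addnS; have [s1 s2 _] := stepI (v + k)%N.
  by split; [exact: le_trans s1 | exact: le_trans IH2].
have lub v w : (I v).1 <= (I w).2.
  have [v1 _] := monoI v w; have [_ w2] := monoI w v.
  by rewrite (le_trans v1) // (le_trans _ w2) // addnC ltW.
pose A : set R := range (fun v => (I v).1).
have A0 : (A !=set0)%classic by exists (I 0%N).1; exists 0%N.
have Aub : has_ubound A by exists (I 0%N).2 => _ [v _ <-].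
exists (sup A) => v; apply/negP => /(let: And3 _ _ av := stepI v in av _).
rewrite ub_le_sup ?ge_sup //; first by move=> _ [w _ <-].
by exists v.+1.
Qed.

Lemma complex_pigeonhole (h : R[i] -> nat) : exists v, forall m,
  exists s : seq R[i], [/\ uniq s, size s = m & forall x, x \in s -> h x = v].
Proof.
apply: contrapT => /forallNP nh.
have cover m (P : R[i] -> Prop) :
    ~ (exists s, [/\ uniq s, size s = m & forall x, x \in s -> P x]) ->
    exists s : seq R[i], forall x, P x -> x \in s.
  elim: m => [|m IH] nP; first by case: nP; exists [::].
  have [[s [us ss sP]]|/IH//] := pselect (exists s,
    [/\ uniq s, size s = m & forall x, x \in s -> P x]).
  exists s => x Px; apply/negPn/negP => xs; apply: nP; exists (x :: s).
  by rewrite /= xs us ss; split=> // y; rewrite inE => /predU1P[->//|/sP].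
have /choice[s sP] v : exists s : seq R[i], forall x, h x = v -> x \in s.
  by have /existsNP[m] := nh v; exact: (cover m (fun x => h x = v)).
have [x xs] := real_not_countable_union (fun v => map (@complex.Re R) (s v)).
have := sP _ (x%:C)%C erefl; apply/negP.
apply: contra (xs (h (x%:C)%C)) => /(map_f (@complex.Re R)).
by [].
Qed.

End Uncountable.

(** * Regular functions and left-invariant vector fields *)

Section Coordinates.
Variable n : nat.

(** The layout of the coordinates on GL_n, matrix entries first, with an arbitrary
    value in the place of 1 / det and over any ring: it serves for points and for
    tuples of polynomials alike. *)
Definition gl_pair (T : pzSemiRingType) (M : 'M[T]_n) (y : T) : 'I_(n * n + 1) -> T :=
  row_mx (mxvec M) y%:M 0.

Lemma gl_pair_entry (T : pzSemiRingType) (M : 'M[T]_n) y i j :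
  gl_pair M y (lshift 1 (mxvec_index i j)) = M i j.
Proof. by rewrite /gl_pair row_mxEl mxvecE. Qed.

Lemma gl_pair_last (T : pzSemiRingType) (M : 'M[T]_n) y :
  gl_pair M y (rshift (n * n) ord0) = y.
Proof. by rewrite /gl_pair row_mxEr mxE eqxx. Qed.

Lemma gl_pair_ind (P : 'I_(n * n + 1) -> Prop) :
  (forall i j, P (lshift 1 (mxvec_index i j))) -> P (rshift (n * n) ord0) ->
  forall k, P k.
Proof.
move=> Pl Pr k; rewrite -(splitK k); case: (split k) => j /=.
  by case/mxvec_indexP: j.
by rewrite ord1.
Qed.

Lemma eq_gl_pair (T : pzSemiRingType) (M M' : 'M[T]_n) y y' :
  (forall i j, M i j = M' i j) -> y = y' -> gl_pair M y =1 gl_pair M' y'.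
Proof.
move=> MM yy; elim/gl_pair_ind => [i j|]; rewrite ?gl_pair_entry ?gl_pair_last //.
Qed.

End Coordinates.

Section Calculus.
Variables (F : fieldType) (n : nat).
Notation N := (n * n + 1)%N.
Notation S := {mpoly F[n * n + 1]}.
Implicit Types (p q : S) (X A : 'M[F]_n) (u v : 'I_N -> S).

Definition genX : 'M[S]_n := \matrix_(i, j) 'X_(lshift 1 (mxvec_index i j)).
Definition genY : S := 'X_(rshift (n * n) ord0).
Definition mxC A : 'M[S]_n := map_mx (@mpolyC _ F) A.

Lemma gen_gl_pair k : 'X_k = gl_pair genX genY k :> S.
Proof. by elim/gl_pair_ind: k => [i j|]; rewrite ?gl_pair_entry ?mxE ?gl_pair_last. Qed.

Lemma meval_gl_pair (M : 'M[S]_n) (y : S) (w : 'I_N -> F) k :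
  (gl_pair M y k).@[w] = gl_pair (map_mx (meval w) M) y.@[w] k.
Proof. by elim/gl_pair_ind: k => [i j|]; rewrite ?gl_pair_entry ?mxE ?gl_pair_last. Qed.

Lemma meval_genX A y : map_mx (meval (gl_pair A y)) genX = A.
Proof. by apply/matrixP=> i j; rewrite !mxE mevalXU gl_pair_entry. Qed.

Lemma meval_genY A y : genY.@[gl_pair A y] = y.
Proof. by rewrite /genY mevalXU gl_pair_last. Qed.

Lemma meval_mxC A (w : 'I_N -> F) : map_mx (meval w) (mxC A) = A.
Proof. by apply/matrixP=> i j; rewrite !mxE mevalC. Qed.

Lemma gl_coordE A k : gl_coord A k = gl_pair A (\det A)^-1 k.
Proof. by []. Qed.

Definition subst u : S -> S := comp_mpoly [tuple u k | k < N].
HB.instance Definition _ u :=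
  GRing.LRMorphism.copy (subst u) (comp_mpoly [tuple u k | k < N]).

Lemma substX u k : subst u 'X_k = u k.
Proof. by rewrite /subst comp_mpolyXU -tnth_nth tnth_mktuple. Qed.

Lemma substC u c : subst u c%:MP = c%:MP.
Proof. exact: comp_mpolyC. Qed.

Lemma meval_subst u p (w : 'I_N -> F) : (subst u p).@[w] = p.@[fun k => (u k).@[w]].
Proof. by rewrite comp_mpoly_meval; apply: meval_eq => k; rewrite tnth_mktuple. Qed.

(** The vector field with components v, as a derivation. *)
Definition vder v p : S := \sum_k p^`M(k) * v k.

Lemma vder_is_linear v : linear (vder v).
Proof.
move=> c p q; rewrite /vder scaler_sumr -big_split /=; apply: eq_bigr => k _.
by rewrite mderivD mderivZ mulrDl scalerAl.
Qed.
HB.instance Definition _ v :=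
  GRing.isLinear.Build F S S *:%R (vder v) (vder_is_linear v).

Lemma vderM v p q : vder v (p * q) = vder v p * q + p * vder v q.
Proof.
rewrite /vder mulr_suml mulr_sumr -big_split; apply: eq_bigr => k _ /=.
by rewrite mderivM mulrDl mulrA mulrAC.
Qed.

Lemma vderX v k : vder v 'X_k = v k.
Proof.
rewrite /vder (bigD1 k) //= big1 => [|i ik]; rewrite mderivX mnm1E.
  by rewrite eqxx scale1r -{1}[U_(k)%MM]add0m addmK mpolyX0 mul1r addr0.
by rewrite eq_sym (negPf ik) scale0r mul0r.
Qed.

Lemma vderC v c : vder v c%:MP = 0.
Proof. by rewrite /vder big1 // => k _; rewrite mderivC mul0r. Qed.

Lemma eq_derivation (T : comNzRingType) (e d1 d2 : S -> T) :
  {morph d1 : p q / p + q} -> {morph d2 : p q / p + q} ->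
  (forall p q, d1 (p * q) = d1 p * e q + e p * d1 q) ->
  (forall p q, d2 (p * q) = d2 p * e q + e p * d2 q) ->
  (forall c, d1 c%:MP = d2 c%:MP) -> (forall k, d1 'X_k = d2 'X_k) -> d1 =1 d2.
Proof.
move=> D1 D2 M1 M2 dC dX p; elim/mpolyind: p => [|c m p _ _ IH]; first exact: (dC 0).
rewrite D1 D2 IH -mul_mpolyC M1 M2 dC; congr (_ + _ * _ + _).
rewrite mpolyXE_id; elim/big_ind: _ => [|a b|k _]; first exact: (dC 1).
  by rewrite M1 M2 => -> ->.
elim: (m k) => [|j IHj]; first exact: (dC 1).
by rewrite exprS M1 M2 dX IHj.
Qed.

(** Stated for derivations d along a ring morphism e, so that it covers vector fields
    (e the identity) as well as tangent vectors (e the evaluation at a point). *)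
Lemma chain_rule (T : comNzRingType) (e : {rmorphism S -> T}) (d : {additive S -> T}) u p :
  (forall p q, d (p * q) = d p * e q + e p * d q) -> (forall c, d c%:MP = 0) ->
  d (subst u p) = \sum_k e (subst u p^`M(k)) * d (u k).
Proof.
move=> dM dC; move: p; apply: (@eq_derivation T (e \o subst u)) => /=.
- by move=> p q; rewrite !raddfD.
- move=> p q; rewrite -big_split /=; apply: eq_bigr => k _.
  by rewrite mderivD !rmorphD mulrDl.
- by move=> p q; rewrite rmorphM dM.
- move=> p q; rewrite mulr_suml mulr_sumr -big_split /=; apply: eq_bigr => k _.
  by rewrite mderivM !rmorphD !rmorphM mulrDl mulrA mulrAC.
- move=> c; rewrite substC dC big1 // => k _.
  by rewrite mderivC !rmorph0 mul0r.
- move=> k; rewrite substX (bigD1 k) //= big1 => [|i ik]; rewrite mderivX mnm1E.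
    rewrite eqxx scale1r -{1}[U_(k)%MM]add0m addmK mpolyX0 !rmorph1 mul1r addr0 //.
  by rewrite eq_sym (negPf ik) scale0r !rmorph0 mul0r.
Qed.

Lemma vder_subst u v p :
  vder v (subst u p) = \sum_k subst u p^`M(k) * vder v (u k).
Proof. by apply: (@chain_rule _ idfun); [exact: vderM | exact: vderC]. Qed.

(** The left-invariant vector field of X: the derivative at t = 0 of A (1 + t X), whose
    component at the coordinate 1 / det is - tr X / det. *)
Definition lfield X : 'I_N -> S := gl_pair (genX *m mxC X) (- \tr X *: genY).
Definition lder X : S -> S := vder (lfield X).
HB.instance Definition _ X := GRing.Linear.copy (lder X) (vder (lfield X)).

Lemma lderE X p : lder X p = \sum_k p^`M(k) * lfield X k.
Proof. by []. Qed.

Definition ltrans A : S -> S := subst (gl_pair (mxC A *m genX) ((\det A)^-1 *: genY)).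
HB.instance Definition _ A := GRing.LRMorphism.copy (ltrans A)
  (subst (gl_pair (mxC A *m genX) ((\det A)^-1 *: genY))).

Lemma meval_ltrans A B p : (ltrans A p).@[gl_coord B] = p.@[gl_coord (A *m B)].
Proof.
rewrite meval_subst; apply: meval_eq => k; rewrite meval_gl_pair.
rewrite map_mxM meval_mxC mevalZ (meval_genY B) (meval_genX B).
by rewrite -invfM -det_mulmx.
Qed.

Lemma lderM X p q : lder X (p * q) = lder X p * q + p * lder X q.
Proof. exact: vderM. Qed.

Lemma lder_genX X : map_mx (lder X) genX = genX *m mxC X.
Proof. by apply/matrixP=> i j; rewrite !mxE /lder vderX /lfield gl_pair_entry mxE. Qed.

Lemma lder_genY X : lder X genY = - \tr X *: genY.
Proof. by rewrite /lder vderX /lfield gl_pair_last. Qed.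

Lemma ltrans_genX A : map_mx (ltrans A) genX = mxC A *m genX.
Proof. by apply/matrixP=> i j; rewrite !mxE /ltrans substX gl_pair_entry mxE. Qed.

Lemma ltrans_genY A : ltrans A genY = (\det A)^-1 *: genY.
Proof. by rewrite /ltrans substX gl_pair_last. Qed.

Lemma lderC X c : lder X c%:MP = 0.
Proof. exact: vderC. Qed.

Lemma lder_ltrans X A p : lder X (ltrans A p) = ltrans A (lder X p).
Proof.
have -> : lder X p = \sum_k p^`M(k) * lfield X k by [].
rewrite rmorph_sum [LHS]vder_subst; apply: eq_bigr => k _.
rewrite rmorphM; congr (_ * _); rewrite -/(lder X _).
elim/gl_pair_ind: k => [i j|]; rewrite /lfield ?gl_pair_entry ?gl_pair_last.
  transitivity ((mxC A *m map_mx (lder X) genX) i j).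
    rewrite [RHS]mxE [in LHS]mxE (raddf_sum (lder X)); apply: eq_bigr => l _ /=.
    have -> : mxC A i l = (A i l)%:MP by rewrite mxE.
    by rewrite mul_mpolyC linearZ /= -mul_mpolyC [map_mx _ _ _ _]mxE.
  transitivity ((map_mx (ltrans A) genX *m mxC X) i j).
    by rewrite lder_genX ltrans_genX mulmxA.
  rewrite [LHS]mxE [in RHS]mxE (raddf_sum (ltrans A)); apply: eq_bigr => l _ /=.
  have -> : mxC X l j = (X l j)%:MP by rewrite mxE.
  by rewrite rmorphM [map_mx _ _ _ _]mxE /= /ltrans substC.
by rewrite [LHS]linearZ [RHS]linearZ /= lder_genY ltrans_genY !scalerA mulrC.
Qed.

Lemma lder_linear c X Y p : lder (c *: X + Y) p = c *: lder X p + lder Y p.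
Proof.
rewrite /lder /vder scaler_sumr -big_split; apply: eq_bigr => k _ /=.
rewrite scalerAr -mulrDr; congr (_ * _).
elim/gl_pair_ind: k => [i j|]; rewrite /lfield ?gl_pair_entry ?gl_pair_last.
  rewrite !mxE scaler_sumr -big_split; apply: eq_bigr => l _ /=.
  by rewrite !mxE mpolyCD mpolyCM mulrDr mul_mpolyC scalerAr.
by rewrite scalerA -scalerDl mxtraceD mxtraceZ opprD mulrN.
Qed.

Lemma meval1_lder X p : (lder X p).@[gl_coord 1%:M] = diff_at_1 p X.
Proof.
rewrite raddf_sum; apply: eq_bigr => k _ /=; rewrite mevalM; congr (_ * _).
rewrite /lfield meval_gl_pair map_mxM meval_mxC mevalZ (meval_genY 1%:M) (meval_genX 1%:M).
by rewrite mul1mx det1 invr1 mulr1.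
Qed.

Lemma diff_at_1_genX X i j : diff_at_1 (genX i j) X = X i j.
Proof.
rewrite -meval1_lder.
transitivity (map_mx (meval (gl_coord 1%:M)) (map_mx (lder X) genX) i j); first by rewrite !mxE.
by rewrite lder_genX map_mxM meval_mxC (meval_genX 1%:M) mul1mx.
Qed.

(** Left invariance turns a derivative at A into a derivative at the identity. *)
Lemma meval_lder X A p : (lder X p).@[gl_coord A] = diff_at_1 (ltrans A p) X.
Proof. by rewrite -meval1_lder lder_ltrans meval_ltrans mulmx1. Qed.

Lemma diff_at_1M p q X : diff_at_1 (p * q) X =
  diff_at_1 p X * q.@[gl_coord 1%:M] + p.@[gl_coord 1%:M] * diff_at_1 q X.
Proof. by rewrite -!meval1_lder lderM mevalD !mevalM. Qed.

Lemma diff_at_1_prod (I : finType) (f : I -> S) X :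
  diff_at_1 (\prod_i f i) X =
  \sum_i diff_at_1 (f i) X * \prod_(k | k != i) (f k).@[gl_coord 1%:M].
Proof.
have d1 : diff_at_1 1 X = 0.
  by rewrite /diff_at_1 big1 // => k _; rewrite (mderivC k 1) meval0 mul0r.
suff dP (s : seq I) : uniq s -> diff_at_1 (\prod_(i <- s) f i) X =
    \sum_(i <- s) diff_at_1 (f i) X * \prod_(k <- s | k != i) (f k).@[gl_coord 1%:M].
  by rewrite dP ?index_enum_uniq.
elim: s => [|i s IH] /=; first by rewrite !big_nil.
case/andP=> si us; rewrite !big_cons diff_at_1M IH // eqxx /=; congr (_ * _ + _).
  rewrite rmorph_prod /= big_seq [RHS]big_seq_cond; apply: eq_bigl => k.
  by case: eqVneq si => [->/negPf->|_]; rewrite ?andbT.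
rewrite mulr_sumr big_seq [RHS]big_seq; apply: eq_bigr => k sk.
by rewrite big_cons; case: eqVneq si => [->|]; rewrite ?sk // mulrCA.
Qed.

(** Jacobi's formula at the identity: of the terms of the Leibniz expansion only
    the one of the trivial permutation has at most one off-diagonal factor. *)
Lemma diff_at_1_det (M : 'M[S]_n) X : map_mx (meval (gl_coord 1%:M)) M = 1%:M ->
  diff_at_1 (\det M) X = \tr (map_mx (fun p => diff_at_1 p X) M).
Proof.
move=> M1; have Mik i k : (M i k).@[gl_coord 1%:M] = (i == k)%:R.
  by have /matrixP/(_ i k) := M1; rewrite !mxE.
have d_sum (I : finType) (f : I -> S) :
    diff_at_1 (\sum_i f i) X = \sum_i diff_at_1 (f i) X.
  rewrite -meval1_lder (raddf_sum (lder X)) raddf_sum; apply: eq_bigr => i _.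
  by rewrite /= meval1_lder.
have d_sign (s : 'S_n) p : diff_at_1 ((-1) ^+ s * p) X = (-1) ^+ s * diff_at_1 p X.
  case: (s : bool); rewrite !(expr0, expr1) ?mul1r // !mulN1r.
  by rewrite -!meval1_lder !raddfN.
rewrite /determinant d_sum; under eq_bigr do rewrite d_sign diff_at_1_prod.
rewrite (bigD1 1%g) //= odd_perm1 expr0 mul1r [X in _ + X]big1 ?addr0.
  rewrite /mxtrace; apply: eq_bigr => i _; rewrite mxE perm1 big1 ?mulr1 // => k _.
  by rewrite perm1 Mik eqxx.
move=> s s1; rewrite big1 ?mulr0 // => i _.
have [k /andP[ki sk]] : exists k, (k != i) && (s k != k).
  apply/existsP; apply: contraR s1 => /existsPn sE.
  have sk k : k != i -> s k = k by move=> ki; have := sE k; rewrite ki negbK => /eqP.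
  apply/eqP/permP => k; rewrite perm1; have [->|/sk//] := eqVneq k i.
  apply/eqP; apply: contraTT isT => si; have := sk _ si => /perm_inj ii.
  by rewrite ii eqxx in si.
by rewrite (bigD1 k) //= Mik eq_sym (negPf sk) mul0r mulr0.
Qed.

End Calculus.

Section Degree.
Variables (F : fieldType) (N : nat).
Notation S := {mpoly F[N]}.
Implicit Types p q : S.

Lemma msize_leP p d : (forall m, (d <= mdeg m)%N -> p@_m = 0) <-> (msize p <= d)%N.
Proof.
split=> [p0|le_pd m le_dm]; last first.
  by rewrite memN_msupp_eq0 // msize_mdeg_ge // (leq_trans le_pd).
rewrite msizeE; apply/bigmax_leqP_seq => m mp _; rewrite ltnNge.
by apply: contraL mp => /p0/eqP; rewrite mcoeff_eq0.
Qed.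

Lemma msize_add p q d : (msize p <= d)%N -> (msize q <= d)%N -> (msize (p + q) <= d)%N.
Proof. by move=> pd qd; rewrite (leq_trans (msizeD_le _ _)) // geq_max pd. Qed.

Lemma msize_sum_le (I : Type) (s : seq I) (P : pred I) (f : I -> S) d :
  (forall i, P i -> (msize (f i) <= d)%N) -> (msize (\sum_(i <- s | P i) f i) <= d)%N.
Proof.
by move=> fd; elim/big_ind: _ => [|p q|i /fd//]; [rewrite msize0 | exact: msize_add].
Qed.

Lemma msize_mul p q a b : (msize p <= a.+1)%N -> (msize q <= b.+1)%N ->
  (msize (p * q) <= (a + b).+1)%N.
Proof.
move=> pa qb; have [->|p0] := eqVneq p 0; first by rewrite mul0r msize0.
have [->|q0] := eqVneq q 0; first by rewrite mulr0 msize0.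
rewrite msizeM // -subn1 leq_subLR (leq_trans (leq_add pa qb)) //.
by rewrite addSn addnS.
Qed.

Lemma msize_exp p a k : (msize p <= a.+1)%N -> (msize (p ^+ k) <= (a * k).+1)%N.
Proof.
move=> pa; elim: k => [|k IH]; first by rewrite expr0 msize1.
by rewrite exprS mulnS; exact: msize_mul.
Qed.

Lemma msize_mderiv p k d : (msize p <= d.+1)%N -> (msize p^`M(k) <= d)%N.
Proof.
move=> /msize_leP pd; apply/msize_leP => m dm; rewrite mcoeff_mderiv pd ?mul0rn //.
by rewrite mdegD mdeg1 addn1 ltnS.
Qed.

End Degree.

Section DegreeCalculus.
Variables (F : fieldType) (n : nat).
Notation N := (n * n + 1)%N.
Notation S := {mpoly F[n * n + 1]}.

Lemma msize_subst (u : 'I_N -> S) (p : S) e d : (forall k, (msize (u k) <= e.+1)%N) ->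
  (msize p <= d.+1)%N -> (msize (subst u p) <= (e * d).+1)%N.
Proof.
move=> ue pd; rewrite {1}(mpolywE pd) (raddf_sum (subst u)); apply: msize_sum_le => m _.
rewrite /= linearZ /= (leq_trans (msizeZ_le _ _)) //.
rewrite mpolyXE_id rmorph_prod /=.
apply: (@leq_trans (e * mdeg m).+1); last by rewrite ltnS leq_mul2l -ltnS bmdeg orbT.
rewrite mdegE; elim/big_ind2: _ => [|a p' b q'|k _]; first by rewrite msize1.
  by move=> ap bq; rewrite mulnDr; exact: msize_mul.
by rewrite rmorphXn /= substX; exact: msize_exp.
Qed.

Lemma msize_entry_mulmx (A B : 'M[S]_n) a b i j :
  (forall i j, (msize (A i j) <= a.+1)%N) -> (forall i j, (msize (B i j) <= b.+1)%N) ->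
  (msize ((A *m B) i j) <= (a + b).+1)%N.
Proof. by move=> Aa Bb; rewrite mxE; apply: msize_sum_le => l _; exact: msize_mul. Qed.

Lemma msize_genX i j : (msize (genX F n i j) <= 2)%N.
Proof. by rewrite mxE msizeX mdeg1. Qed.

Lemma msize_mxC (A : 'M[F]_n) i j : (msize (mxC A i j) <= 1)%N.
Proof. by rewrite mxE msizeC leq_b1. Qed.

Lemma msize_scale_genY (c : F) : (msize (c *: genY F n) <= 2)%N.
Proof. by rewrite (leq_trans (msizeZ_le _ _)) // msizeX mdeg1. Qed.

Lemma msize_ltrans (A : 'M[F]_n) (p : S) d :
  (msize p <= d.+1)%N -> (msize (ltrans A p) <= d.+1)%N.
Proof.
move=> pd; rewrite -[d]mul1n; apply: msize_subst; last by rewrite ?mul1n. move=> k.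
elim/gl_pair_ind: k => [i j|]; rewrite ?gl_pair_entry ?gl_pair_last ?msize_scale_genY //.
by apply: (@msize_entry_mulmx _ _ 0 1); [exact: msize_mxC | exact: msize_genX].
Qed.

Lemma msize_lder (X : 'M[F]_n) (p : S) d :
  (msize p <= d.+1)%N -> (msize (lder X p) <= d.+1)%N.
Proof.
move=> pd; apply: msize_sum_le => k _; have := msize_mderiv k pd.
case: d pd => [|d] _ dp.
  by move: dp; rewrite leqn0 msize_poly_eq0 => /eqP->; rewrite mul0r msize0.
have -> : d.+2 = (d + 1).+1 by rewrite addn1.
apply: msize_mul => //.
elim/gl_pair_ind: k {dp} => [i j|]; rewrite /lfield ?gl_pair_entry ?gl_pair_last ?msize_scale_genY //.
by apply: (@msize_entry_mulmx _ _ 1 0); [exact: msize_genX | exact: msize_mxC].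
Qed.

End DegreeCalculus.

(** * Jet ideals *)

Section JetIdeal.
Variables (F : numClosedFieldType) (n : nat).
Notation S := {mpoly F[n * n + 1]}.
Implicit Types (p q f g : S) (X Y : 'M[F]_n) (J : S -> Prop).

Definition lword (ws : seq 'M[F]_n) p : S := foldl (fun q X => lder X q) p ws.

(** The polynomials with trivial Taylor expansion at the identity along L: they are the
    functions that vanish on the closed subgroup generated by the exponentials of
    elements of L, in a form that needs no exponential map. *)
Definition jet_ideal (L : {vspace 'M[F]_n}) p : Prop :=
  forall ws, {subset ws <= L} -> (lword ws p).@[gl_coord 1%:M] = 0.

(** The largest ideal inside J that is stable under the derivation of Y. *)
Definition der_core J Y f : Prop := forall k, J (iter k (lder Y) f).

Lemma iter_lderD k Y : {morph iter k (lder Y) : p q / p + q}.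
Proof. by elim: k => // k IH p q; rewrite !iterS IH raddfD. Qed.

Lemma der_core_lder J Y f : der_core J Y f -> der_core J Y (lder Y f).
Proof. by move=> Jf k; rewrite -iterSr. Qed.

Lemma der_core_ideal J Y : ideal J -> ideal (der_core J Y).
Proof.
move=> [J0 JD JM]; split=> [k|p q Jp Jq k|a p Jp k].
- by elim: k => // k IH; rewrite iterSr raddf0.
- by rewrite iter_lderD; apply: JD.
elim: k a p Jp => [|k IH] a p Jp; first by apply: JM; exact: (Jp 0%N).
rewrite iterSr lderM iter_lderD; apply: (JD); first exact: IH.
by apply: IH => j; exact: der_core_lder.
Qed.

Section LeibnizModJ.
Variables (J : S -> Prop) (Y : 'M[F]_n).
Hypothesis idJ : ideal J.

Let vanish i f := forall a, (a < i)%N -> J (iter a (lder Y) f).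

Let vanish_lder i f : vanish i f -> vanish i.-1 (lder Y f).
Proof. by case: i => // i vf a ai; rewrite -iterSr; exact: vf. Qed.

Lemma leibniz_low i j k f g : vanish i f -> vanish j g -> (k < i + j)%N ->
  J (iter k (lder Y) (f * g)).
Proof.
have [J0 JD JM] := idJ.
elim: k i j f g => [|k IH] i j f g vf vg lt.
  case: i vf lt => [|i] vf lt; last by rewrite mulrC; apply: JM; exact: (vf 0%N).
  by apply: JM; exact: (vg 0%N).
rewrite iterSr lderM iter_lderD; apply: (JD).
  by apply: (IH i.-1 j) => //; [exact: vanish_lder | lia].
by apply: (IH i j.-1) => //; [exact: vanish_lder | lia].
Qed.

Lemma leibniz_top i j k f g : vanish i f -> vanish j g -> (i + j)%N = k ->
  exists2 c : nat, (0 < c)%N &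
  J (iter k (lder Y) (f * g) - (iter i (lder Y) f * iter j (lder Y) g) *+ c).
Proof.
have [J0 JD JM] := idJ.
elim: k i j f g => [|k IH] [|i] [|j] // f g vf vg ijk.
- by exists 1%N => //; rewrite /= subrr.
- have [|c c0 Jc] := IH 0%N j f (lder Y g) vf (vanish_lder vg); first by lia.
  exists c => //; rewrite iterSr lderM iter_lderD -addrA; apply: (JD).
    by apply: (@leibniz_low 0%N j.+1) => //; lia.
  by rewrite [iter j.+1 _ _]iterSr.
- have [|c c0 Jc] := IH i 0%N (lder Y f) g (vanish_lder vf) vg; first by lia.
  exists c => //; rewrite iterSr lderM iter_lderD addrAC; apply: (JD).
    by rewrite [iter i.+1 _ _]iterSr.
  by apply: (@leibniz_low i.+1 0%N) => //; lia.
have [|c c0 Jc] := IH i.+1 j f (lder Y g) vf (vanish_lder vg); first by lia.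
have [|c' _ Jc'] := IH i j.+1 (lder Y f) g (vanish_lder vf) vg; first by lia.
exists (c' + c)%N; first by rewrite addn_gt0 c0 orbT.
rewrite [iter k.+1 _ _]iterSr lderM iter_lderD mulrnDr opprD addrACA; apply: (JD).
  by rewrite [iter i.+1 _ _]iterSr.
by rewrite [iter j.+1 _ _]iterSr.
Qed.

End LeibnizModJ.

Lemma natr_mul_prime J p c : prime_ideal J -> (0 < c)%N -> J (p *+ c) -> J p.
Proof.
move=> [[_ _ JM] _ _] c0 Jpc.
have -> : p = (c%:R^-1)%:MP * (p *+ c).
  by rewrite -scaler_nat mul_mpolyC scalerA mulVf ?scale1r // pnatr_eq0 -lt0n.
exact: JM.
Qed.

(** If the first derivatives of f and g outside J have orders i and j, then modulo J
    the derivative of f * g of order i + j is a nonzero multiple of their product,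
    by the Leibniz rule in characteristic zero. *)
Lemma prime_der_core J Y : prime_ideal J -> prime_ideal (der_core J Y).
Proof.
move=> PJ; have [idJ J1 JP] := PJ; split; first exact: der_core_ideal.
  by move=> /(_ 0%N).
move=> f g Jfg; apply: contrapT => /not_orP[].
have first_out p : ~ der_core J Y p -> exists i, ~ J (iter i (lder Y) p) /\
    forall a, (a < i)%N -> J (iter a (lder Y) p).
  move=> /existsNP[k0 k0P].
  have ex : exists k, `[< ~ J (iter k (lder Y) p) >] by exists k0; exact/asboolP.
  case: (ex_minnP ex) => i /asboolP Ji mini; exists i; split=> // a ai.
  by apply: contrapT => /asboolP/mini; rewrite leqNgt ai.
move=> /first_out[i [fi vf]] /first_out[j [gj vg]].
have [c c0 Jc] := leibniz_top idJ vf vg erefl.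
have : J ((iter i (lder Y) f * iter j (lder Y) g) *+ c).
  by have := idealB idJ (Jfg (i + j)%N) Jc; rewrite subKr.
by move/(natr_mul_prime PJ c0)/JP => [].
Qed.

Definition vanish1 p : Prop := p.@[gl_coord 1%:M] = 0.

Lemma prime_vanish1 : prime_ideal vanish1.
Proof.
split=> [||p q]; rewrite /vanish1 ?meval1.
- split=> [|p q|a p]; rewrite ?meval0 ?mevalD ?mevalM //.
    by move=> -> ->; rewrite addr0.
  by move=> ->; rewrite mulr0.
- by move/eqP; rewrite oner_eq0.
- by rewrite mevalM => /eqP; rewrite mulf_eq0 => /orP[] /eqP; [left|right].
Qed.

(** Jets along the words Y_1 ^ k_1 ... Y_m ^ k_m for a fixed list of directions only.
    Unlike the jet ideal, which is an intersection of such ideals, this one is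
    obtained from the maximal ideal of the identity by iterating [der_core]. *)
Fixpoint core ws : S -> Prop :=
  if ws is Y :: ws' then der_core (core ws') Y else vanish1.

Lemma prime_core ws : prime_ideal (core ws).
Proof.
by elim: ws => [|Y ws IH]; [exact: prime_vanish1 | exact: prime_der_core].
Qed.

Lemma core_catr ws ws' p : core (ws ++ ws') p -> core ws' p.
Proof. by elim: ws => // Y ws IH /= /(_ 0%N)/IH. Qed.

Lemma core_catl ws ws' p : core (ws ++ ws') p -> core ws p.
Proof.
elim: ws p => [|Y ws IH] p /=; last by move=> cp k; apply: IH.
elim: ws' p => [//|Y ws' IH] p /= cp; exact: (IH _ (cp 0%N)).
Qed.

Section JetIdealOf.
Variable L : {vspace 'M[F]_n}.

Lemma jet_ideal_lder Y p : Y \in L -> jet_ideal L p -> jet_ideal L (lder Y p).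
Proof.
move=> LY Lp ws wsL; apply: (Lp (Y :: ws)) => X.
by rewrite inE => /predU1P[->|/wsL].
Qed.

Lemma jet_ideal_core p :
  jet_ideal L p <-> forall ws, {subset ws <= L} -> core ws p.
Proof.
split=> [Lp ws|cp ws wsL].
  elim: ws p Lp => [|Y ws IH] p Lp wsL; first exact: (Lp [::]).
  move=> k; apply: IH => [|X Xws]; last by rewrite wsL // inE Xws orbT.
  have LY : Y \in L by rewrite wsL // mem_head.
  by elim: k => //= k; exact: jet_ideal_lder.
have := cp ws wsL; elim: ws {wsL cp} p => [//|Y ws IH] p /= /(_ 1%N); exact: IH.
Qed.

(** If f and g are outside the jet ideal, they are outside the prime ideals of two
    lists of directions, hence both outside that of the concatenated list. *)
Lemma prime_jet_ideal : prime_ideal (jet_ideal L).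
Proof.
have PC ws := prime_core ws; split.
- split=> [|p q|a p].
  + by apply/jet_ideal_core => ws _; have [[]] := PC ws.
  + move=> /jet_ideal_core Lp /jet_ideal_core Lq; apply/jet_ideal_core => ws wsL.
    by have [[_ CD _] _ _] := PC ws; apply: CD; [exact: Lp | exact: Lq].
  + move=> /jet_ideal_core Lp; apply/jet_ideal_core => ws wsL.
    by have [[_ _ CM] _ _] := PC ws; apply: CM; exact: Lp.
- move=> L1; have /eqP : (1 : S).@[gl_coord (1%:M : 'M[F]_n)] = 0 by exact: (L1 [::]).
  by rewrite meval1 oner_eq0.
- move=> p q /jet_ideal_core Lpq; apply: contrapT => /not_orP[].
  move=> nLp nLq.
  have [ws [wsL cp]] : exists ws, {subset ws <= L} /\ ~ core ws p.
    apply: contrapT => nex; apply/nLp/jet_ideal_core => ws wsL.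
    by apply: contrapT => cp; apply: nex; exists ws.
  have [ws' [wsL' cq]] : exists ws, {subset ws <= L} /\ ~ core ws q.
    apply: contrapT => nex; apply/nLq/jet_ideal_core => ws' wsL'.
    by apply: contrapT => cq; apply: nex; exists ws'.
  have [_ _ CP] := PC (ws ++ ws'); case: (CP p q).
  + by apply: Lpq => X; rewrite mem_cat => /orP[/wsL|/wsL'].
  + by move/core_catl.
  + by move/core_catr.
Qed.

Lemma jet_diff p X : jet_ideal L p -> X \in L -> diff_at_1 p X = 0.
Proof.
move=> Lp LX; rewrite -meval1_lder; apply: (Lp [:: X]) => Y.
by rewrite inE => /eqP->.
Qed.

Lemma lword_ltrans A ws p : lword ws (ltrans A p) = ltrans A (lword ws p).
Proof. by elim: ws p => [//|X ws IH] p; rewrite /= lder_ltrans IH. Qed.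

Lemma jet_lword ws p : {subset ws <= L} -> jet_ideal L p -> jet_ideal L (lword ws p).
Proof.
elim: ws p => [//|X ws IH] p wsL Lp /=; apply: IH => [Y Yws|].
  by rewrite wsL // inE Yws orbT.
by apply: jet_ideal_lder => //; rewrite wsL ?mem_head.
Qed.

Lemma jet_ltrans A p : (forall ws, {subset ws <= L} -> (lword ws p).@[gl_coord A] = 0) ->
  jet_ideal L (ltrans A p).
Proof. by move=> pA ws wsL; rewrite lword_ltrans meval_ltrans mulmx1 pA. Qed.

Lemma jet_stable_left A p : (forall q, jet_ideal L q -> q.@[gl_coord A] = 0) ->
  jet_ideal L p -> jet_ideal L (ltrans A p).
Proof.
by move=> LA Lp; apply: jet_ltrans => ws wsL; apply: LA; exact: jet_lword.
Qed.

End JetIdealOf.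
End JetIdeal.

(** * Dimension growth along a dominant endomorphism *)
Section Growth.
Variables (F : fieldType) (n : nat).
Notation N := (n * n + 1)%N.
Notation S := {mpoly F[n * n + 1]}.
Variables (I : S -> Prop) (u : 'I_N -> S) (a : S).
Hypothesis idI : ideal I.
Hypothesis I1 : ~ I 1.

(** The largest such k, as a function of d, is the Hilbert function of I. *)
Definition independent_family d k := exists2 T : finType, #|T| = k &
  exists2 f : T -> S, forall t, (msize (f t) <= d.+1)%N &
    forall c : T -> F, I (\sum_t c t *: f t) -> forall t, c t = 0.

Lemma idealZ (c : F) p : I p -> I (c *: p).
Proof. by have [_ _ IM] := idI; rewrite -mul_mpolyC; exact: IM. Qed.

Lemma independent_family_le d k : independent_family d k -> (k <= d.+1 ^ N)%N.
Proof.
case=> T <- [f fd fI]; rewrite leqNgt; apply/negP => lt.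
have [c [t ct] c0] := bounded_dependent fd (leq_ltn_trans (card_bmultinom _ _) lt).
by case/negP: ct; apply/eqP/fI; rewrite c0; case: idI.
Qed.

Lemma independent_family1 : independent_family 1 1.
Proof.
exists 'I_1; first exact: card_ord.
exists (fun=> 1) => [_|c]; first by rewrite msize1.
rewrite big_ord1 => Ic t; rewrite ord1; apply/eqP/negPn/negP => ct; apply: I1.
by have := idealZ (c ord0)^-1 Ic; rewrite scalerA mulVf // scale1r.
Qed.

Hypothesis transcendental : forall e (f : nat -> S),
  I (\sum_(j < e.+1) subst u (f j) * a ^+ j) -> forall j, (j <= e)%N -> I (f j).

(** If a is transcendental over the image of the substitution, the products of the
    images of an independent family with the powers of a are independent. *)
Lemma independent_family_step E d k :
  (forall i, (msize (u i) <= E.+1)%N) -> (msize a <= E.+1)%N ->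
  independent_family d k -> independent_family (2 * E * d) (k * d.+1).
Proof.
move=> uE aE [T <- [f fd fI]]; exists (T * 'I_d.+1)%type.
  by rewrite card_prod card_ord.
exists (fun tj : T * 'I_d.+1 => subst u (f tj.1) * a ^+ tj.2) => [[t j]|c Ic [t j]] /=.
  apply: (@leq_trans (E * d + E * j).+1).
    by apply: msize_mul; [exact: msize_subst | exact: msize_exp].
  by rewrite ltnS -mulnDr -mulnA mulnCA leq_mul2l mul2n -addnn leq_add2l -ltnS ltn_ord orbT.
pose g j := \sum_t c (t, inord j) *: f t.
have Ig : I (\sum_(j < d.+1) subst u (g j) * a ^+ j).
  move: Ic; congr I.
  transitivity (\sum_t \sum_(j < d.+1) c (t, j) *: (subst u (f t) * a ^+ j)).
    by rewrite pair_bigA; apply: eq_bigr => -[t' j'].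
  rewrite exchange_big /=; apply: eq_bigr => j' _.
  rewrite /g (raddf_sum (subst u)) mulr_suml; apply: eq_bigr => t' _.
  by rewrite /= linearZ /= -scalerAl inord_val.
have /fI/(_ t) := transcendental Ig (ltn_ord j : (j <= d)%N).
by rewrite inord_val.
Qed.

(** Starting from 1 and iterating the previous step, the degree c ^ m accommodates at
    least c ^ (m (m - 1) / 2) independent elements, more than the polynomial bound
    of [independent_family_le] allows when m is large. *)
Lemma not_transcendental : False.
Proof.
pose E := maxn 1 (maxn (\max_i msize (u i)) (msize a)).
have E0 : (0 < E)%N by rewrite leq_maxl.
have uE i : (msize (u i) <= E.+1)%N.
  by rewrite leqW // !leq_max (leq_bigmax i) orbT.
have aE : (msize a <= E.+1)%N by rewrite leqW // !leq_max leqnn !orbT.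
pose c := (2 * E)%N; have c2 : (1 < c)%N by rewrite /c; lia.
have fam m : exists2 k, (c ^ 'C(m, 2) <= k)%N & independent_family (c ^ m) k.
  elim: m => [|m [k le_k fk]]; first by exists 1%N; [|exact: independent_family1].
  exists (k * (c ^ m).+1)%N; last by rewrite expnS; exact: independent_family_step.
  by rewrite binS bin1 expnD leq_mul.
have [k le_k /independent_family_le le_kN] := fam (2 * N).+3.
have : (c ^ 'C((2 * N).+3, 2) <= c ^ ((2 * N).+4 * N))%N.
  rewrite (leq_trans le_k) // (leq_trans le_kN) // expnM leq_exp2r //.
    rewrite [X in (_ <= X)%N]expnS; have := expn_gt0 c (2 * N).+3; nia.
  by rewrite addn1.
rewrite leq_exp2l // bin2 /=; move: (n * n)%N => m; nia.
Qed.

End Growth.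

Section DominantEndomorphism.
Variables (F : numClosedFieldType) (n : nat).
Notation N := (n * n + 1)%N.
Notation S := {mpoly F[n * n + 1]}.
Variables (I : S -> Prop) (u : 'I_N -> S) (X : 'M[F]_n).

Lemma lder_exp (a : S) j : lder X (a ^+ j.+1) = (a ^+ j * lder X a) *+ j.+1.
Proof.
elim: j => [|j IH]; first by rewrite expr1 expr0 mul1r.
rewrite exprS lderM IH mulrnAr mulrA -exprS mulrC [RHS]mulrS.
by rewrite -mulrnAr.
Qed.

(** A derivation that kills a subring kills everything algebraic over it: derive an
    equation of minimal degree. The residues of all polynomials a modulo I are
    algebraic over those of the substituted ones by [not_transcendental]. *)
Lemma lder_dominant_eq0 : prime_ideal I ->
  (forall q, I q <-> I (subst u q)) -> (forall q, I (lder X (subst u q))) ->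
  (forall q, I q -> I (lder X q)) -> forall a, I (lder X a).
Proof.
move=> PI Iu IXu IX a; have [idI I1 IP] := PI; have [I0 ID IM] := idI.
pose rel e := `[< exists f : nat -> S, ~ I (f e) /\
  I (\sum_(j < e.+1) subst u (f j) * a ^+ j) >].
have exrel : exists e, rel e.
  apply: contrapT => nrel.
  apply: (@not_transcendental _ _ I u a) => // e f; elim: e => [|e IH] If j.
    rewrite leqn0 => /eqP->; apply/Iu; move: If.
    by rewrite big_ord1 expr0 mulr1.
  have Ie : I (f e.+1).
    by apply: contrapT => nIe; apply: nrel; exists e.+1; apply/asboolP; exists f.
  rewrite leq_eqVlt => /predU1P[->//|]; apply: IH; move: If.
  have It : I (subst u (f e.+1) * a ^+ e.+1) by rewrite mulrC; apply: (IM); exact: (Iu _).1 Ie.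
  by rewrite big_ord_recr /= => If; have := idealB idI If It; rewrite addrK.
case: (ex_minnP exrel) => e /asboolP[f [fe If]] mine.
case: e => [|e] in fe If mine *.
  by case: fe; apply/Iu; move: If; rewrite big_ord1 expr0 mulr1.
pose g j := f j.+1 *+ j.+1.
have : I (lder X a * \sum_(j < e.+1) subst u (g j) * a ^+ j).
  have := IX _ If; rewrite (raddf_sum (lder X)) /=.
  under eq_bigr do rewrite lderM; rewrite big_split /= => IX'.
  have Is : I (\sum_(j < e.+2) lder X (subst u (f j)) * a ^+ j).
    by apply: ideal_sum => // j _; rewrite mulrC; apply: IM.
  have := idealB idI IX' Is; rewrite addrAC subrr add0r big_ord_recl expr0.
  rewrite (_ : lder X 1 = 0) ?mulr0 ?add0r; last by rewrite -mpolyC1 /lder vderC.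
  congr I; rewrite mulr_sumr; apply: eq_bigr => j _.
  by rewrite lift0 lder_exp /g raddfMn /= mulrnAr mulrnAl mulrnAr mulrA; congr (_ *+ _); ring.
case/IP => // Ig; exfalso.
suff : rel e by move/mine; rewrite ltnn.
apply/asboolP; exists g; split=> //.
by move/(natr_mul_prime PI (ltn0Sn e)).
Qed.

End DominantEndomorphism.

(** * Comorphisms *)

Section OverSubfield.
Variables (F : fieldType) (n : nat) (K : divringClosed F).
Notation N := (n * n + 1)%N.
Notation S := {mpoly F[n * n + 1]}.

Lemma over_subst (u : 'I_N -> S) p : (forall k, u k \is a mpolyOver _ K) ->
  p \is a mpolyOver _ K -> subst u p \is a mpolyOver _ K.
Proof.
move=> uK pK; rewrite {1}(mpolyE p) (raddf_sum (subst u)); apply: rpred_sum => m _.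
rewrite /= linearZ /=; apply: mpolyOverZ; first by have /mpolyOverP := pK; apply.
rewrite mpolyXE_id rmorph_prod.
by apply: rpred_prod => k _; rewrite rmorphXn /= substX; apply: rpredX.
Qed.

Lemma over_mpolyX N' (i : 'I_N') : ('X_i : {mpoly F[N']}) \is a mpolyOver _ K.
Proof. exact: mpolyOverX. Qed.

Lemma over_det m N' (M : 'M[{mpoly F[N']}]_m) :
  (forall i j, M i j \is a mpolyOver _ K) -> \det M \is a mpolyOver _ K.
Proof.
move=> MK; apply: rpred_sum => s _; rewrite rpredM ?rpred_prod //.
by rewrite rpredX // rpredN rpred1.
Qed.

Lemma over_adj m N' (M : 'M[{mpoly F[N']}]_m) :
  (forall i j, M i j \is a mpolyOver _ K) ->
  forall i j, (\adj M) i j \is a mpolyOver _ K.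
Proof.
move=> MK i j; rewrite mxE rpredM ?rpredX ?rpredN ?rpred1 //.
by apply: over_det => a b; rewrite !mxE.
Qed.

Lemma over_gl_pair (M : 'M[S]_n) y k : (forall i j, M i j \is a mpolyOver _ K) ->
  y \is a mpolyOver _ K -> gl_pair M y k \is a mpolyOver _ K.
Proof. by move=> MK yK; elim/gl_pair_ind: k => [i j|]; rewrite ?gl_pair_entry ?gl_pair_last. Qed.

Lemma over_genX i j : genX F n i j \is a mpolyOver _ K.
Proof. by rewrite mxE over_mpolyX. Qed.

(** Equations of a group are polynomials in the matrix entries, while the constructions
    below produce regular functions on GL_n: a power of det clears the denominator and
    does not change the zeros. *)
Lemma clear_denominator (p : S) : p \is a mpolyOver _ K ->
  exists (q : {mpoly F[n * n]}) (e : nat), q \is a mpolyOver _ K /\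
    forall A : 'M[F]_n, A \in unitmx -> q.@[mxvec A 0] = \det A ^+ e * p.@[gl_coord A].
Proof.
pose X : 'M[{mpoly F[n * n]}]_n := \matrix_(i, j) 'X_(mxvec_index i j).
have XK i j : X i j \is a mpolyOver _ K by rewrite mxE over_mpolyX.
have detX (A : 'M[F]_n) : (\det X).@[mxvec A 0] = \det A.
  rewrite -det_map_mx; congr (\det _); apply/matrixP => i j.
  by rewrite !mxE /= mevalXU mxvecE.
pose good (p : S) := exists (q : {mpoly F[n * n]}) (e : nat), q \is a mpolyOver _ K /\
    forall A : 'M[F]_n, A \in unitmx -> q.@[mxvec A 0] = \det A ^+ e * p.@[gl_coord A].
rewrite -/(good p).
have goodM a b : good a -> good b -> good (a * b).
  move=> [q [e [qK qE]]] [q' [e' [qK' qE']]]; exists (q * q'), (e + e')%N.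
  split=> [|A uA]; first exact: rpredM.
  by rewrite !mevalM qE // qE' // exprD mulrACA.
have goodD a b : good a -> good b -> good (a + b).
  move=> [q [e [qK qE]]] [q' [e' [qK' qE']]].
  exists (\det X ^+ e' * q + \det X ^+ e * q'), (e + e')%N; split=> [|A uA].
    by rewrite rpredD ?rpredM ?rpredX ?over_det.
  rewrite !mevalD !mevalM !rmorphXn /= !detX qE // qE' //.
  by rewrite mulrDr exprD; ring.
have goodC c : c \in K -> good c%:MP.
  by move=> cK; exists c%:MP, 0%N; rewrite mpolyOverC; split=> // A _; rewrite !mevalC mul1r.
have goodX k : good 'X_k.
  elim/gl_pair_ind: k => [i j|].
    exists (X i j), 0%N; split=> // A _.
    by rewrite mul1r mxE !mevalXU mxvecE gl_coordE gl_pair_entry.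
  exists 1, 1%N; split=> [|A uA]; first exact: rpred1.
  by rewrite meval1 expr1 mevalXU gl_coordE gl_pair_last mulfV -?unitfE -?unitmxE.
move=> pK; rewrite (mpolyE p); elim/big_ind: _ => [||m _]; first exact: (goodC 0 (rpred0 K)).
  exact: goodD.
rewrite -mul_mpolyC; apply: (goodM); first by apply: goodC; have /mpolyOverP := pK; apply.
rewrite mpolyXE_id; elim/big_ind: _ => [||k _]; first exact: (goodC 1 (rpred1 K)).
  exact: goodM.
elim: (m k) => [|j IH]; first exact: (goodC 1 (rpred1 K)).
by rewrite exprS; exact: goodM.
Qed.

End OverSubfield.

Section Comorphism.
Variables (F : numClosedFieldType) (n : nat).
Notation N := (n * n + 1)%N.
Notation S := {mpoly F[n * n + 1]}.
Implicit Types (A X : 'M[F]_n) (M : 'M[S]_n).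

Definition inv_pair : 'I_N -> S :=
  gl_pair (genY F n *: \adj (genX F n)) (\det (genX F n)).

Lemma meval_det_genX A : (\det (genX F n)).@[gl_coord A] = \det A.
Proof. by rewrite -det_map_mx (meval_genX A). Qed.

Lemma meval_inv_pair A k : A \in unitmx -> (inv_pair k).@[gl_coord A] = gl_coord (invmx A) k.
Proof.
move=> uA; rewrite /inv_pair meval_gl_pair gl_coordE.
apply: eq_gl_pair => [i j|]; last by rewrite meval_det_genX det_inv invrK.
rewrite mxE mxE mevalM (meval_genY A) /invmx uA !mxE; congr (_ * _).
rewrite mevalM rmorphXn /= mevalN meval1; congr (_ * _).
by rewrite -det_map_mx map_row' map_col' (meval_genX A).
Qed.

(** 1 / det M is not a polynomial for a general matrix M, but along a group morphism
    it is the determinant of M at the inverse element, which is a polynomial. *)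
Definition cofun_det M : S := \det (map_mx (subst inv_pair) M).
Definition comor M : S -> S := subst (gl_pair M (cofun_det M)).
HB.instance Definition _ M :=
  GRing.LRMorphism.copy (comor M) (subst (gl_pair M (cofun_det M))).

Lemma comor_entry M i j : comor M 'X_(lshift 1 (mxvec_index i j)) = M i j.
Proof. by rewrite /comor substX gl_pair_entry. Qed.

Definition ev_mx M A : 'M[F]_n := map_mx (meval (gl_coord A)) M.

Lemma meval_cofun_det M A : A \in unitmx -> ev_mx M (invmx A) = invmx (ev_mx M A) ->
  (cofun_det M).@[gl_coord A] = (\det (ev_mx M A))^-1.
Proof.
move=> uA MV; rewrite -det_inv -MV /cofun_det -det_map_mx; congr (\det _).
apply/matrixP => i j; rewrite !mxE /= meval_subst; apply: meval_eq => k.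
by rewrite meval_inv_pair.
Qed.

Lemma meval_comor M A p : A \in unitmx -> ev_mx M (invmx A) = invmx (ev_mx M A) ->
  (comor M p).@[gl_coord A] = p.@[gl_coord (ev_mx M A)].
Proof.
move=> uA MV; rewrite /comor meval_subst; apply: meval_eq => k.
by rewrite meval_gl_pair meval_cofun_det.
Qed.

Lemma over_comor (K : divringClosed F) M p : (forall i j, M i j \is a mpolyOver _ K) ->
  p \is a mpolyOver _ K -> comor M p \is a mpolyOver _ K.
Proof.
move=> MK; apply: over_subst => k; apply: over_gl_pair => //; apply: over_det => i j.
rewrite mxE; apply: over_subst => // {}k; apply: over_gl_pair => [{}i {}j|].
  rewrite mxE rpredM ?over_mpolyX //; apply: over_adj => a b; exact: over_genX.
by apply: over_det => a b; exact: over_genX.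
Qed.

Lemma diff_at_1_1 X : diff_at_1 (1 : S) X = 0.
Proof. by rewrite /diff_at_1 big1 // => k _; rewrite (mderivC k 1) meval0 mul0r. Qed.

(** The coordinate 1 / det of the target is differentiated through the relation
    between [cofun_det] and det M, which need only hold to first order. *)
Lemma diff_comor M X p : ev_mx M 1%:M = 1%:M ->
  diff_at_1 (cofun_det M * \det M - 1) X = 0 ->
  diff_at_1 (comor M p) X = diff_at_1 p (map_mx (fun q => diff_at_1 q X) M).
Proof.
move=> M1 dM; rewrite -meval1_lder /lder /comor vder_subst raddf_sum /diff_at_1.
have MV : ev_mx M (invmx 1%:M) = invmx (ev_mx M 1%:M) by rewrite invmx1 M1 invmx1.
apply: eq_bigr => k _ /=; rewrite mevalM meval_comor ?unitmx1 // M1; congr (_ * _).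
rewrite -/(lder X _) meval1_lder; elim/gl_pair_ind: k => [i j|].
  by rewrite gl_pair_entry /gl_tangent row_mxEl mxvecE !mxE.
rewrite gl_pair_last /gl_tangent row_mxEr mxE eqxx mulr1n; move: dM.
rewrite diff_at_1B diff_at_1M -det_map_mx -/(ev_mx M _) M1 meval_cofun_det ?unitmx1 // M1.
rewrite det1 invr1 mulr1 mul1r diff_at_1_1 (diff_at_1_det X M1) subr0.
by move/eqP; rewrite addr_eq0 => /eqP.
Qed.

Lemma det_genXY_vanishes A : A \in unitmx ->
  (genY F n * \det (genX F n) - 1).@[gl_coord A] = 0.
Proof.
move=> uA; rewrite mevalB meval1 mevalM meval_det_genX (meval_genY A).
by rewrite mulVf ?subrr // -unitfE -unitmxE.
Qed.

Lemma gl_coord_surj (w : 'I_N -> F) : (genY F n * \det (genX F n) - 1).@[w] = 0 ->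
  exists2 A, A \in unitmx & w =1 gl_coord A.
Proof.
pose A : 'M[F]_n := map_mx (meval w) (genX F n).
have wE k : w k = gl_pair A (genY F n).@[w] k.
  by rewrite -[LHS]mevalXU gen_gl_pair meval_gl_pair.
rewrite mevalB meval1 mevalM -det_map_mx => /eqP; rewrite subr_eq0 => /eqP yA.
have A0 : \det A != 0 by apply: contra_eq_neq yA => ->; rewrite mulr0 eq_sym oner_neq0.
exists A; first by rewrite unitmxE unitfE.
by move=> k; rewrite wE gl_coordE; congr gl_pair; rewrite -[LHS](mulfK A0) yA mul1r.
Qed.

End Comorphism.

(** * Algebraic groups, their tangent spaces and morphisms *)

Opaque subst vder lder ltrans comor.

Section AlgebraicGroups.
Variables (C : numClosedFieldType) (K : divringClosed C) (n : nat).
Notation N := (n * n + 1)%N.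
Notation S := {mpoly C[n * n + 1]}.

(** K-groups over any field with the algebraic properties of the complex numbers;
    uncountability is a separate hypothesis. *)
Record algGroup := AlgGroup {
  algGroup_set :> 'M[C]_n -> Prop;
  algGroup1 : algGroup_set 1%:M;
  algGroupM : forall A B, algGroup_set A -> algGroup_set B -> algGroup_set (A *m B);
  algGroupV : forall A, algGroup_set A -> algGroup_set (invmx A);
  algGroup_zeros : exists ps : seq {mpoly C[n * n]},
    (forall p, p \in ps -> p \is a mpolyOver (n * n) K) /\
    (forall A, algGroup_set A <->
       A \in unitmx /\ forall p, p \in ps -> p.@[mxvec A 0] = 0)
}.
Implicit Types (p q : S) (X A B : 'M[C]_n) (G H : algGroup).

Definition tangent G : {vspace 'M[C]_n} :=
  vspan [set X | forall p : {mpoly C[n * n + 1]},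
    (forall A, G A -> p.@[gl_coord A] = 0) -> diff_at_1 p X = 0].

Lemma tangentP G X : (X \in tangent G) <->
  (forall p : {mpoly C[n * n + 1]},
    (forall A, G A -> p.@[gl_coord A] = 0) -> diff_at_1 p X = 0).
Proof.
apply: (vspanP (S := fun X => forall p : {mpoly C[n * n + 1]},
  (forall A, G A -> p.@[gl_coord A] = 0) -> diff_at_1 p X = 0)).
  move=> p _; have := diff_at_1_linear p (-1) 0 0.
  by rewrite scaler0 addr0 mulN1r addNr.
by move=> a U W U0 W0 p p0; rewrite diff_at_1_linear U0 // W0 // mulr0 addr0.
Qed.

Definition vanishing G p : Prop := forall A, G A -> p.@[gl_coord A] = 0.

Lemma algGroup_unit G A : G A -> A \in unitmx.
Proof. by have [ps [_ Gps]] := algGroup_zeros G => /Gps[]. Qed.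

Lemma algGroup_equations G : exists ps : seq S,
  (forall p, p \in ps -> p \is a mpolyOver _ K) /\
  (forall A, G A <-> A \in unitmx /\ forall p, p \in ps -> p.@[gl_coord A] = 0).
Proof.
have [ps [psK Gps]] := algGroup_zeros G.
pose lift (p : {mpoly C[n * n]}) : S := p \mPo [tuple 'X_(lshift 1 k) | k < n * n].
have liftE (p : {mpoly C[n * n]}) A : (lift p).@[gl_coord A] = p.@[mxvec A 0].
  rewrite comp_mpoly_meval; apply: meval_eq => k; rewrite tnth_mktuple mevalXU.
  by rewrite /gl_coord row_mxEl.
exists (map lift ps); split=> [_ /mapP[p /psK pK ->]|A].
  rewrite /lift comp_mpolyEX; apply: rpred_sum => m _; apply: mpolyOverZ.
    by have /mpolyOverP := pK; apply.
  rewrite comp_mpolyX; apply: rpred_prod => k _; rewrite tnth_mktuple.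
  by apply: rpredX; exact: over_mpolyX.
rewrite Gps; split=> -[uA psA]; split=> //.
  by move=> _ /mapP[p /psA pA ->]; rewrite liftE.
by move=> p pps; rewrite -liftE psA ?map_f.
Qed.

Lemma algGroup_of_equations (P : 'M[C]_n -> Prop) (ps : seq S) :
  P 1%:M -> (forall A B, P A -> P B -> P (A *m B)) -> (forall A, P A -> P (invmx A)) ->
  (forall p, p \in ps -> p \is a mpolyOver _ K) ->
  (forall A, P A <-> A \in unitmx /\ forall p, p \in ps -> p.@[gl_coord A] = 0) ->
  exists H : algGroup, forall A, H A <-> P A.
Proof.
move=> P1 PM PV psK Pps.
have /choice[q qP] p : exists q : {mpoly C[n * n]}, p \is a mpolyOver _ K ->
    q \is a mpolyOver _ K /\ forall A : 'M[C]_n, A \in unitmx ->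
      (q.@[mxvec A 0] = 0 <-> p.@[gl_coord A] = 0).
  have [pK|npK] := pselect (p \is a mpolyOver _ K); last by exists 0.
  have [q [e [qK qE]]] := clear_denominator pK; exists q => _; split=> // A uA.
  rewrite qE //; split=> [/eqP|->]; last exact: mulr0.
  rewrite mulf_eq0 expf_eq0 => /orP[/andP[_ detA]|/eqP//].
  by move: uA; rewrite unitmxE unitfE (eqP detA) eqxx.
have zP : exists qs : seq {mpoly C[n * n]},
    (forall r, r \in qs -> r \is a mpolyOver _ K) /\
    (forall A, P A <-> A \in unitmx /\ forall r, r \in qs -> r.@[mxvec A 0] = 0).
  exists (map q ps); split=> [_ /mapP[p /psK/qP[qK _] ->] //|A].
  rewrite Pps; split=> -[uA psA]; split=> //.
    move=> _ /mapP[p pps ->].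
    by have [_ qE] := qP p (psK p pps); apply/qE => //; exact: psA.
  move=> p pps.
  by have [_ qE] := qP p (psK p pps); apply/(qE A uA)/psA/map_f.
by exists (AlgGroup P1 PM PV zP).
Qed.

Lemma vanishing_ideal G : ideal (vanishing G).
Proof.
split=> [A _|p q Gp Gq A GA|a p Gp A GA]; first exact: meval0.
  by rewrite mevalD Gp // Gq // addr0.
by rewrite mevalM Gp // mulr0.
Qed.

Lemma vanishing_ltrans G A p : G A -> vanishing G p -> vanishing G (ltrans A p).
Proof. by move=> GA Gp B GB; rewrite meval_ltrans Gp //; exact: algGroupM. Qed.

Lemma vanishing_lder G X p : X \in tangent G -> vanishing G p -> vanishing G (lder X p).
Proof.
move=> /tangentP LX Gp A GA; rewrite meval_lder; apply: LX.
exact: vanishing_ltrans.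
Qed.

Lemma tangent_sub G H : (forall A, H A -> G A) -> (tangent H <= tangent G)%VS.
Proof.
move=> HG; apply/subvP => X /tangentP HX; apply/tangentP => p Gp; apply: HX => A HA.
exact/Gp/HG.
Qed.

Hypothesis pigeonhole : forall h : C -> nat, exists v, forall m,
  exists s : seq C, [/\ uniq s, size s = m & forall x, x \in s -> h x = v].

Section JetIdealOfSubspace.
Variables (G : algGroup) (L : {vspace 'M[C]_n}).
Hypothesis LG : (L <= tangent G)%VS.

Lemma vanishing_jet p : vanishing G p -> jet_ideal L p.
Proof.
move=> Gp ws; elim: ws p Gp => [|Y ws IH] p Gp wsL; first exact/Gp/algGroup1.
apply: IH => [|X Xws]; last by rewrite wsL // inE Xws orbT.
by apply: vanishing_lder Gp; apply: (subvP LG); rewrite wsL ?mem_head.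
Qed.

(** The jet ideal of a subspace of the Lie algebra of G contains the equations of GL_n,
    so that the points provided by the Nullstellensatz are invertible matrices. *)
Lemma jet_point p : ~ jet_ideal L p -> exists A,
  [/\ A \in unitmx, forall q, jet_ideal L q -> q.@[gl_coord A] = 0 &
      p.@[gl_coord A] != 0].
Proof.
move=> np; have [w [wL wp]] :=
  prime_nullstellensatz pigeonhole (prime_jet_ideal L) np.
have [|A uA wA] := @gl_coord_surj _ _ w.
  apply: wL; apply: vanishing_jet => B GB.
  by apply: det_genXY_vanishes; exact: (algGroup_unit GB).
exists A; split=> // [q Lq|]; first by rewrite -(meval_eq _ wA) wL.
by rewrite -(meval_eq _ wA).
Qed.

End JetIdealOfSubspace.

(** Morphisms are represented by matrices of regular functions, so that they can be
    composed and restricted without changing their type. *)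
Definition morphism_on G H (M : 'M[S]_n) :=
  [/\ forall i j, M i j \is a mpolyOver _ K,
      forall A, G A -> H (ev_mx M A)
    & forall A B, G A -> G B -> ev_mx M (A *m B) = ev_mx M A *m ev_mx M B].

Definition mdiff (M : 'M[S]_n) X : 'M[C]_n := map_mx (fun p => diff_at_1 p X) M.

Lemma mdiff_linear M c X Y : mdiff M (c *: X + Y) = c *: mdiff M X + mdiff M Y.
Proof. by apply/matrixP => i j; rewrite !mxE diff_at_1_linear. Qed.

Section Comorphism.
Variables (G H : algGroup) (M : 'M[S]_n).
Hypothesis GHM : morphism_on G H M.
Notation Phi := (ev_mx M).
Notation alpha := (comor M).

Lemma mor_over i j : M i j \is a mpolyOver _ K. Proof. by case: GHM. Qed.
Lemma mor_in A : G A -> H (Phi A). Proof. by case: GHM => _ + _; apply. Qed.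
Lemma mor_mul A B : G A -> G B -> Phi (A *m B) = Phi A *m Phi B.
Proof. by case: GHM => _ _; apply. Qed.

Lemma mor1 : Phi 1%:M = 1%:M.
Proof.
have uP : Phi 1%:M \in unitmx by exact/(@algGroup_unit H)/mor_in/algGroup1.
have := mor_mul (algGroup1 G) (algGroup1 G).
rewrite mulmx1 => /(congr1 (mulmx (invmx (Phi 1%:M)))).
by rewrite mulmxA mulVmx // mul1mx.
Qed.

Lemma morV A : G A -> Phi (invmx A) = invmx (Phi A).
Proof.
move=> GA; have uA := algGroup_unit GA; have uP : Phi A \in unitmx.
  exact/(@algGroup_unit H)/mor_in.
have := mor_mul GA (algGroupV GA); rewrite mulmxV // mor1.
by move/(congr1 (mulmx (invmx (Phi A)))); rewrite mulmx1 mulmxA mulVmx // mul1mx.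
Qed.

Lemma meval_mor A p : G A -> (alpha p).@[gl_coord A] = p.@[gl_coord (Phi A)].
Proof. by move=> GA; rewrite meval_comor ?(algGroup_unit GA) //; exact: morV. Qed.

Lemma mor_vanishing p : vanishing H p -> vanishing G (alpha p).
Proof. by move=> Hp A GA; rewrite meval_mor // Hp //; exact: mor_in. Qed.

Lemma diff_mor X p : X \in tangent G -> diff_at_1 (alpha p) X = diff_at_1 p (mdiff M X).
Proof.
move=> GX; rewrite diff_comor ?mor1 //.
move/tangentP: GX; apply=> A GA; rewrite mevalB meval1 mevalM.
rewrite meval_cofun_det ?(algGroup_unit GA) //; last exact: morV.
rewrite -det_map_mx -/(ev_mx _ _) mulVf ?subrr // -unitfE -unitmxE.
exact/(@algGroup_unit H)/mor_in.
Qed.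

Lemma mdiff_tangent X : X \in tangent G -> mdiff M X \in tangent H.
Proof.
move=> GX; apply/tangentP => p Hp; rewrite -diff_mor //.
by move/tangentP: GX; apply; exact: mor_vanishing.
Qed.

(** The comorphism intertwines the field of X with the field of its image, but only
    modulo the functions that vanish on G. *)
Lemma lder_mor X p : X \in tangent G ->
  vanishing G (lder X (alpha p) - alpha (lder (mdiff M X) p)).
Proof.
move=> GX A GA.
have e1 : (lder X (alpha p)).@[gl_coord A] = diff_at_1 (ltrans A (alpha p)) X.
  exact: meval_lder.
have e2 : (alpha (lder (mdiff M X) p)).@[gl_coord A] =
    diff_at_1 (alpha (ltrans (Phi A) p)) X.
  by rewrite (meval_mor _ GA) meval_lder (diff_mor _ GX).
rewrite mevalB e1 e2 -diff_at_1B; move/tangentP: (GX); apply=> B GB.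
have e3 : (ltrans A (alpha p)).@[gl_coord B] = p.@[gl_coord (Phi (A *m B))].
  rewrite meval_ltrans; exact: meval_mor (algGroupM GA GB).
have e4 : (alpha (ltrans (Phi A) p)).@[gl_coord B] = p.@[gl_coord (Phi A *m Phi B)].
  rewrite (meval_mor _ GB); exact: meval_ltrans.
rewrite mevalB e3 e4.
by rewrite (mor_mul GA GB) subrr.
Qed.

Lemma lword_mor ws p : {subset ws <= tangent G} ->
  vanishing G (lword ws (alpha p) - alpha (lword (map (mdiff M) ws) p)).
Proof.
have vG := vanishing_ideal G.
have vlw us q : {subset us <= tangent G} -> vanishing G q -> vanishing G (lword us q).
  elim: us q => [//|X us IH] q usG Gq /=; apply: IH => [Y Yus|].
    by rewrite usG // inE Yus orbT.
  by apply: vanishing_lder => //; rewrite usG ?mem_head.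
have lwB us q r : lword us (q - r) = lword us q - lword us r.
  by elim: us q r => [//|X us IH] q r; rewrite /= raddfB IH.
elim: ws p => [|X ws IH] p wsG /=; first by rewrite subrr; case: vG.
have GX : X \in tangent G by rewrite wsG ?mem_head.
have {}wsG : {subset ws <= tangent G} by move=> Y Yws; rewrite wsG // inE Yws orbT.
have [_ vD _] := vG; have := vD _ _ (vlw _ _ wsG (lder_mor p GX)) (IH (lder (mdiff M X) p) wsG).
by rewrite lwB addrA subrK.
Qed.

End Comorphism.

Definition mdiffl (M : 'M[S]_n) : 'End('M[C]_n) := linfun (mdiff M).

Lemma mdifflE M X : mdiffl M X = mdiff M X.
Proof.
pose f := GRing.isLinear.Build C 'M[C]_n 'M[C]_n *:%R (mdiff M) (mdiff_linear M).
pose g : {linear 'M[C]_n -> 'M[C]_n} := HB.pack (mdiff M) f.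
exact: (lfunE g X).
Qed.

(** The kernel subgroup Z has the expected Lie algebra L. A function that vanishes on Z
    has trivial jets along L: otherwise the Nullstellensatz would give a zero of the
    jet ideal of L outside Z, while the equations of Z lie in this jet ideal, since
    the morphism is constant to all orders along L. *)
Lemma kernel_algebraic G H M : morphism_on G H M ->
  exists2 Z : algGroup, forall A, Z A -> G A &
    tangent Z = (tangent G :&: lker (mdiffl M))%VS.
Proof.
move=> mM; have [ps [psK Gps]] := algGroup_equations G.
pose P A := G A /\ ev_mx M A = 1%:M.
pose es := [seq M ij.1 ij.2 - (ij.1 == ij.2)%:R%:MP | ij <- enum {: 'I_n * 'I_n}].
have esE A : (forall p, p \in es -> p.@[gl_coord A] = 0) <-> ev_mx M A = 1%:M.
  split=> [esA|MA p /mapP[ij _ ->]].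
    apply/matrixP => i j; rewrite !mxE; apply/eqP; rewrite -subr_eq0; apply/eqP.
    rewrite -[X in _ - X](mevalC (gl_coord A)) -mevalB; apply: esA.
    by apply/mapP; exists (i, j); rewrite ?mem_enum.
  rewrite mevalB mevalC; have /matrixP/(_ ij.1 ij.2) := MA.
  by rewrite !mxE => ->; rewrite subrr.
have [|A B [GA MA] [GB MB]|A [GA MA]|||Z ZP] := @algGroup_of_equations P (ps ++ es).
- by split; [exact: algGroup1 | exact: mor1 mM].
- by split; [exact: algGroupM | rewrite (mor_mul mM) // MA MB mulmx1].
- by split; [exact: algGroupV | rewrite (morV mM) // MA invmx1].
- move=> p; rewrite mem_cat => /orP[/psK//|/mapP[ij _ ->]].
  by rewrite rpredB ?(mor_over mM) // mpolyOverC rpred_nat.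
- move=> A; rewrite /P Gps -esE; split=> [[[uA psA] esA]|[uA pA]].
    by split=> // p; rewrite mem_cat => /orP[/psA|/esA].
  split; last by move=> p pp; apply: pA; rewrite mem_cat pp orbT.
  by split=> // p pp; apply: pA; rewrite mem_cat pp.
exists Z => [A /ZP[]//|].
have ZG : (tangent Z <= tangent G)%VS by apply: tangent_sub => A /ZP[].
apply/eqP; rewrite eqEsubv subv_cap ZG /=; apply/andP; split.
  apply/subvP => X ZX; rewrite memv_ker mdifflE; apply/eqP/matrixP => i j.
  rewrite !mxE; have := (tangentP Z X).1 ZX (M i j - (i == j)%:R%:MP).
  rewrite -[X in diff_at_1 (_ - X)]mulr1 diff_at_1B diff_at_1M diff_at_1_1 mulr0 addr0.
  rewrite meval1 mulr1 {2}/diff_at_1 big1 ?subr0 => [|k _]; last first.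
    by rewrite mderivC meval0 mul0r.
  by apply=> A /ZP[_ /esE MA]; apply/MA/mapP; exists (i, j); rewrite ?mem_enum.
apply/subvP => X LX; set L := (_ :&: _)%VS in LX.
have LG : (L <= tangent G)%VS by exact: capvSl.
apply/tangentP => p Zp; apply: (@jet_diff _ _ L) LX; apply: contrapT => np.
have [A [uA LA pA]] := jet_point LG np; case/eqP: pA; apply: Zp; apply/ZP; split.
  by apply/Gps; split=> // q qps; apply: LA; apply: (vanishing_jet LG) => B /Gps[_]; exact.
apply/esE => _ /mapP[[i j] _ ->] /=; apply: LA => -[|Y ws] wsL /=.
  rewrite mevalB mevalC; have /matrixP/(_ i j) := mor1 mM.
  by rewrite !mxE => ->; rewrite subrr.
have LY : Y \in L by rewrite wsL ?mem_head.
have : vanishing G (lder Y (M i j - (i == j)%:R%:MP)).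
  have GY : Y \in tangent G by exact: (subvP LG).
  have := lder_mor mM 'X_(lshift 1 (mxvec_index i j)) GY.
  have -> : mdiff M Y = 0.
    by move: LY; rewrite memv_cap memv_ker mdifflE => /andP[_ /eqP].
  have -> q : lder 0 q = 0 by have := lder_linear (-1) 0 0 q; rewrite scaler0 addr0 scaleN1r addNr.
  by rewrite raddf0 subr0 comor_entry raddfB /= lderC subr0.
move/(vanishing_jet LG); apply=> Z' Zws; by rewrite wsL // inE Zws orbT.
Qed.

End AlgebraicGroups.

(** * Descent to the subfield *)

Section Descent.
Variables (F : numClosedFieldType) (K : divringClosed F).

Definition aut_over (s t : {rmorphism F -> F}) :=
  [/\ cancel s t, cancel t s & forall x, x \in K -> s x = x].

Lemma aut_over_sym s t : aut_over s t -> aut_over t s.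
Proof. by move=> [st ts sK]; split=> // x xK; rewrite -{1}(sK x xK) st. Qed.

(** This is where the automorphisms that move a given element are used. *)
Lemma fixed_by_automorphisms c : (forall s t, aut_over s t -> s c = c) -> c \in K.
Proof.
move=> fixc; apply/negPn/negP => /exists_automorphism_moving[s [[t0 st ts] sK]].
have t0M := can2_monoid_morphism st ts; have t0B := can2_zmod_morphism st ts.
pose tA := GRing.isZmodMorphism.Build F F t0 t0B.
pose tR := GRing.isMonoidMorphism.Build F F t0 t0M.
pose t : {rmorphism F -> F} := HB.pack t0 tA tR.
by rewrite (fixc s t) ?eqxx.
Qed.

Section Polynomials.
Variable N : nat.
Notation S := {mpoly F[N]}.
Implicit Types p q : S.
Variable J : S -> Prop.
Hypothesis JB : forall p q, J p -> J q -> J (p - q).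
Hypothesis JZ : forall c p, J p -> J (c *: p).
Hypothesis Jaut : forall s t, aut_over s t -> forall p, J p -> J (map_mpoly s p).

Lemma msupp_sub_lead p q m : {subset msupp q <= msupp p} -> q@_m = 1 ->
  forall r, r = p - p@_m *: q -> {subset msupp r <= msupp p} /\ m \notin msupp r.
Proof.
move=> qp qm r ->; split=> [m'|].
  move=> /msuppB_le; rewrite mem_cat => /orP[//|/msuppZ_le/qp//].
by rewrite mcoeff_msupp negbK mcoeffB mcoeffZ qm mulr1 subrr.
Qed.

Lemma size_msupp_lt p q m : {subset msupp q <= msupp p} -> m \in msupp p ->
  m \notin msupp q -> (size (msupp q) < size (msupp p))%N.
Proof.
move=> qp mp mq; have : (size (m :: msupp q) <= size (msupp p))%N.
  apply: uniq_leq_size; first by rewrite /= mq msupp_uniq.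
  by move=> m'; rewrite inE => /predU1P[->|/qp].
by [].
Qed.

(** A nonzero element of minimal support, normalised to have a coefficient 1, is
    fixed by all automorphisms, hence is defined over K. *)
Lemma minimal_support p : J p -> p != 0 -> exists q m, [/\ J q,
  q \is a mpolyOver _ K, {subset msupp q <= msupp p}, m \in msupp p & q@_m = 1].
Proof.
move=> Jp p0.
pose Q k := `[< exists q, [/\ J q, q != 0, {subset msupp q <= msupp p} & size (msupp q) = k] >].
have exQ : exists k, Q k by exists (size (msupp p)); apply/asboolP; exists p; split.
case: (ex_minnP exQ) => k /asboolP[q [Jq q0 qp sq]] minq.
pose m := mlead q; have qm0 : q@_m != 0 by rewrite mleadc_eq0.
pose r := (q@_m)^-1 *: q.
have rm : r@_m = 1 by rewrite mcoeffZ mulVf.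
have rq : msupp r =i msupp q by apply/perm_mem/msuppZ; rewrite invr_eq0.
exists r, m; split=> //; first exact: JZ.
- apply/mpolyOverP => m'; apply: fixed_by_automorphisms => s t st.
  pose d := map_mpoly s r - r.
  have dE m'' : d@_m'' = s r@_m'' - r@_m'' by rewrite mcoeffB mcoeff_map_mpoly.
  suff : d = 0 by move/(congr1 (mcoeff m'))/eqP; rewrite dE mcoeff0 subr_eq0 => /eqP.
  apply/eqP; apply: contraT => d0.
  have dq : {subset msupp d <= msupp q}.
    move=> m''; rewrite -rq !mcoeff_msupp dE; apply: contraNN => /eqP->.
    by rewrite rmorph0 subrr.
  have dm : m \notin msupp d by rewrite mcoeff_msupp negbK dE rm rmorph1 subrr.
  have lt_d : (size (msupp d) < k)%N.
    by rewrite -sq; apply: (@size_msupp_lt _ _ m); rewrite ?mlead_supp.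
  suff /minq : Q (size (msupp d)) by rewrite leqNgt lt_d.
  apply/asboolP; exists d; split=> //; last by move=> m'' /dq/qp.
  by apply: JB; [exact: (Jaut st (JZ _ Jq)) | exact: JZ].
- by move=> m'; rewrite rq => /qp.
by apply: qp; exact: mlead_supp.
Qed.

(** Subtracting a multiple of an element of minimal support defined over K makes the
    support smaller. *)
Lemma Kspanned p : J p -> exists s : seq (F * S), p = \sum_(cq <- s) cq.1 *: cq.2 /\
  forall cq, cq \in s -> [/\ J cq.2, cq.2 \is a mpolyOver _ K & (msize cq.2 <= msize p)%N].
Proof.
suff : forall k p, (size (msupp p) <= k)%N -> J p ->
    exists s : seq (F * S), p = \sum_(cq <- s) cq.1 *: cq.2 /\
    forall cq, cq \in s -> [/\ J cq.2, cq.2 \is a mpolyOver _ K & {subset msupp cq.2 <= msupp p}].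
  move=> /(_ _ p (leqnn _)) + Jp => /(_ Jp)[s [pE sP]]; exists s; split=> // cq /sP[? ? qp].
  split=> //; rewrite [msize cq.2]msizeE; apply/bigmax_leqP_seq => m /qp mp _.
  exact: msize_mdeg_lt.
elim=> [|k IH] {}p sp Jp.
  have p0 : p = 0 by apply/msuppnil0/size0nil/eqP; rewrite -leqn0.
  by exists [::]; split; rewrite ?big_nil.
have [->|p0] := eqVneq p 0; first by exists [::]; split; rewrite ?big_nil.
have [q [m [Jq qK qp mp qm]]] := minimal_support Jp p0.
pose r := p - p@_m *: q; have [rp mr] := msupp_sub_lead qp qm (erefl r).
have [|s [rE sP]] := IH r _ (JB Jp (JZ _ Jq)).
  by rewrite -ltnS (leq_trans (size_msupp_lt rp mp mr)).
exists ((p@_m, q) :: s); split=> [|cq].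
  by rewrite big_cons -rE addrC subrK.
rewrite inE => /predU1P[->//|/sP[? ? qr]]; split=> // m' /qr; exact: rp.
Qed.

(** The part of J of bounded degree has the same zeros as finitely many of its
    elements defined over K: any maximal linearly independent family of them. *)
Lemma finite_equations d : exists s : seq S,
  (forall p, p \in s -> [/\ J p, p \is a mpolyOver _ K & (msize p <= d)%N]) /\
  (forall v : 'I_N -> F, (forall p, p \in s -> p.@[v] = 0) ->
     forall p, J p -> (msize p <= d)%N -> p.@[v] = 0).
Proof.
pose good (s : seq S) :=
  (forall p, p \in s -> [/\ J p, p \is a mpolyOver _ K & (msize p <= d)%N]) /\
  (forall c : 'I_(size s) -> F, \sum_i c i *: s`_i = 0 -> forall i, c i = 0).
pose Q k := `[< exists s, good s /\ size s = k >].
have exQ : exists k, Q k.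
  exists 0%N; apply/asboolP; exists [::]; split=> //; split=> [|c _ []] //.
have ubQ k : Q k -> (k <= #|{: 'X_{1..N < d}}|)%N.
  case/asboolP => s [[sP sI] <-]; rewrite leqNgt; apply/negP => lt.
  have sd (i : 'I_(size s)) : (msize s`_i <= d)%N.
    by have [] := sP _ (mem_nth 0 (ltn_ord i)).
  have lt' : (#|{: 'X_{1..N < d}}| < #|'I_(size s)|)%N by rewrite card_ord.
  have [c [i ci] /sI c0] := bounded_dependent sd lt'.
  by rewrite c0 eqxx in ci.
case: (ex_maxnP exQ ubQ) => k /asboolP[s [[sP sI] sk]] maxs.
exists s; split=> // v sv.
have Kv p : J p -> p \is a mpolyOver _ K -> (msize p <= d)%N -> p.@[v] = 0.
  move=> Jp pK pd; apply: contrapT => /eqP pv.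
  suff /maxs : Q k.+1 by rewrite ltnn.
  apply/asboolP; exists (p :: s); split; last by rewrite /= sk.
  split=> [q|c]; first by rewrite inE => /predU1P[->//|/sP].
  rewrite big_ord_recl /= => c0.
  have c00 : c ord0 = 0.
    apply/eqP; have /(congr1 (meval v))/eqP := c0.
    rewrite meval0 mevalD mevalZ raddf_sum big1 /= => [|i _].
      by rewrite addr0 mulf_eq0 (negPf pv) orbF.
    by rewrite mevalZ sv ?mulr0 //; apply: mem_nth; exact: (ltn_ord i).
  move: c0; rewrite c00 scale0r add0r => /sI ci i.
  by have [j ->|->] := unliftP ord0 i; [exact: ci | exact: c00].
move=> p Jp pd; have [t [pE tP]] := Kspanned Jp; rewrite pE.
rewrite raddf_sum big_seq big1 //= => cq /tP[Jq qK qp].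
by rewrite mevalZ (Kv _ Jq qK (leq_trans qp pd)) mulr0.
Qed.

End Polynomials.
End Descent.

(** * The Galois action *)

Section GaloisAction.
Variables (F : numClosedFieldType) (n : nat) (s : {rmorphism F -> F}).
Notation S := {mpoly F[n * n + 1]}.
Notation ms := (map_mpoly s).
Implicit Types (p q : S) (A X : 'M[F]_n).

Lemma meval_map N (p : {mpoly F[N]}) (v : 'I_N -> F) :
  (ms p).@[fun k => s (v k)] = s p.@[v].
Proof.
elim/mpolyind: p => [|c m p _ _ IH]; first by rewrite !(rmorph0, meval0).
rewrite !rmorphD /= IH map_mpolyZ !mevalZ rmorphM map_mpolyX; congr (_ * _ + _).
by rewrite !mevalX rmorph_prod; apply: eq_bigr => k _; rewrite rmorphXn.
Qed.

Lemma map_gl_coord A k : gl_coord (map_mx s A) k = s (gl_coord A k).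
Proof.
by elim/gl_pair_ind: k => [i j|];
  rewrite !gl_coordE ?gl_pair_entry ?gl_pair_last ?mxE // det_map_mx fmorphV.
Qed.

Lemma meval_map_gl A p : (ms p).@[gl_coord (map_mx s A)] = s p.@[gl_coord A].
Proof. by rewrite -meval_map; apply: meval_eq => k; exact: map_gl_coord. Qed.

Lemma map_mderiv p k : (ms p)^`M(k) = ms p^`M(k).
Proof. by apply/mpolyP => m; rewrite mcoeff_map_mpoly !mcoeff_deriv mcoeff_map_mpoly raddfMn. Qed.

Lemma map_lder X p : ms (lder X p) = lder (map_mx s X) (ms p).
Proof.
rewrite !lderE rmorph_sum; apply: eq_bigr => k _.
rewrite rmorphM map_mderiv; congr (_ * _).
elim/gl_pair_ind: k => [i j|]; rewrite /lfield ?gl_pair_entry ?gl_pair_last.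
  rewrite !mxE rmorph_sum; apply: eq_bigr => l _; rewrite rmorphM !mxE /=.
  by rewrite map_mpolyX map_mpolyC.
rewrite /= map_mpolyZ map_mpolyX; congr (_ *: _).
by rewrite rmorphN; congr (- _); rewrite /mxtrace rmorph_sum; apply: eq_bigr => i _; rewrite mxE.
Qed.

Lemma map_diff_at_1 X p : diff_at_1 (ms p) (map_mx s X) = s (diff_at_1 p X).
Proof.
rewrite -!meval1_lder -map_lder -meval_map_gl; apply: meval_eq => k.
by rewrite map_mx1.
Qed.

Lemma map_lword ws p : ms (lword ws p) = lword (map (map_mx s) ws) (ms p).
Proof. by elim: ws p => [//|X ws IH] p; rewrite /= IH map_lder. Qed.

End GaloisAction.

Lemma map_over (F : numClosedFieldType) (K : divringClosed F) N
    (s t : {rmorphism F -> F}) (p : {mpoly F[N]}) :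
  aut_over K s t -> p \is a mpolyOver _ K -> map_mpoly s p = p.
Proof.
move=> [_ _ sK] /mpolyOverP pK; apply/mpolyP => m.
by rewrite mcoeff_map_mpoly; exact/sK/pK.
Qed.

Section GaloisStable.
Variables (F : numClosedFieldType) (K : divringClosed F) (n : nat).
Variables (s t : {rmorphism F -> F}).
Hypothesis st : aut_over K s t.
Notation S := {mpoly F[n * n + 1]}.
Implicit Types (G : algGroup K n) (p q : S) (A X : 'M[F]_n).

Lemma map_mxK (s' t' : {rmorphism F -> F}) X : cancel s' t' -> map_mx t' (map_mx s' X) = X.
Proof. by move=> c; apply/matrixP => i j; rewrite !mxE c. Qed.

Lemma map_algGroup G A : G A -> G (map_mx s A).
Proof.
have [ps [psK Gps]] := algGroup_equations G; move=> /Gps[uA psA]; apply/Gps; split.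
  by rewrite map_unitmx.
move=> p pps; rewrite -(map_over st (psK p pps)) meval_map_gl psA // rmorph0 //.
Qed.

End GaloisStable.

Section GaloisInvariance.
Variables (F : numClosedFieldType) (K : divringClosed F) (n : nat).
Variables (s t : {rmorphism F -> F}).
Hypothesis st : aut_over K s t.
Notation S := {mpoly F[n * n + 1]}.
Implicit Types (G : algGroup K n) (p q : S) (A X : 'M[F]_n).

Lemma map_vanishing G p : vanishing G p -> vanishing G (map_mpoly s p).
Proof.
have [_ ts _] := st; move=> Gp A GA; rewrite -(map_mxK A ts) meval_map_gl Gp ?rmorph0 //.
exact: (map_algGroup (aut_over_sym st)).
Qed.

Lemma map_mdiff (M : 'M[S]_n) X : (forall i j, M i j \is a mpolyOver _ K) ->
  mdiff M (map_mx s X) = map_mx s (mdiff M X).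
Proof.
move=> MK; apply/matrixP => i j; rewrite !mxE -map_diff_at_1.
by rewrite (map_over st (MK i j)).
Qed.

Lemma map_jet_ideal (L : {vspace 'M[F]_n}) p : (forall X, X \in L -> map_mx t X \in L) ->
  jet_ideal L p -> jet_ideal L (map_mpoly s p).
Proof.
move=> tL Lp ws wsL; have [_ ts _] := st.
have -> : ws = map (map_mx s) (map (map_mx t) ws).
  by rewrite -map_comp -[LHS]map_id; apply: eq_map => X; rewrite /= (map_mxK X ts).
rewrite -map_lword -(map_mx1 s n) meval_map_gl Lp ?rmorph0 // => _ /mapP[X /wsL LX ->].
exact: tL.
Qed.

End GaloisInvariance.

Lemma map_tangent (F : numClosedFieldType) (K : divringClosed F) n
    (s t : {rmorphism F -> F}) (G : algGroup K n) X :
  aut_over K s t -> X \in tangent G -> map_mx s X \in tangent G.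
Proof.
move=> st /tangentP GX; have [_ ts _] := st; apply/tangentP => p Gp.
have pE : p = map_mpoly s (map_mpoly t p).
  by apply/mpolyP => m; rewrite !mcoeff_map_mpoly; exact/esym/ts.
rewrite pE map_diff_at_1 GX ?rmorph0 //.
exact: (map_vanishing (aut_over_sym st)).
Qed.

(** * Images *)

(** A morphism M from G to itself, with differential phi, is considered under the
    assumption that phi maps the image L of phi onto itself, as it does after
    replacing M by a power. *)
Section ImageTheorem.
Variables (C : numClosedFieldType) (K : divringClosed C) (n : nat).
Notation N := (n * n + 1)%N.
Notation S := {mpoly C[n * n + 1]}.
Hypothesis pigeonhole : forall h : C -> nat, exists v, forall m,
  exists s : seq C, [/\ uniq s, size s = m & forall x, x \in s -> h x = v].
Variables (G : algGroup K n) (M : 'M[S]_n).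
Hypothesis mM : morphism_on G G M.
Notation phi := (mdiffl M).
Notation L := (phi @: tangent G)%VS.
Hypothesis phiL : (phi @: L)%VS = L.
Implicit Types (p q : S) (X A B : 'M[C]_n).

Lemma image_sub : (L <= tangent G)%VS.
Proof.
apply/subvP => _ /memv_imgP[X GX ->]; rewrite mdifflE.
exact: mdiff_tangent mM _ GX.
Qed.

Lemma meval_lword_mor ws q : {subset ws <= L} ->
  (lword ws (comor M q)).@[gl_coord 1%:M] = (lword (map (mdiff M) ws) q).@[gl_coord 1%:M].
Proof.
move=> wsL; have wsG : {subset ws <= tangent G} by move=> X /wsL; exact: (subvP image_sub).
have := lword_mor mM q wsG (algGroup1 G); rewrite mevalB.
rewrite (meval_mor mM _ (algGroup1 G)) (mor1 mM) => /eqP.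
by rewrite subr_eq0 => /eqP.
Qed.

(** As phi is onto L, the comorphism induces an injection on the quotient by the jet
    ideal of L. *)
Lemma jet_image q : jet_ideal L q <-> jet_ideal L (comor M q).
Proof.
split=> Lq ws wsL.
  rewrite meval_lword_mor //; apply: Lq => _ /mapP[X /wsL LX ->].
  by rewrite -mdifflE -phiL memv_img.
have [ws' [wsL' <-]] : exists ws', {subset ws' <= L} /\ map (mdiff M) ws' = ws.
  elim: ws wsL => [|X ws IH] wsL; first by exists [::].
  have [|ws' [wsL' <-]] := IH; first by move=> Y Yws; rewrite wsL // inE Yws orbT.
  have : X \in (phi @: L)%VS by rewrite phiL wsL ?mem_head.
  move=> /memv_imgP[Y LY ->]; exists (Y :: ws'); rewrite /= mdifflE; split=> //.
  by move=> Z; rewrite inE => /predU1P[->|/wsL'].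
by rewrite -meval_lword_mor //; exact: Lq.
Qed.

(** The zero set of the jet ideal has no other tangent vectors than those of L.
    Modulo L such a vector may be taken in the kernel of phi. Its left-invariant
    derivation then kills the image of the comorphism, over which all functions are
    algebraic modulo the jet ideal, hence it is zero. *)
Lemma tangent_image X : (forall q, jet_ideal L q -> diff_at_1 q X = 0) -> X \in L.
Proof.
move=> TX; have LG := image_sub.
have GX : X \in tangent G by apply/tangentP => p Gp; apply/TX/(vanishing_jet LG).
have : phi X \in (phi @: L)%VS by rewrite phiL memv_img.
move=> /memv_imgP[X1 LX1 XX1].
pose X0 := X - X1.
have TX0 q : jet_ideal L q -> diff_at_1 q X0 = 0.
  move=> Lq; have -> : X0 = -1 *: X1 + X by rewrite scaleN1r addrC.
  by rewrite diff_at_1_linear (TX q Lq) (jet_diff Lq LX1) mulr0 addr0.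
have GX0 : X0 \in tangent G by rewrite rpredB //; exact: (subvP LG).
have phiX0 : mdiff M X0 = 0 by rewrite -mdifflE linearB /= XX1 subrr.
have [idL L1 _] := prime_jet_ideal L.
have X0eq a : jet_ideal L (lder X0 a).
  apply: (@lder_dominant_eq0 _ _ _ (gl_pair M (cofun_det M))).
  - exact: prime_jet_ideal.
  - exact: jet_image.
  - move=> q; apply: (vanishing_jet LG) => A GA.
    have := lder_mor mM q GX0 GA; rewrite phiX0.
    have -> : lder 0 q = 0 by have := lder_linear (-1) 0 0 q; rewrite scaler0 addr0 scaleN1r addNr.
    by rewrite raddf0 subr0.
  - move=> q Lq; apply: contrapT => nq; have [A [uA LA]] := jet_point pigeonhole LG nq.
    by rewrite meval_lder TX0 ?eqxx //; exact: jet_stable_left.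
suff /eqP : X0 = 0 by rewrite subr_eq0 => /eqP->.
apply/matrixP => i j; rewrite [RHS]mxE -(diff_at_1_genX X0) -meval1_lder.
by apply: (X0eq _ [::]).
Qed.

(** The tangent spaces cut out by the jets of bounded degree decrease with the degree
    and are finite-dimensional. *)
Lemma bounded_tangent : exists d0, forall d, (d0 <= d)%N -> forall X,
  (forall q, jet_ideal L q -> (msize q <= d.+1)%N -> diff_at_1 q X = 0) -> X \in L.
Proof.
pose T d := [set X | forall q, jet_ideal L q -> (msize q <= d.+1)%N -> diff_at_1 q X = 0]%classic.
have TP d X : X \in vspan (T d) <-> T d X.
  apply: vspanP => [q _ _|c U W TU TW q Lq qd].
    by have := diff_at_1_linear q (-1) 0 0; rewrite scaler0 addr0 mulN1r addNr.
  by rewrite diff_at_1_linear TU // TW // mulr0 addr0.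
have ex : exists k, `[< exists d, \dim (vspan (T d)) = k >].
  by exists (\dim (vspan (T 0%N))); apply/asboolP; exists 0%N.
case: (ex_minnP ex) => k /asboolP[d0 d0k] mink.
have T_mono d d' : (d <= d')%N -> (vspan (T d') <= vspan (T d))%VS.
  move=> le_dd; apply/subvP => X /TP TX; apply/TP => q Lq qd; apply: TX => //.
  by rewrite (leq_trans qd).
exists d0 => d d0d X TX; apply: tangent_image => q Lq.
pose e := maxn d (msize q).
have de : (d <= e)%N by exact: leq_maxl.
have : X \in vspan (T d) by apply/TP.
have -> : vspan (T d) = vspan (T e).
  apply/esym/eqP; rewrite eqEdim T_mono //=.
  rewrite (leq_trans (dimvS (T_mono _ _ d0d))) // d0k mink //.
  by apply/asboolP; exists e.
by move=> /TP; apply=> //; rewrite leqW ?leq_maxr.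
Qed.

Section BoundedZeros.
Variable d : nat.

(** The degree is bounded in order to have finitely many equations over K. The bound
    keeps the zeros a group because left translations and left-invariant derivations
    preserve the degree. *)
Definition zero_of_jets A := A \in unitmx /\
  forall q, jet_ideal L q -> (msize q <= d.+1)%N -> q.@[gl_coord A] = 0.

Lemma zero_of_jets1 : zero_of_jets 1%:M.
Proof. by split=> [|q Lq _]; [exact: unitmx1 | exact: (Lq [::])]. Qed.

Lemma zero_of_jets_ltrans A q : zero_of_jets A -> jet_ideal L q -> (msize q <= d.+1)%N ->
  jet_ideal L (ltrans A q).
Proof.
move=> [uA Aq] Lq qd; apply: jet_ltrans => ws wsL; apply: Aq; first exact: jet_lword.
by elim: ws q {Lq wsL} qd => [//|X ws IH] q qd; apply: IH; exact: msize_lder.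
Qed.

Lemma zero_of_jetsM A B : zero_of_jets A -> zero_of_jets B -> zero_of_jets (A *m B).
Proof.
move=> ZA [uB Bq]; split=> [|q Lq qd]; first by rewrite unitmx_mul uB ZA.1.
rewrite -meval_ltrans; apply: Bq; last exact: msize_ltrans.
exact: zero_of_jets_ltrans.
Qed.

(** The left translates of q by the powers of A have bounded degree, so they are
    linearly dependent. If the first nonzero coefficient of a relation is that of
    A ^ m, evaluation at the power of A of exponent - m - 1 leaves only the value of q
    at the inverse of A, because q vanishes at the nonnegative powers of A. *)
Lemma zero_of_jetsV A : zero_of_jets A -> zero_of_jets (invmx A).
Proof.
move=> ZA; have [uA Aq] := ZA; split=> [|q Lq qd]; first by rewrite unitmx_inv.
pose tr k := iter k (ltrans A) q.
have trP k : jet_ideal L (tr k) /\ (msize (tr k) <= d.+1)%N.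
  elim: k => [//|k [Lk kd]] /=; split; last exact: msize_ltrans.
  exact: zero_of_jets_ltrans.
pose D := #|{: 'X_{1..N < d.+1}}|.
have trd (k : 'I_D.+1) : (msize (tr k) <= d.+1)%N by case: (trP k).
have ltD : (#|{: 'X_{1..N < d.+1}}| < #|'I_D.+1|)%N by rewrite card_ord.
have [c [i0 ci0] c0] := bounded_dependent trd ltD.
have ex : exists i, (i < D.+1)%N && (c (inord i) != 0).
  by exists i0; rewrite ltn_ord inord_val.
case: (ex_minnP ex) => m /andP[mD cm] minm.
pose B := iter m.+1 (mulmx (invmx A)) 1%:M.
have trB k B' : (tr k).@[gl_coord B'] = q.@[gl_coord (iter k (mulmx A) B')].
  elim: k B' => [//|k IH] B'; rewrite /tr iterS -/(tr k) meval_ltrans IH.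
  by congr (_.@[gl_coord _]); rewrite -iterSr.
have AB k B' : iter k (mulmx A) (iter k (mulmx (invmx A)) B') = B'.
  by elim: k => [//|k IH]; rewrite iterSr iterS mulmxA mulmxV // mul1mx.
have ZAk k : zero_of_jets (iter k (mulmx A) 1%:M).
  by elim: k => [|k IH]; [exact: zero_of_jets1 | exact: zero_of_jetsM].
have := congr1 (meval (gl_coord B)) c0; rewrite meval0 raddf_sum /=.
have mo : (m < D.+1)%N by [].
rewrite (bigD1 (Ordinal mo)) //= big1 ?addr0 => [|i ne_im].
  rewrite mevalZ => /eqP; rewrite mulf_eq0.
  have -> : Ordinal mo = inord m by apply: ord_inj; rewrite inordK.
  rewrite (negPf cm) /= trB => /eqP <-; congr (_.@[gl_coord _]).
  by rewrite /B iterSr AB mulmx1.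
rewrite mevalZ; have [im|mi] := ltnP i m.
  have [->|ci] := eqVneq (c i) 0; first by rewrite mul0r.
  by have := minm i; rewrite ltn_ord inord_val ci leqNgt im => /(_ isT).
have {ne_im}mi : (m < i)%N by rewrite ltn_neqAle mi andbT; apply: contraNneq ne_im => mi'; apply/eqP/val_inj.
have -> : (tr i).@[gl_coord B] = 0; last by rewrite mulr0.
rewrite trB -(subnK mi) iterD AB.
by have [_] := ZAk (i - m.+1)%N; apply.
Qed.

End BoundedZeros.

(** The zeros of the jets of L of sufficiently high bounded degree. They are defined
    over K by descent: phi is defined over K, so that L, and with it the jet ideal, is
    stable under all automorphisms over K. *)
Theorem image_algebraic : exists2 Z : algGroup K n, forall A, Z A -> G A & tangent Z = L.
Proof.
have LG := image_sub.
have [d0 d0P] := bounded_tangent; have [ps [psK Gps]] := algGroup_equations G.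
pose d := maxn d0 (\max_(p <- ps) msize p).
have Laut s t : aut_over K s t -> forall p, jet_ideal L p -> jet_ideal L (map_mpoly s p).
  move=> st p Lp; apply: (map_jet_ideal st) Lp => _ /memv_imgP[X GX ->].
  have ts := aut_over_sym st.
  rewrite mdifflE -(map_mdiff ts); last exact: mor_over mM.
  by rewrite -mdifflE memv_img // (map_tangent ts).
have [idL L1 _] := prime_jet_ideal L.
have [es [esP esZ]] := @finite_equations _ K N (jet_ideal L) (fun p q => idealB idL)
  (fun c p => @idealZ _ _ _ idL c p) Laut d.+1.
have [||||A|Z ZP] := @algGroup_of_equations _ K n (zero_of_jets d) es.
- exact: zero_of_jets1.
- exact: zero_of_jetsM.
- exact: zero_of_jetsV.
- by move=> p /esP[].
- split=> [[uA ZA]|[uA eA]]; split=> //; first by move=> p /esP[Lp _ pd]; exact: ZA.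
  exact: esZ.
exists Z => [A /ZP[uA ZA]|].
  apply/Gps; split=> // p pps; apply: ZA.
    by apply: (vanishing_jet LG) => B /Gps[_]; apply.
  by rewrite leqW // leq_max (leq_bigmax_seq p) ?orbT.
apply/eqP; rewrite eqEsubv; apply/andP; split; apply/subvP => X.
  move=> /tangentP ZX; apply: (d0P d); first exact: leq_maxl.
  by move=> q Lq qd; apply: ZX => A /ZP[_]; apply.
move=> LX; apply/tangentP => p Zp; apply: jet_diff LX; apply: contrapT => np.
have [A [uA LA]] := jet_point pigeonhole LG np.
by rewrite Zp ?eqxx //; apply/ZP; split=> // q Lq _; exact: LA.
Qed.

End ImageTheorem.

(** * Fitting's lemma *)

Section Composition.
Variables (C : numClosedFieldType) (K : divringClosed C) (n : nat).
Notation S := {mpoly C[n * n + 1]}.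
Implicit Types (G H : algGroup K n) (M : 'M[S]_n).

Definition mor_comp M' M : 'M[S]_n := map_mx (comor M) M'.

Lemma ev_mor_comp G H M' M A : morphism_on G H M -> G A ->
  ev_mx (mor_comp M' M) A = ev_mx M' (ev_mx M A).
Proof.
by move=> mM GA; apply/matrixP => i j; rewrite !mxE; exact: (meval_mor mM).
Qed.

Lemma mdiff_mor_comp G H M' M X : morphism_on G H M -> X \in tangent G ->
  mdiff (mor_comp M' M) X = mdiff M' (mdiff M X).
Proof.
by move=> mM GX; apply/matrixP => i j; rewrite !mxE; exact: (diff_mor mM).
Qed.

Lemma morphism_comp G H H' M' M : morphism_on G H M -> morphism_on H H' M' ->
  morphism_on G H' (mor_comp M' M).
Proof.
move=> mM mM'; split=> [i j|A GA|A B GA GB].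
- by rewrite mxE; apply: over_comor => [a b|]; [exact: mor_over mM _ _ | exact: mor_over mM' _ _].
- by rewrite (ev_mor_comp _ mM GA); apply: (mor_in mM'); exact: mor_in mM _ GA.
rewrite !(ev_mor_comp _ mM) ?(mor_mul mM) //; last exact: algGroupM.
by rewrite (mor_mul mM') //; exact: (mor_in mM).
Qed.

Lemma morphism_id G : morphism_on G G (genX C n).
Proof.
have evE A : ev_mx (genX C n) A = A by exact: meval_genX.
by split=> [i j|A|A B]; rewrite ?evE //; exact: over_genX.
Qed.

Lemma mdiff_id X : mdiff (genX C n) X = X.
Proof. by apply/matrixP => i j; rewrite mxE diff_at_1_genX. Qed.

Lemma morphism_iter G M k : morphism_on G G M -> exists2 M' : 'M[S]_n, morphism_on G G M' &
  forall X, X \in tangent G -> mdiff M' X = iter k (mdiff M) X.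
Proof.
move=> mM; elim: k => [|k [M' mM' M'E]].
  by exists (genX C n); [exact: morphism_id | move=> X _; exact: mdiff_id].
exists (mor_comp M M'); first exact: morphism_comp mM' mM.
by move=> X GX; rewrite (mdiff_mor_comp _ mM' GX) M'E.
Qed.

End Composition.

Section Fitting.
Variables (C : numClosedFieldType) (K : divringClosed C) (n : nat).
Notation S := {mpoly C[n * n + 1]}.
Hypothesis pigeonhole : forall h : C -> nat, exists v, forall m,
  exists s : seq C, [/\ uniq s, size s = m & forall x, x \in s -> h x = v].
Variables (G : algGroup K n) (M : 'M[S]_n).
Hypothesis mM : morphism_on G G M.
Notation phi := (mdiffl M).
Notation g := (tangent G).
Hypothesis g_closed : forall X Y, X \in g -> Y \in g -> bracket X Y \in g.
Hypothesis normal : forall X Y, X \in g -> Y \in g -> bracket X (phi Y) = phi (bracket X Y).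

Definition algebraic_ideal (a : {vspace 'M[C]_n}) :=
  lie_ideal g a /\ exists2 Z : algGroup K n, forall A, Z A -> G A & tangent Z = a.

Hypothesis indecomposable : forall a b, algebraic_ideal a -> algebraic_ideal b ->
  g = (a + b)%VS -> directv (a + b) -> a = 0%VS \/ b = 0%VS.

(** For large k the Lie algebra is the direct sum of the kernel and of the image of
    the k-th power psi of phi. Both are ideals as phi commutes with all adjoint maps,
    and algebraic by [kernel_algebraic] and [image_algebraic], so one of them is
    zero. *)
Theorem fitting : (exists k, forall X, X \in g -> iter k phi X = 0) \/ (phi @: g = g)%VS.
Proof.
have phiE : phi =1 mdiff M by exact: mdifflE.
have phig X : X \in g -> phi X \in g by rewrite phiE; exact: mdiff_tangent mM _.
have iterg k X : X \in g -> iter k phi X \in g by move=> gX; elim: k => //= k; exact: phig.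
pose W k := iter k (fun U => phi @: U)%VS g.
have W_mono j k : (j <= k)%N -> (W k <= W j)%VS.
  move=> /subnKC <-; elim: (k - j)%N => [|i IH]; first by rewrite addn0.
  rewrite addnS (subv_trans _ IH) //; elim: (j + i)%N => [|l IHl] /=.
    by apply/subvP => _ /memv_imgP[X gX ->]; exact: phig.
  exact: limgS.
have ex : exists d, `[< exists k, \dim (W k) = d >].
  by exists (\dim (W 0%N)); apply/asboolP; exists 0%N.
case: (ex_minnP ex) => d /asboolP[k Wk] mind.
have W_stable j : (k <= j)%N -> W j = W k.
  move=> kj; apply/eqP; rewrite eqEdim W_mono //= Wk mind //.
  by apply/asboolP; exists j.
have [M' mM' M'E] := morphism_iter k mM; pose psi := mdiffl M'.
have psiE X : X \in g -> psi X = iter k phi X.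
  move=> gX; rewrite mdifflE M'E // -/(mdiff M); elim: k {W_stable Wk M'E} => //= k <-.
  by rewrite phiE.
have psiW U : (U <= g)%VS -> (psi @: U = iter k (fun U => phi @: U) U)%VS.
  move=> /subvP Ug; apply/vspaceP => Y; apply/memv_imgP/idP.
    case=> X UX ->; rewrite psiE ?Ug //.
    by elim: k {W_stable Wk M'E psiE psi M' mM'} => //= j IH; exact: memv_img.
  have : forall j Y, Y \in iter j (fun U => phi @: U)%VS U -> exists2 X, X \in U & Y = iter j phi X.
    elim=> [|j IH] Y'; first by exists Y'.
    by move=> /memv_imgP[Z /IH[X UX ->] ->]; exists X.
  by move=> /[apply] -[X UX ->]; exists X => //; rewrite psiE ?Ug.
set b := (psi @: g)%VS; have bE : b = W k by exact: psiW.
have bg : (b <= g)%VS by rewrite bE (W_mono 0%N).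
have psib : (psi @: b = b)%VS.
  by rewrite psiW // bE -iterD; exact: (W_stable (k + k)%N (leq_addr _ _)).
set a := (g :&: lker psi)%VS.
have psi_normal X Y : X \in g -> Y \in g -> bracket X (psi Y) = psi (bracket X Y).
  move=> gX gY; rewrite !psiE ?g_closed //.
  elim: k {W_stable Wk M'E psiE psiW bE bg psib b a psi M' mM'} => //= j <-.
  by rewrite normal ?iterg.
have aA : algebraic_ideal a.
  split; last by have [Z ZG ZE] := kernel_algebraic pigeonhole mM'; exists Z.
  split=> [|X Y gX]; first exact: capvSl.
  rewrite !memv_cap !memv_ker => /andP[gY /eqP psiY].
  by rewrite g_closed //= -psi_normal // psiY /bracket mulmx0 mul0mx subrr.
have bA : algebraic_ideal b.
  split; last by have [Z ZG ZE] := image_algebraic pigeonhole mM' psib; exists Z.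
  split=> // X _ gX /memv_imgP[Y gY ->]; rewrite psi_normal // memv_img //.
  exact: g_closed.
have ab0 : (a :&: b = 0)%VS.
  have kb : (b :&: lker psi = 0)%VS.
    have := limg_ker_dim psi b; rewrite psib => /eqP.
    by rewrite -[X in _ == X]add0n eqn_add2r dimv_eq0 => /eqP.
  by apply/eqP; rewrite -subv0 -kb subv_cap capvSr (subv_trans (capvSl _ _) (capvSr _ _)).
have gab : g = (a + b)%VS.
  apply/esym/eqP; rewrite eqEdim subv_add capvSl bg /=.
  by rewrite dimv_disjoint_sum // -(limg_ker_dim psi g).
have [|a0|b0] := indecomposable aA bA gab; first by apply/directv_addP.
  right; have gb : g = W k by rewrite {1}gab a0 add0v bE.
  rewrite {1}gb; change (W k.+1 = g); rewrite W_stable //.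
left; exists k => X gX; rewrite -psiE //; apply/eqP; rewrite -memv0 -b0.
exact: memv_img.
Qed.

End Fitting.

(** * The matching of two systems of idempotents *)

Section Hall.
Variables (I J : finType).
Implicit Types (N : I -> {set J}) (A : {set I}).

Definition neighbours N A : {set J} := \bigcup_(i in A) N i.

Lemma neighboursP N A j : reflect (exists2 i, i \in A & j \in N i) (j \in neighbours N A).
Proof. exact: finset.bigcupP. Qed.

(** Rado's proof: a family minimal among those that satisfy the condition consists of
    singletons. If neither of two elements x, y of N i0 could be deleted, there would
    be two violating sets A1 and A2 that contain i0; the condition for their union and
    for their intersection without i0 contradicts the count of the neighbours. *)
Theorem hall N : (forall A, #|A| <= #|neighbours N A|)%N ->
  exists2 f : I -> J, injective f & forall i, f i \in N i.
Proof.
move: {2}(\sum_i #|N i|)%N (leqnn (\sum_i #|N i|)) => k; elim: k N => [|k IH] N sN HN.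
  have N0 i : N i = finset.set0.
    apply/eqP; rewrite -cards_eq0 -leqn0 (leq_trans _ sN) // (bigD1 i) //= leq_addr //.
  have I0 (i : I) : False.
    have := HN [set i]; rewrite cards1 /neighbours big_set1 N0 cards0 //.
  exists (fun i => False_rect J (I0 i)) => i; by case: (I0 i).
have [/forallP N1|] := boolP [forall i, #|N i| <= 1]%N.
  have Nf i : exists j, N i == [set j].
    have := HN [set i]; rewrite cards1 /neighbours big_set1 => Ni.
    have /cards1P[j ->] : #|N i| == 1%N by rewrite eqn_leq N1.
    by exists j.
  pose f i := xchoose (Nf i); have fE i : N i = [set f i] by apply/eqP/(xchooseP (Nf i)).
  exists f => [i i' ff|i]; last by rewrite fE set11.
  apply/eqP; apply: contraT => ii'; have := HN [set i; i'].
  by rewrite cards2 ii' /neighbours finset.bigcup_setU !big_set1 !fE ff finset.setUid cards1.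
rewrite negb_forall => /existsP[i0]; rewrite -ltnNge => /card_gt1P[x [y [Nx Ny xy]]].
pose del z i := if i == i0 then N i :\ z else N i.
have del_sub z i : del z i \subset N i by rewrite /del; case: eqP => // _; exact: subD1set.
have del_lt z : z \in N i0 -> (\sum_i #|del z i| <= k)%N.
  move=> Nz; rewrite -ltnS (leq_trans _ sN) // [X in (X < _)%N](bigD1 i0) //=.
  rewrite [X in (_ < X)%N](bigD1 i0) //= /del eqxx (cardsD1 z (N i0)) Nz add1n addSn ltnS.
  by rewrite leq_add2l; apply: leq_sum => i /negPf->.
have conclude z : z \in N i0 -> (forall A, #|A| <= #|neighbours (del z) A|)%N ->
    exists2 f : I -> J, injective f & forall i, f i \in N i.
  move=> Nz Hz; have [f fI fN] := IH _ (del_lt z Nz) Hz.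
  by exists f => // i; apply: (fintype.subsetP (del_sub z i)).
have [/forallP Hx|] := boolP [forall A : {set I}, #|A| <= #|neighbours (del x) A|]%N.
  exact: conclude Nx Hx.
rewrite negb_forall => /existsP[A1]; rewrite -ltnNge => lt1.
have [/forallP Hy|] := boolP [forall A : {set I}, #|A| <= #|neighbours (del y) A|]%N.
  exact: conclude Ny Hy.
rewrite negb_forall => /existsP[A2]; rewrite -ltnNge => lt2; exfalso.
have in_viol z A : (#|neighbours (del z) A| < #|A|)%N -> i0 \in A.
  move=> lt; apply: contraTT lt => iA; rewrite -leqNgt.
  suff -> : neighbours (del z) A = neighbours N A by [].
  apply: eq_bigr => i Ai; rewrite /del; case: eqP => // ii; by rewrite ii (negPf iA) in Ai.
have i1 := in_viol _ _ lt1; have i2 := in_viol _ _ lt2.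
set U1 := neighbours (del x) A1 in lt1; set U2 := neighbours (del y) A2 in lt2.
have sub_del z A i j : i \in A -> j \in N i -> (i != i0) || (j != z) ->
    j \in neighbours (del z) A.
  move=> Ai Nj cond; apply/neighboursP; exists i => //; rewrite /del; case: eqP => // ii.
  by rewrite !inE Nj andbT; move: cond; rewrite ii eqxx.
have UU : neighbours N (A1 :|: A2) \subset U1 :|: U2.
  apply/fintype.subsetP => j /neighboursP[ i ]; rewrite !inE => /orP[Ai|Ai] Nj.
    have [ii|ii] := eqVneq i i0; last by rewrite (@sub_del x A1 i) // ii.
    have [->|jx] := eqVneq j x; last by rewrite (@sub_del x A1 i) // jx orbT.
    by rewrite (@sub_del y A2 i0 x) ?orbT // xy orbT.
  have [ii|ii] := eqVneq i i0; last by rewrite (@sub_del y A2 i) ?orbT // ii.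
  have [->|jy] := eqVneq j y; last by rewrite (@sub_del y A2 i) ?orbT // jy orbT.
  by rewrite (@sub_del x A1 i0 y) // eq_sym xy orbT.
have II : neighbours N ((A1 :&: A2) :\ i0) \subset U1 :&: U2.
  apply/fintype.subsetP => j /neighboursP[ i ]; rewrite !inE => /and3P[ii Ai1 Ai2] Nj.
  by rewrite (@sub_del x A1 i) ?(@sub_del y A2 i) ?ii.
have := leq_trans (HN _) (subset_leq_card UU).
have := leq_trans (HN _) (subset_leq_card II).
have := cardsUI U1 U2; have := cardsUI A1 A2.
have := cardsD1 i0 (A1 :&: A2); rewrite inE i1 i2 /=.
move: lt1 lt2; lia.
Qed.

End Hall.

Section Trace.
Variable F : numFieldType.

Lemma mulmx_iter_comm m k (A : 'M[F]_(m, k)) (B : 'M[F]_(k, m)) e :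
  (A *m B) ^+ e *m A = A *m (B *m A) ^+ e.
Proof.
elim: e => [|e IH]; first by rewrite !expr0 mul1mx mulmx1.
by rewrite !exprSr -!mulmxE -mulmxA -(mulmxA A B A) mulmxA IH -[LHS]mulmxA.
Qed.

Lemma exp_mulmx m k (A : 'M[F]_(m, k)) (B : 'M[F]_(k, m)) e :
  (A *m B) ^+ e.+1 = A *m (B *m A) ^+ e *m B.
Proof. by rewrite exprSr -mulmxE mulmxA mulmx_iter_comm. Qed.

Lemma trace_exp_swap m k (A : 'M[F]_(m, k)) (B : 'M[F]_(k, m)) e :
  \tr ((A *m B) ^+ e.+1) = \tr ((B *m A) ^+ e.+1).
Proof.
by rewrite exp_mulmx -mulmxA mxtrace_mulC -mulmxA mulmxE -exprSr.
Qed.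

Definition nilpotent_mx m (x : 'M[F]_m) := exists k, x ^+ k = 0.

Lemma trace_idempotent m (e : 'M[F]_m) : e *m e = e -> \tr e = (\rank e)%:R.
Proof.
move=> ee; rewrite -{1}(mulmx_base e) mxtrace_mulC.
suff -> : row_base e *m col_base e = 1%:M by rewrite mxtrace1.
have cancel_base k (U : 'M[F]_(m, k)) V U' V' : U' *m U = 1%:M -> V *m V' = 1%:M ->
    U *m V *m (U *m V) = U *m V -> V *m U = 1%:M.
  move=> U'U VV' /(congr1 (fun x => U' *m x *m V')).
  by rewrite !mulmxA U'U !mul1mx -!mulmxA VV' !mulmx1.
have /row_freeP[V' VV'] := row_base_free e; have /row_fullP[U' U'U] := col_base_full e.
by apply: cancel_base U'U VV' _; rewrite mulmx_base.
Qed.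

(** By Cayley-Hamilton a multiple of the constant coefficient of the characteristic
    polynomial, which is the determinant up to sign, is the trace of a combination of
    positive powers of x. *)
Lemma trace_zero_unit m (x : 'M[F]_m) : x \in unitmx ->
  (forall k, \tr (x ^+ k.+1) = 0) -> m = 0%N.
Proof.
case: m x => // m x ux tr0; exfalso.
have trX (q : {poly F}) k : \tr (horner_mx x (q * 'X^(k.+1))) = 0.
  elim/poly_ind: q k => [|q c IH] k; first by rewrite mul0r rmorph0 mxtrace0.
  rewrite mulrDl -mulrA -exprS rmorphD /= mxtraceD IH add0r rmorphM /= horner_mx_C.
  by rewrite rmorphXn /= horner_mx_X -mulmxE mul_scalar_mx mxtraceZ tr0 mulr0.
have /factor_theorem[q qE] : root (char_poly x - ((char_poly x)`_0)%:P) 0.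
  by rewrite rootE hornerD hornerN hornerC horner_coef0 subrr.
have pE : char_poly x = q * 'X^1 + ((char_poly x)`_0)%:P.
  by move: qE; rewrite polyC0 subr0 expr1 => <-; rewrite subrK.
have /(congr1 mxtrace) := Cayley_Hamilton x.
rewrite pE rmorphD /= mxtraceD trX add0r horner_mx_C mxtrace_scalar mxtrace0 => /eqP.
rewrite mulrn_eq0 /= char_poly_det mulf_eq0 signr_eq0 /= => /eqP detx.
by move: ux; rewrite unitmxE detx unitr0.
Qed.

(** Exchanging the two factors of a rank factorisation of x keeps the traces of all
    powers and lowers the dimension, unless x is invertible. *)
Lemma nilpotent_of_traces m (x : 'M[F]_m) :
  (forall k, \tr (x ^+ k.+1) = 0) -> nilpotent_mx x.
Proof.
elim/ltn_ind: m x => m IH x tr0.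
have [rm|rm] := ltnP (\rank x) m.
  have [|k yk] := IH _ rm (row_base x *m col_base x).
    by move=> k; rewrite -trace_exp_swap mulmx_base.
  by exists k.+1; rewrite -(mulmx_base x) exp_mulmx yk mulmx0 mul0mx.
have ux : x \in unitmx by rewrite -row_full_unit /row_full eqn_leq rank_leq_row.
exists 0%N; have m0 := trace_zero_unit ux tr0; apply/matrixP => i.
by have := ltn_ord i; rewrite {2}m0.
Qed.

Lemma trace_nilpotent m (x : 'M[F]_m) : nilpotent_mx x -> \tr x = 0.
Proof.
elim/ltn_ind: m x => m IH x [k xk].
have [rm|rm] := ltnP (\rank x) m.
  have := trace_exp_swap (col_base x) (row_base x) 0; rewrite !expr1 mulmx_base => ->.
  apply: IH rm _ _; exists k.+1.
  by rewrite exp_mulmx mulmx_base xk mulmx0 mul0mx.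
have ux : x \in unitmx by rewrite -row_full_unit /row_full eqn_leq rank_leq_row.
have : x ^+ k \in unitmx.
  by elim: k {xk} => [|k IHk]; rewrite ?expr0 ?unitmx1 // exprS -mulmxE unitmx_mul ux.
rewrite xk unitmxE; case: m {IH rm xk ux} x => [|m] x; first by rewrite /mxtrace big_ord0.
by rewrite (_ : \det _ = 0) ?unitr0 //; exact: det0.
Qed.

End Trace.

Section KrullSchmidt.
Variables (F : numFieldType) (d : nat).
Implicit Types (x w : 'M[F]_d) (W : 'M[F]_d -> Prop).

Definition idempotent_system (I : finType) (p : I -> 'M[F]_d) :=
  [/\ forall i, p i *m p i = p i, forall i k, i != k -> p i *m p k = 0,
      \sum_i p i = 1%:M & forall i, p i != 0].

(** The words in W act on the image of each p i either nilpotently or bijectively, as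
    endomorphisms of an object with local endomorphism ring do. *)
Definition local_system W (I : finType) (p : I -> 'M[F]_d) :=
  forall w i, W w -> nilpotent_mx (p i *m w *m p i) \/
    \rank (p i *m w *m p i) = \rank (p i).

Section Matching.
Variables (I J : finType) (p : I -> 'M[F]_d) (q : J -> 'M[F]_d) (W : 'M[F]_d -> Prop).
Hypothesis pS : idempotent_system p.
Hypothesis qS : idempotent_system q.
Hypothesis WM : forall x y, W x -> W y -> W (x *m y).
Hypothesis Wp : forall i, W (p i).
Hypothesis Wq : forall j, W (q j).
Hypothesis pL : local_system W p.
Hypothesis qL : local_system W q.

(** q j *m p i induces a bijection between the images of q j and p i. *)
Definition bijective_entry i j :=
  (\rank (q j *m p i) == \rank (p i)) && (\rank (q j *m p i) == \rank (q j)).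

(** Otherwise q j p i w q j would be bijective on the image of q j, which forces
    q j p i to have the rank of q j, and p i w q j p i would not be nilpotent either,
    which forces q j p i to have the rank of p i too. *)
Lemma trace_non_bijective i j w : ~~ bijective_entry i j -> W w ->
  \tr (q j *m p i *m w) = 0.
Proof.
have [pp _ _ _] := pS; have [qq _ _ _] := qS => nb Ww.
have -> : \tr (q j *m p i *m w) = \tr (q j *m (p i *m w) *m q j).
  by rewrite [RHS]mxtrace_mulC !mulmxA qq.
have [/trace_nilpotent//|ru] := qL j (WM (Wp i) Ww).
have rq : \rank (q j *m p i) = \rank (q j).
  apply/eqP; rewrite eqn_leq mxrankM_maxl -{1}ru.
  by rewrite mulmxA -mulmxA mxrankM_maxl.
have [[k vk]|rv] := pL i (WM Ww (Wq j)).
  apply: trace_nilpotent; exists k.+2.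
  have qz : q j *m (p i *m w) *m q j = q j *m (p i *m w *m q j) by rewrite !mulmxA.
  rewrite qz exp_mulmx -[p i *m w *m q j *m q j]mulmxA qq.
  rewrite -(pp i) -!mulmxA exp_mulmx.
  by rewrite !mulmxA in vk *; rewrite vk !(mulmx0, mul0mx).
case/negP: nb; rewrite /bijective_entry rq eqxx andbT -{1}rq; apply/eqP.
apply/eqP; rewrite eqn_leq mxrankM_maxr -{1}rv.
by rewrite !mulmxA -[p i *m w *m q j *m p i]mulmxA mxrankM_maxr.
Qed.

Lemma rank_idempotent_sum (T : finType) (e : T -> 'M[F]_d) (A : {set T}) :
  idempotent_system e -> \rank (\sum_(t in A) e t)%R = (\sum_(t in A) \rank (e t))%N.
Proof.
move=> [ee e0 _ _]; apply/eqP; rewrite -(eqr_nat F) -trace_idempotent.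
  rewrite natr_sum (raddf_sum (@mxtrace F d)); apply/eqP/eq_bigr => t _.
  by rewrite /= trace_idempotent.
rewrite mulmx_suml; apply: eq_bigr => t At; rewrite mulmx_sumr (bigD1 t) //= ee.
by rewrite big1 ?addr0 // => t' /andP[_ tt']; rewrite e0 // eq_sym.
Qed.

(** Let P be the sum of the p i for i in A and Q' that of the q j for j outside B. All
    words that begin with Q' P have trace zero, so Q' P is nilpotent. Writing
    P = Q P + Q' P repeatedly shows that the rows of P are combinations of those of
    Q P, whence the rank of P is at most that of Q. *)
Lemma rank_le_neighbours (A : {set I}) (B : {set J}) :
  (forall i j, i \in A -> j \notin B -> ~~ bijective_entry i j) ->
  (\sum_(i in A) \rank (p i) <= \sum_(j in B) \rank (q j))%N.
Proof.
move=> nb; rewrite -!rank_idempotent_sum //.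
pose P := \sum_(i in A) p i; pose Q := \sum_(j in B) q j; pose Q' := \sum_(j in ~: B) q j.
have PP : P *m P = P.
  have [pp p0 _ _] := pS.
  rewrite mulmx_suml; apply: eq_bigr => t At; rewrite mulmx_sumr (bigD1 t) //= pp.
  by rewrite big1 ?addr0 // => t' /andP[_ tt']; rewrite p0 // eq_sym.
have QQ' : Q + Q' = 1%:M.
  have [_ _ <- _] := qS; rewrite [RHS](bigID (mem B)) /=; congr (_ + _).
  by apply: eq_bigl => j; rewrite inE.
have trx w : W w -> \tr (Q' *m P *m w) = 0.
  move=> Ww; rewrite mulmx_suml mulmx_suml raddf_sum big1 //= => j.
  rewrite inE => jB; rewrite mulmx_sumr mulmx_suml raddf_sum big1 //= => i iA.
  by rewrite trace_non_bijective ?nb.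
pose span w := exists2 s : seq 'M[F]_d, (forall x, x \in s -> W x) & w = \sum_(x <- s) x.
have spanW x : W x -> span x.
  by move=> Wx; exists [:: x]; rewrite ?big_seq1 // => y; rewrite inE => /eqP->.
have span_sum (T : Type) (r : seq T) (f : T -> 'M[F]_d) (Pr : pred T) :
    (forall t, Pr t -> span (f t)) -> span (\sum_(t <- r | Pr t) f t).
  move=> fS; elim/big_ind: _ => [|a b [s sW ->] [s' sW' ->]|t /fS//].
    by exists [::]; rewrite ?big_nil.
  exists (s ++ s'); rewrite ?big_cat // => x; rewrite mem_cat => /orP[/sW|/sW'] //.
have spanM x y : span x -> span y -> span (x *m y).
  move=> [s sW ->] [s' sW' ->]; rewrite mulmx_suml big_seq; apply: (span_sum) => a /sW Wa.
  rewrite mulmx_sumr big_seq; apply: (span_sum) => b /sW' Wb; exact/spanW/WM.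
have spanP : span P by apply: (span_sum) => i _; exact/spanW/Wp.
have spanQ' : span Q' by apply: (span_sum) => j _; exact/spanW/Wq.
have trs w : span w -> \tr (Q' *m P *m w) = 0.
  move=> [s sW ->]; rewrite mulmx_sumr raddf_sum big_seq big1 //= => x /sW.
  exact: trx.
have [k xk] : nilpotent_mx (Q' *m P).
  apply: nilpotent_of_traces => k; rewrite exprSr -mulmxE mxtrace_mulC.
  case: k => [|k].
    rewrite expr0 mulmx1 -PP mulmxA; exact: trs.
  by apply: trs; elim: k => [|k IH]; rewrite ?expr1 1?exprS -?mulmxE; do ?[exact: spanM | apply: (spanM)].
have yk : P *m (Q' *m P) ^+ k = 0 by rewrite xk mulmx0.
have Pfix : forall j, P *m (Q' *m P) ^+ j = P *m (Q' *m P) ^+ j *m P.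
  case=> [|j]; first by rewrite expr0 mulmx1 PP.
  by rewrite exprSr -mulmxE -!mulmxA PP.
have sub j : (P <= Q *m P + P *m (Q' *m P) ^+ j)%MS.
  elim: j => [|j IH]; first by rewrite expr0 mulmx1 addsmxSr.
  rewrite (submx_trans IH) // addsmx_sub addsmxSl /=.
  rewrite {1}Pfix -{1}(mulmx1 (P *m _)) -QQ'.
  rewrite mulmxDr mulmxDl addmx_sub_adds //.
    by rewrite -mulmxA submxMl.
  by rewrite exprSr -mulmxE !mulmxA.
have /mxrankS le : (P <= Q *m P)%MS.
  by rewrite (submx_trans (sub k)) // yk addsmx_sub submx_refl sub0mx.
by rewrite (leq_trans le) // mxrankM_maxl.
Qed.

(** Hall's condition: bijective entries preserve the rank, so that it suffices to
    compare the idempotents of each given rank, for which [rank_le_neighbours]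
    compares their numbers. *)
Theorem matching : exists2 f : I -> J, injective f & forall i, bijective_entry i (f i).
Proof.
pose N i := [set j | bijective_entry i j]%SET.
suff /hall[f fI fN] : forall A : {set I}, (#|A| <= #|neighbours N A|)%N.
  by exists f => // i; have := fN i; rewrite inE.
move=> A; have [_ _ _ p_n0] := pS.
pose rk m (x : 'M[F]_m) : 'I_m.+1 := inord (\rank x).
have rkE (x : 'M[F]_d) : rk d x = \rank x :> nat by rewrite inordK // ltnS rank_leq_row.
have card_split (T : finType) (e : T -> 'M[F]_d) (B : {set T}) :
    #|B| = (\sum_(k < d.+1) #|[set t in B | rk d (e t) == k]%SET|)%N.
  rewrite -sum1_card (partition_big (fun t => rk d (e t)) xpredT) //=.
  by apply: eq_bigr => k _; rewrite -sum1_card; apply: eq_bigl => t; rewrite inE.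
rewrite (card_split _ p A) (card_split _ q (neighbours N A)); apply: leq_sum => k _.
set Ak := [set t in A | _]%SET; set Bk := [set t in _ | _]%SET.
have rA i : i \in Ak -> \rank (p i) = k by rewrite inE => /andP[_ /eqP <-]; rewrite rkE.
have rB j : j \in Bk -> \rank (q j) = k by rewrite inE => /andP[_ /eqP <-]; rewrite rkE.
have [->|[i0 Ai0]] := set_0Vmem Ak; first by rewrite cards0.
have k0 : (0 < k)%N by rewrite -(rA i0 Ai0) lt0n mxrank_eq0.
have : (\sum_(i in Ak) \rank (p i) <= \sum_(j in Bk) \rank (q j))%N.
  apply: rank_le_neighbours => i j Ai; apply: contraNN => bij.
  have Ai' : i \in A by move: Ai; rewrite inE => /andP[].
  rewrite inE; apply/andP; split; first by apply/neighboursP; exists i => //; rewrite inE.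
  have /andP[/eqP r1 /eqP r2] := bij.
  by apply/eqP/ord_inj; rewrite rkE -r2 r1 rA.
by rewrite (eq_bigr _ rA) (eq_bigr _ rB) !sum_nat_const leq_pmul2r.
Qed.

End Matching.
End KrullSchmidt.

(** * From matrices to endomorphisms of a subspace *)

Section EndomorphismsOfSubspace.
Variables (F : numFieldType) (vT : vectType F) (g : {vspace vT}).
Notation d := (\dim g).
Implicit Types (f : 'End(vT)) (u : 'rV[F]_d).

Let e := vbasis g.

(** Coordinates in a basis of g; matrices act on row vectors, so that [mx_on] reverses
    compositions. *)
Definition vec_of u : vT := \sum_b u 0 b *: e`_b.
Definition mx_on f : 'M[F]_d := \matrix_(a, b) coord e b (f e`_a).

Lemma vec_of_linear c u u' : vec_of (c *: u + u') = c *: vec_of u + vec_of u'.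
Proof.
rewrite /vec_of scaler_sumr -big_split; apply: eq_bigr => b _ /=.
by rewrite !mxE scalerDl scalerA.
Qed.

Lemma vec_of_mem u : vec_of u \in g.
Proof. by apply: rpred_sum => b _; rewrite rpredZ // vbasis_mem // mem_nth ?size_tuple. Qed.

Lemma vec_of_inj u : vec_of u = 0 -> u = 0.
Proof.
move=> u0; have /freeP fr := basis_free (vbasisP g).
by apply/rowP => b; rewrite mxE; apply: fr b; exact: u0.
Qed.

Lemma vec_of_onto x : x \in g -> exists u, x = vec_of u.
Proof.
move=> gx; exists (\row_b coord e b x); rewrite {1}(coord_vbasis gx).
by apply: eq_bigr => b _; rewrite mxE.
Qed.

Definition stable f := forall x, x \in g -> f x \in g.

Lemma vec_of_mx_on f u : stable f -> f (vec_of u) = vec_of (u *m mx_on f).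
Proof.
move=> fg; rewrite linear_sum /=.
have eg (a : 'I_d) : e`_a \in g by rewrite vbasis_mem // mem_nth ?size_tuple.
under eq_bigr => a _ do rewrite linearZ /= (coord_vbasis (fg _ (eg a))) scaler_sumr.
rewrite exchange_big; apply: eq_bigr => b _ /=; rewrite mxE scaler_suml.
by apply: eq_bigr => a _; rewrite mxE scalerA.
Qed.

Lemma mx_onE f (A : 'M[F]_d) : stable f -> (forall u, f (vec_of u) = vec_of (u *m A)) ->
  mx_on f = A.
Proof.
move=> fg fA; apply/row_matrixP => i; rewrite !rowE; apply/eqP; rewrite -subr_eq0.
apply/eqP/vec_of_inj; have := vec_of_linear (-1) (delta_mx 0 i *m A) (delta_mx 0 i *m mx_on f).
by rewrite !scaleN1r addrC => ->; rewrite -fA -vec_of_mx_on // addNr.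
Qed.

Lemma mx_on_comp f f' : stable f -> stable f' -> mx_on (f \o f')%VF = mx_on f' *m mx_on f.
Proof.
move=> fg fg'; apply: mx_onE => [x gx|u]; first by rewrite lfunE /=; exact/fg/fg'.
by rewrite lfunE /= !vec_of_mx_on // mulmxA.
Qed.

Lemma eq_mx_on f f' : {in g, f =1 f'} -> mx_on f = mx_on f'.
Proof.
by move=> ff; apply/matrixP => a b; rewrite !mxE ff // vbasis_mem // mem_nth ?size_tuple.
Qed.

Lemma rank_mx_on f : stable f -> \rank (mx_on f) = \dim (f @: g).
Proof.
move=> fg; pose A := mx_on f; pose B := row_base A.
have vec_sum m (k : 'rV[F]_m) (D : 'M[F]_(m, d)) :
    vec_of (k *m D) = \sum_i k 0 i *: vec_of (row i D).
  rewrite /vec_of; under [RHS]eq_bigr do rewrite scaler_sumr.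
  rewrite exchange_big; apply: eq_bigr => b _ /=; rewrite mxE scaler_suml.
  by apply: eq_bigr => i _; rewrite mxE scalerA.
pose X := [tuple vec_of (row i B) | i < \rank A].
have XE (i : 'I_(\rank A)) : X`_i = vec_of (row i B) by rewrite -tnth_nth tnth_mktuple.
have freeX : free X.
  apply/freeP => k; under eq_bigr do rewrite XE; move=> k0 i.
  have : vec_of ((\row_i k i) *m B) = 0.
    by rewrite vec_sum -[RHS]k0; apply: eq_bigr => j _; rewrite mxE.
  move=> /vec_of_inj; rewrite -[RHS](mul0mx _ B).
  by move=> /(row_free_inj (row_base_free A)) /rowP/(_ i); rewrite !mxE.
have -> : (f @: g)%VS = <<X>>%VS.
  apply/vspaceP => x; apply/memv_imgP/idP => [[y /vec_of_onto[u ->] ->]|].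
    rewrite vec_of_mx_on //.
    have /submxP[k ->] : (u *m mx_on f <= B)%MS.
      by rewrite (submx_trans (submxMl _ _)) // eq_row_base.
    rewrite vec_sum; apply: rpred_sum => i _; rewrite rpredZ //.
    by rewrite -XE memv_span // mem_nth ?size_tuple.
  move=> /coord_span->; under eq_bigr do rewrite XE.
  pose k := \row_i coord X i x.
  have /submxP[u uE] : (k *m B <= A)%MS by rewrite (submx_trans (submxMl _ _)) // eq_row_base.
  exists (vec_of u); first exact: vec_of_mem.
  rewrite vec_of_mx_on // -uE vec_sum; apply: eq_bigr => i _; by rewrite mxE.
by move: freeX => /eqP ->; rewrite size_tuple.
Qed.

Lemma mx_on_iter f k : stable f -> mx_on f ^+ k = 0 <-> {in g, forall x, iter k f x = 0}.
Proof.
move=> fg; have itE u : iter k f (vec_of u) = vec_of (u *m mx_on f ^+ k).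
  elim: k => [|k IH]; first by rewrite expr0 mulmx1.
  by rewrite iterS IH vec_of_mx_on // exprSr -mulmxE mulmxA.
split=> [f0 x /vec_of_onto[u ->]|f0].
  rewrite itE f0 mulmx0; have := vec_of_linear (-1) 0 0.
  by rewrite scaler0 addr0 scaleN1r addNr.
apply/row_matrixP => i; rewrite [RHS]row0 rowE; apply: vec_of_inj.
by rewrite -itE f0 ?vec_of_mem.
Qed.

End EndomorphismsOfSubspace.

Section MatchingOfDecompositions.
Variables (F : numFieldType) (vT : vectType F) (g : {vspace vT}).
Variables (I J : finType) (pi : I -> 'End(vT)) (rho : J -> 'End(vT)).
Variable W : 'End(vT) -> Prop.

Definition projection_system (T : finType) (f : T -> 'End(vT)) :=
  [/\ forall t x, x \in g -> f t (f t x) = f t x,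
      forall t t' x, t != t' -> x \in g -> f t' (f t x) = 0,
      forall x, x \in g -> \sum_t f t x = x & forall t, (f t @: g != 0)%VS].

(** The words w are endomorphisms of the whole space; cutting them off on both sides
    by f t makes them endomorphisms of the summand f t @: g. *)
Definition fitting_for (T : finType) (f : T -> 'End(vT)) :=
  forall w t, W w ->
    (exists k, {in g, forall x, iter k (f t \o w \o f t)%VF x = 0}) \/
    ((f t \o w \o f t) @: g = f t @: g)%VS.

Hypothesis piS : projection_system pi.
Hypothesis rhoS : projection_system rho.
Hypothesis Wg : forall w, W w -> stable g w.
Hypothesis WM : forall w w', W w -> W w' -> W (w \o w')%VF.
Hypothesis Wpi : forall i, W (pi i).
Hypothesis Wrho : forall j, W (rho j).
Hypothesis piL : fitting_for pi.
Hypothesis rhoL : fitting_for rho.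

Lemma idempotent_mx_on (T : finType) (f : T -> 'End(vT)) :
  projection_system f -> (forall t, W (f t)) -> idempotent_system (fun t => mx_on g (f t)).
Proof.
move=> [ff f0 f1 fn] Wf; have fg t := Wg (Wf t); split=> [t|t t' tt||t].
- rewrite -mx_on_comp //; apply: eq_mx_on => x gx; rewrite lfunE /=; exact: ff.
- rewrite -mx_on_comp //; apply/eqP; rewrite -mxrank_eq0 rank_mx_on; last exact/Wg/WM.
  rewrite dimv_eq0 -subv0; apply/subvP => _ /memv_imgP[x gx ->].
  by rewrite lfunE /= f0 ?mem0v.
- apply/row_matrixP => i; rewrite !rowE mulmx1; apply/eqP; rewrite -subr_eq0; apply/eqP.
  apply: vec_of_inj; set u := delta_mx 0 i.
  have -> : u *m (\sum_t mx_on g (f t)) - u = -1 *: u + \sum_t u *m mx_on g (f t).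
    by rewrite mulmx_sumr scaleN1r addrC.
  have vsum (r : seq T) : vec_of (\sum_(t <- r) u *m mx_on g (f t)) =
      \sum_(t <- r) f t (vec_of u).
    elim: r => [|t r IH].
      by rewrite !big_nil; have := vec_of_linear (-1) (0 : 'rV[F]_(\dim g)) 0;
        rewrite scaler0 addr0 scaleN1r addNr.
    rewrite !big_cons -[u *m _]scale1r vec_of_linear IH scale1r.
    by rewrite -vec_of_mx_on.
  by rewrite vec_of_linear vsum f1 ?vec_of_mem // scaleN1r addNr.
- by rewrite -mxrank_eq0 rank_mx_on // dimv_eq0.
Qed.

Definition word_matrix (x : 'M[F]_(\dim g)) := exists2 w, W w & x = mx_on g w.

Lemma local_mx_on (T : finType) (f : T -> 'End(vT)) :
  (forall t, W (f t)) -> fitting_for f -> local_system word_matrix (fun t => mx_on g (f t)).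
Proof.
move=> Wf fL _ t [w Ww ->]; have fg t := Wg (Wf t); have wg := Wg Ww.
have wS : W (f t \o w \o f t)%VF by do 2?apply: (WM) => //.
have -> : mx_on g (f t) *m mx_on g w *m mx_on g (f t) = mx_on g (f t \o w \o f t)%VF.
  by rewrite !mx_on_comp ?mulmxA //; exact/Wg/WM.
have [[k k0]|wE] := fL w t Ww; [left | right].
  by exists k; apply/mx_on_iter; [exact: Wg |].
by rewrite !rank_mx_on ?wE //; exact: Wg.
Qed.

Theorem matching_decompositions : exists2 f : I -> J, injective f &
  forall i, (pi i @: (rho (f i) @: g) = pi i @: g)%VS /\
            \dim (rho (f i) @: g) = \dim (pi i @: g).
Proof.
have [|||f fI fb] := @matching _ _ _ _ (fun i => mx_on g (pi i)) (fun j => mx_on g (rho j)) word_matrix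
  (idempotent_mx_on piS Wpi) (idempotent_mx_on rhoS Wrho) _ _ _
  (local_mx_on Wpi piL) (local_mx_on Wrho rhoL).
- move=> _ _ [x Wx ->] [y Wy ->]; exists (y \o x)%VF; first exact: WM.
  by rewrite mx_on_comp //; exact: Wg.
- by move=> i; exists (pi i).
- by move=> j; exists (rho j).
exists f => // i; have := fb i.
have gp := Wg (Wpi i); have gr := Wg (Wrho (f i)).
rewrite /bijective_entry -mx_on_comp // !rank_mx_on //; last exact/Wg/WM.
rewrite limg_comp => /andP[/eqP e1 /eqP e2]; split; last by rewrite -e2.
apply/eqP; rewrite eqEdim e1 leqnn andbT limgS //.
by apply/subvP => _ /memv_imgP[x gx ->]; exact: gr.
Qed.

End MatchingOfDecompositions.

(** * Direct sums of ideals *)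

Section DirectSumOfIdeals.
Variables (F : fieldType) (n : nat) (I : finType).
Implicit Types (X Y : 'M[F]_n).

Lemma bracketC X Y : bracket Y X = - bracket X Y.
Proof. by rewrite /bracket opprB. Qed.

Lemma bracketDl X Y Z : bracket (X + Y) Z = bracket X Z + bracket Y Z.
Proof. by rewrite /bracket mulmxDl mulmxDr opprD addrACA. Qed.

Lemma bracket0l Y : bracket 0 Y = 0.
Proof. by rewrite /bracket mul0mx mulmx0 subr0. Qed.

Lemma bracket_suml (T : Type) (r : seq T) (P : pred T) (f : T -> 'M[F]_n) Y :
  bracket (\sum_(t <- r | P t) f t) Y = \sum_(t <- r | P t) bracket (f t) Y.
Proof.
by elim/big_rec2: _ => [|t y x _ <-]; rewrite ?bracket0l // bracketDl.
Qed.

Variables (g : {vspace 'M[F]_n}) (a : I -> {vspace 'M[F]_n}).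

Definition ideal_decomposition :=
  [/\ g = (\sum_i a i)%VS, directv (\sum_i a i) & forall i, lie_ideal g (a i)].

Definition proj i : 'End('M[F]_n) := sumv_pi_for (erefl (\sum_k a k)%VS) i.

Hypothesis aS : ideal_decomposition.

Lemma summand_sub i : (a i <= g)%VS.
Proof. by case: aS => _ _ /(_ i)[]. Qed.

Lemma mem_proj i X : proj i X \in a i.
Proof. exact: memv_sum_pi. Qed.

Lemma proj_mem i X : proj i X \in g.
Proof. exact: (subvP (summand_sub i)) (mem_proj i X). Qed.

Lemma proj_sum X : X \in g -> \sum_i proj i X = X.
Proof. by case: aS => -> _ _; exact: sumv_pi_sum. Qed.

Lemma summand_disjoint i X : X \in a i -> X \in (\sum_(k | k != i) a k)%VS -> X = 0.
Proof.
case: aS => _ /directv_sumP/(_ i isT) d0 _ aX sX.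
by apply/eqP; rewrite -memv0 -d0 memv_cap aX.
Qed.

Lemma summand_disjoint2 i k X : i != k -> X \in a i -> X \in a k -> X = 0.
Proof.
move=> ik aX kX; apply: (summand_disjoint aX).
by apply: (subvP (sumv_sup k _ (subvv _))) => //; rewrite eq_sym.
Qed.

Lemma proj_unique (Y : I -> 'M[F]_n) X : (forall i, Y i \in a i) -> X = \sum_i Y i ->
  forall i, proj i X = Y i.
Proof.
move=> aY XE i; have gX : X \in g.
  by rewrite XE rpred_sum // => k _; exact: (subvP (summand_sub k)).
apply/eqP; rewrite -subr_eq0; apply/eqP; apply: (@summand_disjoint i).
  by rewrite rpredB ?mem_proj.
have -> : proj i X - Y i = \sum_(k | k != i) (Y k - proj k X).
  have pE : proj i X = X - \sum_(k | k != i) proj k X.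
    by rewrite -{2}(proj_sum gX) [X in _ = X - _](bigD1 i) //= addrK.
  rewrite sumrB pE {1}XE (bigD1 i) //= addrAC.
  by rewrite [Y i + _]addrC addrK.
by apply: memv_sumr => k _; rewrite rpredB ?mem_proj.
Qed.

Lemma proj_id i X : X \in a i -> proj i X = X.
Proof.
move=> aX; rewrite (@proj_unique (fun k => if k == i then X else 0)) ?eqxx //.
  by move=> k; case: eqP => [->//|_]; exact: mem0v.
by rewrite -big_mkcond big_pred1_eq.
Qed.

Lemma proj_other i k X : i != k -> X \in a i -> proj k X = 0.
Proof.
move=> ik aX; rewrite (@proj_unique (fun k => if k == i then X else 0)).
- by rewrite eq_sym (negPf ik).
- by move=> k'; case: eqP => [->//|_]; exact: mem0v.
by rewrite -big_mkcond big_pred1_eq.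
Qed.

Lemma proj_image i : (proj i @: g)%VS = a i.
Proof.
apply/vspaceP => X; apply/memv_imgP/idP => [[Y _ ->]|aX]; first exact: mem_proj.
by exists X; rewrite ?proj_id // (subvP (summand_sub i)).
Qed.

Lemma ideal_bracket i X Y : X \in g -> Y \in a i -> bracket X Y \in a i.
Proof. by case: aS => _ _ /(_ i)[_]; apply. Qed.

Lemma ideal_bracketl i X Y : X \in a i -> Y \in g -> bracket X Y \in a i.
Proof. by move=> aX gY; rewrite bracketC rpredN ideal_bracket. Qed.

Lemma bracket_summands i k X Y : i != k -> X \in a i -> Y \in a k -> bracket X Y = 0.
Proof.
move=> ik aX aY; apply: (summand_disjoint2 ik).
  by rewrite ideal_bracketl // (subvP (summand_sub k)).
by rewrite ideal_bracket // (subvP (summand_sub i)).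
Qed.

Lemma bracket_projr i X Y : X \in a i -> Y \in g -> bracket X Y = bracket X (proj i Y).
Proof.
move=> aX gY; rewrite -{1}(proj_sum gY) bracketC bracket_suml (bigD1 i) //= big1 ?addr0.
  by rewrite -bracketC.
by move=> k ki; rewrite (bracket_summands ki (mem_proj k Y) aX).
Qed.

Lemma bracket_mem X Y : X \in g -> Y \in g -> bracket X Y \in g.
Proof.
move=> gX gY; rewrite -(proj_sum gY) bracketC bracket_suml rpredN rpred_sum // => i _.
by rewrite bracketC rpredN (subvP (summand_sub i)) // ideal_bracket ?mem_proj.
Qed.

(** The projections commute with all adjoint maps. *)
Lemma proj_bracket i X Y : X \in g -> Y \in g ->
  proj i (bracket X Y) = bracket X (proj i Y).
Proof.
move=> gX gY; apply: (@proj_unique (fun k => bracket X (proj k Y))).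
  by move=> k; rewrite ideal_bracket ?mem_proj.
rewrite -{1}(proj_sum gY) bracketC bracket_suml -sumrN.
by apply: eq_bigr => k _; rewrite -bracketC.
Qed.

Lemma proj_bracketl i X Y : X \in g -> Y \in g ->
  proj i (bracket X Y) = bracket (proj i X) Y.
Proof. by move=> gX gY; rewrite bracketC linearN /= proj_bracket // -bracketC. Qed.

Lemma proj_bracket2 i X Y : X \in g -> Y \in g ->
  proj i (bracket X Y) = bracket (proj i X) (proj i Y).
Proof.
by move=> gX gY; rewrite proj_bracketl // (@bracket_projr i) // mem_proj.
Qed.

End DirectSumOfIdeals.

(** A summand of one decomposition that is mapped isomorphically onto a summand of
    another one. *)
Section TwoDecompositions.
Variables (F : fieldType) (n : nat) (I J : finType) (g : {vspace 'M[F]_n}).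
Variables (a : I -> {vspace 'M[F]_n}) (b : J -> {vspace 'M[F]_n}).
Hypothesis aS : ideal_decomposition g a.
Hypothesis bS : ideal_decomposition g b.
Variables (i : I) (j : J).
Notation pi := (proj a).
Notation rho := (proj b).
Hypothesis pi_onto : (pi i @: b j = a i)%VS.
Hypothesis dim_eq : \dim (b j) = \dim (a i).
Implicit Types (X Y : 'M[F]_n).

Let ag := summand_sub aS i.
Let bg := summand_sub bS j.

Lemma matched_inj X : X \in b j -> pi i X = 0 -> X = 0.
Proof.
move=> bX piX; have := limg_ker_dim (pi i) (b j); rewrite pi_onto dim_eq => /eqP.
rewrite -[X in _ == X]add0n eqn_add2r dimv_eq0 => /eqP k0.
by apply/eqP; rewrite -memv0 -k0 memv_cap bX memv_ker piX eqxx.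
Qed.

Lemma matched_bijective : lie_bijective (b j) (a i) (pi i).
Proof.
split=> [X _|X Y bX bY eXY|Y]; first exact: mem_proj.
  apply/eqP; rewrite -subr_eq0; apply/eqP/matched_inj; first exact: rpredB.
  by rewrite linearB /= eXY subrr.
by rewrite -pi_onto => /memv_imgP[X bX ->]; exists X.
Qed.

(** Move the projections from one argument of the bracket to the other: for X, Y in b j,
    [pi X, pi Y] = [pi X, Y] = [rho (pi X), Y]. *)
Lemma matched_derived_sub U V : U \in a i -> V \in a i ->
  exists X Y, [/\ X \in b j, Y \in b j & bracket U V = bracket X Y].
Proof.
rewrite -pi_onto => /memv_imgP[X bX ->] /memv_imgP[Y bY ->].
have gX := subvP bg _ bX; have gY := subvP bg _ bY.
exists (rho j (pi i X)), Y; split=> //; first exact: mem_proj.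
rewrite -(proj_bracket2 aS) // (proj_bracketl aS) //.
have gpX := proj_mem aS i X.
by rewrite bracketC (bracket_projr bS bY gpX) -bracketC.
Qed.

(** Both sides lie in b j, the right one by [matched_derived_sub], and have the same
    image under the projection, which is injective on b j. *)
Lemma matched_bracket X Y : X \in b j -> Y \in b j ->
  bracket X Y = bracket (pi i X) (pi i Y).
Proof.
move=> bX bY; have gX := subvP bg _ bX; have gY := subvP bg _ bY.
apply/eqP; rewrite -subr_eq0; apply/eqP/matched_inj.
  rewrite rpredB //; first exact: (ideal_bracket bS).
  have [X' [Y' [bX' bY' ->]]] := matched_derived_sub (mem_proj a i X) (mem_proj a i Y).
  by apply: (ideal_bracket bS) => //; exact: (subvP bg).
rewrite linearB /= -(proj_bracket2 aS) // [pi i (pi i _)](proj_id aS) ?subrr //.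
exact: mem_proj.
Qed.

Lemma matched_derived : derived (a i) = derived (b j).
Proof.
apply/eqP; rewrite eqEsubv; apply/andP; split; apply: vspan_sub => _ [X [Y [aX aY ->]]].
  have [X' [Y' [bX' bY' ->]]] := matched_derived_sub aX aY.
  by apply: mem_vspan; exists X', Y'.
by apply: mem_vspan; exists (pi i X), (pi i Y); rewrite matched_bracket ?mem_proj.
Qed.

(** For X in b j and Y in the complement of a i, the bracket [X, Y] = [X, rho Y] is
    [pi X, pi (rho Y)] by [matched_bracket], so it lies in a i; it also lies in the
    complement, which is an ideal, and is therefore zero. *)
Lemma matched_center : (b j <= a i + lie_center (\sum_(k | k != i) a k))%VS.
Proof.
apply/subvP => X bX; have gX := subvP bg _ bX.
rewrite -(proj_sum aS gX) (bigD1 i) //= memv_add ?mem_proj //.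
apply/lie_centerP; split=> [|Y sY]; first by apply: memv_sumr => k _; exact: mem_proj.
have gY : Y \in g.
  by case: aS => -> _ _; move: Y sY; apply/subvP/subv_sumP => k _; exact: sumv_sup.
have sXE : \sum_(k | k != i) pi k X = X - pi i X.
  by rewrite -{2}(proj_sum aS gX) [X in _ = X - _](bigD1 i) //= [X in _ = X - _]addrC addrK.
have sum_ideal U V : U \in g -> V \in (\sum_(k | k != i) a k)%VS ->
    bracket U V \in (\sum_(k | k != i) a k)%VS.
  move=> gU /memv_sumP[f fa ->]; rewrite bracketC bracket_suml rpredN.
  apply: memv_sumr => k ki; rewrite bracketC rpredN.
  by apply: (ideal_bracket aS) => //; exact: fa.
have XY0 : bracket X Y = 0.
  apply: (summand_disjoint aS (i := i)); last exact: sum_ideal.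
  rewrite (bracket_projr bS bX gY) matched_bracket ?mem_proj //.
  apply: (ideal_bracket aS); last exact: mem_proj.
  exact: proj_mem.
have pY0 : bracket (pi i X) Y = 0.
  apply: (summand_disjoint aS (i := i)); first by apply: (ideal_bracketl aS); rewrite ?mem_proj.
  by apply: sum_ideal => //; exact: proj_mem.
by rewrite sXE bracketDl XY0 add0r bracketC /bracket mulmxN mulNmx -opprD opprK -opprB -/(bracket _ _) pY0 oppr0.
Qed.

End TwoDecompositions.

(** * Direct products of algebraic groups *)

Section DirectProducts.
Variables (C : numClosedFieldType) (K : divringClosed C) (n : nat).
Notation S := {mpoly C[n * n + 1]}.
Hypothesis pigeonhole : forall h : C -> nat, exists v, forall m,
  exists s : seq C, [/\ uniq s, size s = m & forall x, x \in s -> h x = v].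
Implicit Types (G H : algGroup K n) (M : 'M[S]_n) (X Y : 'M[C]_n).

Lemma eq_mdiff G M M' X : (forall A, G A -> ev_mx M A = ev_mx M' A) ->
  X \in tangent G -> mdiff M X = mdiff M' X.
Proof.
move=> eM /tangentP GX; apply/matrixP => i j; rewrite !mxE; apply/eqP.
rewrite -subr_eq0 -diff_at_1B GX // => A /eM/matrixP/(_ i j).
by rewrite !mxE mevalB => ->; rewrite subrr.
Qed.

Lemma mdiff_scalar1 X : mdiff (1%:M : 'M[S]_n) X = 0.
Proof.
apply/matrixP => i j; rewrite !mxE; case: eqP => _; first exact: diff_at_1_1.
by have := diff_at_1B (0 : S) 0 X; rewrite !subrr.
Qed.

Definition indecomposable G := forall a b : {vspace 'M[C]_n},
  algebraic_ideal G a -> algebraic_ideal G b ->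
  tangent G = (a + b)%VS -> directv (a + b) -> a = 0%VS \/ b = 0%VS.

Definition direct_product G (I : finType) (Gs : I -> algGroup K n) (P : I -> 'M[S]_n) :=
  [/\ forall i A, Gs i A -> G A, forall i, morphism_on G (Gs i) (P i),
      forall i A, Gs i A -> ev_mx (P i) A = A
    & forall i k A, i != k -> Gs i A -> ev_mx (P k) A = 1%:M].

(** The words to which the matching of idempotents is applied. *)
Definition normal_endomorphism G (f : 'End('M[C]_n)) :=
  (forall X Y, X \in tangent G -> Y \in tangent G -> bracket X (f Y) = f (bracket X Y)) /\
  exists2 M, morphism_on G G M & {in tangent G, forall X, f X = mdiff M X}.

Lemma normal_stable G f : normal_endomorphism G f -> stable (tangent G) f.
Proof. by move=> [_ [M mM fM]] X GX; rewrite fM //; exact: (mdiff_tangent mM GX). Qed.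

Lemma normal_comp G f f' :
  normal_endomorphism G f -> normal_endomorphism G f' -> normal_endomorphism G (f \o f')%VF.
Proof.
move=> Nf Nf'; have st := normal_stable Nf'.
have [nf [M mM fM]] := Nf; have [nf' [M' mM' fM']] := Nf'; split=> [X Y GX GY|].
  by rewrite !lfunE /= nf ?nf' //; exact: st.
exists (mor_comp M M'); first exact: morphism_comp mM' mM.
by move=> X GX; have GX' := st X GX; rewrite lfunE /= (mdiff_mor_comp _ mM' GX) -fM' // fM.
Qed.

Section OneProduct.
Variables (G : algGroup K n) (I : finType) (Gs : I -> algGroup K n) (P : I -> 'M[S]_n).
Hypothesis GP : direct_product G Gs P.
Notation g := (tangent G).
Notation a := (fun i => tangent (Gs i)).
Hypothesis aS : ideal_decomposition g a.

(** Both sides are linear in X and agree on every summand, since the projection of groups is the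
    identity on one factor and trivial on the others. *)
Lemma mdiff_proj i X : X \in g -> mdiff (P i) X = proj a i X.
Proof.
move=> gX; rewrite -{1}(proj_sum aS gX) -mdifflE linear_sum (bigD1 i) //= big1 ?addr0.
  rewrite mdifflE -[RHS]mdiff_id.
  apply: (@eq_mdiff (Gs i)); last exact: mem_proj.
  have [_ _ PG _] := GP; move=> A /PG ->; apply/esym; exact: meval_genX.
move=> k ki; rewrite mdifflE -(mdiff_scalar1 (proj a k X)); apply: (@eq_mdiff (Gs k)).
  by have [_ _ _ P1] := GP; move=> A /(P1 _ _ _ ki) ->; rewrite /ev_mx map_mx1.
exact: mem_proj.
Qed.

Lemma proj_normal i : normal_endomorphism G (proj a i).
Proof.
split=> [X Y gX gY|]; first by rewrite (proj_bracket aS).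
exists (P i); last by move=> X gX; rewrite mdiff_proj.
have [PG mP _ _] := GP; split=> [|A GA|]; first exact: mor_over (mP i).
  exact/(PG i)/(mor_in (mP i)).
exact: mor_mul (mP i).
Qed.

Lemma proj_system : (forall i, a i != 0%VS) -> projection_system g (proj a).
Proof.
move=> a0; split=> [i X gX|i k X ik gX|X gX|i].
- exact/(proj_id aS)/mem_proj.
- exact: (proj_other aS ik (mem_proj a i X)).
- exact: (proj_sum aS gX).
by rewrite (proj_image aS) a0.
Qed.

(** The word cut off to the summand is the differential of the group endomorphism of
    the factor that is the word followed by the projection. *)
Lemma proj_fitting : (forall i, indecomposable (Gs i)) ->
  fitting_for g (normal_endomorphism G) (proj a).
Proof.
move=> ind w i Nw; have wg := normal_stable Nw; have [nw [M mM wM]] := Nw.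
have [PG mP _ _] := GP; have ag := subvP (summand_sub aS i).
have mPM : morphism_on (Gs i) (Gs i) (mor_comp (P i) M).
  have m := morphism_comp mM (mP i); split=> [|A /PG|A B /PG GA /PG]; first exact: mor_over m.
    exact: mor_in m A.
  exact: mor_mul m A B GA.
pose phi := mdiffl (mor_comp (P i) M).
have phiE X : X \in g -> phi X = proj a i (w X).
  by move=> gX; rewrite mdifflE (mdiff_mor_comp _ mM gX) mdiff_proj -?wM //; exact: wg.
have fE X : X \in a i -> (proj a i \o w \o proj a i)%VF X = phi X.
  by move=> aX; rewrite !lfunE /= lfunE /= (proj_id aS aX) phiE // ag.
have [| | |[k k0]|phia] := fitting pigeonhole mPM.
- by move=> X Y aX aY; apply: (ideal_bracket aS) => //; exact: ag.
- move=> X Y aX aY; have gX := ag _ aX; have gY := ag _ aY.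
  rewrite -/phi !phiE //; last exact: (bracket_mem aS).
  by rewrite -nw // (proj_bracket aS) //; exact: wg.
- exact: ind.
- left; exists k.+1 => X gX; rewrite iterSr.
  have aW : (proj a i \o w \o proj a i)%VF X \in a i by rewrite !lfunE /= lfunE mem_proj.
  rewrite -[RHS](k0 _ aW).
  have st Y : Y \in a i -> iter k phi Y \in a i.
    by move=> aY; elim: k {k0} => //= k aI; rewrite phiE ?ag // mem_proj.
  elim: k {k0 st} => //= k ->; rewrite fE //; elim: k => //= k aI.
  by rewrite phiE ?ag // mem_proj.
right; rewrite limg_comp (proj_image aS); rewrite -[RHS]phia.
apply/vspaceP => Y; apply/memv_imgP/memv_imgP => -[X aX ->]; exists X => //.
  by rewrite -[RHS]fE // !lfunE /= lfunE /= (proj_id aS aX).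
by rewrite -/phi -[LHS]fE // !lfunE /= lfunE /= (proj_id aS aX).
Qed.

End OneProduct.

Section TwoProducts.
Variables (G : algGroup K n) (I J : finType).
Variables (Gs : I -> algGroup K n) (P : I -> 'M[S]_n).
Variables (Hs : J -> algGroup K n) (Q : J -> 'M[S]_n).
Notation g := (tangent G).
Notation a := (fun i => tangent (Gs i)).
Notation b := (fun j => tangent (Hs j)).
Hypothesis GP : direct_product G Gs P.
Hypothesis HQ : direct_product G Hs Q.
Hypothesis aS : ideal_decomposition g a.
Hypothesis bS : ideal_decomposition g b.
Hypothesis indG : forall i, indecomposable (Gs i).
Hypothesis indH : forall j, indecomposable (Hs j).

Theorem matching_products : (forall i, a i != 0%VS) -> (forall j, b j != 0%VS) ->
  exists2 f : I -> J, injective f &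
    forall i, (proj a i @: b (f i) = a i)%VS /\ \dim (b (f i)) = \dim (a i).
Proof.
move=> a0 b0.
have [f fI fP] := matching_decompositions (proj_system aS a0) (proj_system bS b0)
  (@normal_stable G) (@normal_comp G) (proj_normal GP aS) (proj_normal HQ bS)
  (proj_fitting GP aS indG) (proj_fitting HQ bS indH).
by exists f => // i; have [] := fP i; rewrite (proj_image aS) (proj_image bS).
Qed.

Lemma nonabelian_bracket (h : {vspace 'M[C]_n}) : ~ lie_abelian h ->
  exists X Y, [/\ X \in h, Y \in h & bracket X Y <> 0].
Proof.
move=> nh; apply: contrapT => no; apply: nh => X Y hX hY; apply: contrapT => XY.
by apply: no; exists X, Y.
Qed.

Lemma derived_mem (h : {vspace 'M[C]_n}) X Y : X \in h -> Y \in h -> bracket X Y \in derived h.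
Proof. by move=> hX hY; apply: mem_vspan; exists X, Y. Qed.

Lemma derived_summand i : (derived (a i) <= a i)%VS.
Proof.
apply: vspan_sub => _ [X [Y [aX aY ->]]]; apply: (ideal_bracket aS) => //.
exact: (subvP (summand_sub aS i)).
Qed.

(** The composite of rho_j, pi_i and rho_j fixes the nonzero commutators of a i, which lie
    in b j too, hence is not nilpotent, and Fitting's alternative makes it onto. *)
Theorem nonabelian_converse i j : ~ lie_abelian (a i) ->
  (proj a i @: b j = a i)%VS -> derived (a i) = derived (b j) ->
  (proj b j @: a i = b j)%VS.
Proof.
move=> na piE dE; have [X [Y [aX aY XY0]]] := nonabelian_bracket na.
set Z := bracket X Y in XY0.
have dZ : Z \in derived (a i) by exact: derived_mem.
have aZ : Z \in a i by apply: (subvP (derived_summand i)).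
have bZ : Z \in b j.
  rewrite dE in dZ; apply: subvP dZ; apply: vspan_sub => _ [U [V [bU bV ->]]].
  by apply: (ideal_bracket bS) => //; exact: (subvP (summand_sub bS j)).
have [[k k0]|] := proj_fitting HQ bS indH j (proj_normal GP aS i).
  have gZ : Z \in g by apply: (subvP (summand_sub aS i)).
  case: XY0; rewrite -[RHS](k0 _ gZ); elim: k {k0} => //= k <-.
  by rewrite !lfunE /= lfunE /= (proj_id bS bZ) (proj_id aS aZ) (proj_id bS bZ).
by rewrite !limg_comp (proj_image bS) piE.
Qed.

(** Distinct summands meet trivially. *)
Lemma derived_determines i j j' : ~ lie_abelian (a i) ->
  derived (a i) = derived (b j) -> derived (a i) = derived (b j') -> j = j'.
Proof.
move=> na dE dE'; have [X [Y [aX aY XY0]]] := nonabelian_bracket na.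
have dZ := derived_mem aX aY.
have db k : (derived (b k) <= b k)%VS.
  apply: vspan_sub => _ [U [V [bU bV ->]]]; apply: (ideal_bracket bS) => //.
  exact: (subvP (summand_sub bS k)).
apply/eqP; apply: contrapT => /negP jj; case: XY0; apply: (summand_disjoint2 bS jj).
  by apply: (subvP (db j)); rewrite -dE.
by apply: (subvP (db j')); rewrite -dE'.
Qed.

End TwoProducts.
End DirectProducts.

(** * The Krull-Schmidt theorem *)

Lemma lie_bijective_dim (F : fieldType) (n : nat) (f : 'End('M[F]_n)) (b a : {vspace 'M[F]_n}) :
  lie_bijective b a f -> (f @: b = a)%VS /\ \dim b = \dim a.
Proof.
move=> [fa finj fonto]; have fb : (f @: b = a)%VS.
  apply/vspaceP => Y; apply/memv_imgP/idP => [[X bX ->]|/fonto[X bX <-]]; first exact: fa.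
  by exists X.
split=> //; rewrite -fb limg_dim_eq //; apply/eqP; rewrite -subv0; apply/subvP => X.
rewrite memv_cap memv_ker => /andP[bX /eqP fX0].
by rewrite memv0; apply/eqP/finj; rewrite ?mem0v // linear0.
Qed.

Section KrullSchmidt.
Variables (C : numClosedFieldType) (K : divringClosed C) (n r s : nat).
Notation S := {mpoly C[n * n + 1]}.
Hypothesis pigeonhole : forall h : C -> nat, exists v, forall m,
  exists s : seq C, [/\ uniq s, size s = m & forall x, x \in s -> h x = v].
Variables (G : algGroup K n).
Variables (Gs : 'I_r -> algGroup K n) (P : 'I_r -> 'M[S]_n).
Variables (Hs : 'I_s -> algGroup K n) (Q : 'I_s -> 'M[S]_n).
Notation g := (tangent G).
Notation a := (fun i => tangent (Gs i)).
Notation b := (fun j => tangent (Hs j)).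
Hypothesis GP : direct_product G Gs P.
Hypothesis HQ : direct_product G Hs Q.
Hypothesis aS : ideal_decomposition g a.
Hypothesis bS : ideal_decomposition g b.
Hypothesis a0 : forall i, a i != 0%VS.
Hypothesis b0 : forall j, b j != 0%VS.
Hypothesis indG : forall i, indecomposable (Gs i).
Hypothesis indH : forall j, indecomposable (Hs j).

Definition matched_by (e : r = s) (sigma : 'S_r) := forall i : 'I_r,
  let j := cast_ord e (sigma i) in
  [/\ lie_bijective (b j) (a i) (proj a i), derived (a i) = derived (b j)
    & (b j <= a i + lie_center (\sum_(k | k != i) a k))%VS].

Lemma same_length : r = s.
Proof.
have [f fI _] := matching_products pigeonhole GP HQ aS bS indG indH a0 b0.
have [f' fI' _] := matching_products pigeonhole HQ GP bS aS indH indG b0 a0.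
have := leq_card f fI; have := leq_card f' fI'; rewrite !card_ord => sr rs.
by apply/eqP; rewrite eqn_leq rs sr.
Qed.

Lemma exists_matching (e : r = s) : exists sigma, matched_by e sigma.
Proof.
have [f fI fP] := matching_products pigeonhole GP HQ aS bS indG indH a0 b0.
pose h i := cast_ord (esym e) (f i).
have hI : injective h by move=> i i' /cast_ord_inj/fI.
exists (perm hI) => i j; have -> : j = f i by rewrite /j permE /h cast_ordKV.
have [piE dE] := fP i; split.
- exact: (@matched_bijective _ _ _ _ a b _ _ piE dE).
- exact: (matched_derived aS bS piE dE).
exact: (matched_center aS bS piE dE).
Qed.

Lemma matching_unique (e : r = s) sigma tau : (forall i, ~ lie_abelian (a i)) ->
  matched_by e sigma -> matched_by e tau -> sigma = tau.
Proof.
move=> na sP tP; apply/permP => i; have [_ dE _] := sP i; have [_ dE' _] := tP i.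
exact: (cast_ord_inj (derived_determines bS (na i) dE dE')).
Qed.

Lemma matching_converse (e : r = s) sigma : (forall i, ~ lie_abelian (a i)) ->
  matched_by e sigma -> forall i, let j := cast_ord e (sigma i) in
  lie_bijective (a i) (b j) (proj b j) /\
  (a i <= b j + lie_center (\sum_(k | k != j) b k))%VS.
Proof.
move=> na sP i j; have [/lie_bijective_dim[piE dE] derE _] := sP i.
have rhoE : (proj b j @: a i = b j)%VS.
  exact: (nonabelian_converse pigeonhole GP HQ aS bS indH (na i) piE derE).
split; first exact: (@matched_bijective _ _ _ _ b a _ _ rhoE (esym dE)).
exact: (matched_center bS aS rhoE (esym dE)).
Qed.

End KrullSchmidt.

(** * The complex numbers *)

Lemma big_mulmx_single (F : fieldType) (n r : nat) (i : 'I_r) (A : 'M[F]_n) :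
  \big[mulmx/1%:M]_(k < r) (if k == i then A else 1%:M) = A.
Proof.
have E (ks : seq 'I_r) : uniq ks ->
    \big[mulmx/1%:M]_(k <- ks) (if k == i then A else 1%:M) = if i \in ks then A else 1%:M.
  elim: ks => [|k ks IH] /=; rewrite ?big_nil // big_cons inE => /andP[kks /IH->].
  rewrite eq_sym; have [eki|_] := eqVneq i k; last by rewrite mul1mx.
  rewrite {}eki.
  by rewrite (negPf kks) mulmx1.
by rewrite E ?index_enum_uniq // mem_index_enum.
Qed.

Lemma ev_matrix (C : numClosedFieldType) (n : nat) (f : 'I_n -> 'I_n -> {mpoly C[n * n + 1]}) A :
  ev_mx (\matrix_(i, j) f i j) A = \matrix_(i, j) (f i j).@[gl_coord A].
Proof. by apply/matrixP => i j; rewrite !mxE. Qed.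

Lemma mdiff_matrix (C : numClosedFieldType) (n : nat) (f : 'I_n -> 'I_n -> {mpoly C[n * n + 1]}) X :
  mdiff (\matrix_(i, j) f i j) X = \matrix_(i, j) diff_at_1 (f i j) X.
Proof. by apply/matrixP => i j; rewrite !mxE. Qed.

Local Open Scope complex_scope.

Section ComplexGroups.
Variables (R : realType) (K : divringClosed R[i]) (n : nat).
Implicit Types (G H : Kgroup K n).

Definition to_alg G : algGroup K n :=
  AlgGroup (Kgroup1 G) (@KgroupM _ _ _ G) (@KgroupV _ _ _ G) (Kgroup_zeros G).

Definition of_alg (Z : algGroup K n) : Kgroup K n :=
  MkKgroup (algGroup1 Z) (@algGroupM _ _ _ Z) (@algGroupV _ _ _ Z) (algGroup_zeros Z).

Lemma indecomposable_to_alg G : Kindecomposable G -> indecomposable (to_alg G).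
Proof.
move=> ind a b [aI [Z ZG Za]] [bI [Z' ZG' Zb]] gE dab; apply: contrapT => nab.
apply: ind; exists a, b; split=> //.
- split; split=> //; [exists (of_alg Z) | exists (of_alg Z')]; split=> //.
- by split; apply/eqP => ?; apply: nab; [left | right].
Qed.

Definition mor_mx G H (Phi : Kmorphism G H) : 'M[{mpoly R[i][n * n + 1]}]_n :=
  \matrix_(i, j) Kmor_poly Phi i j.

Lemma ev_mor_mx G H (Phi : Kmorphism G H) A : ev_mx (mor_mx Phi) A = Phi A.
Proof. exact: ev_matrix. Qed.

Lemma mdiff_mor_mx G H (Phi : Kmorphism G H) X : mdiff (mor_mx Phi) X = Kdiff Phi X.
Proof. exact: mdiff_matrix. Qed.

Lemma morphism_mor_mx G H (Phi : Kmorphism G H) :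
  morphism_on (to_alg G) (to_alg H) (mor_mx Phi).
Proof.
split=> [i j|A GA|A B GA GB]; first by rewrite mxE; exact: Kmor_over.
- by rewrite ev_mor_mx; exact: Kmor_in.
by rewrite !ev_mor_mx; exact: Kmor_M.
Qed.

Variables (G : Kgroup K n) (r : nat) (Gs : 'I_r -> Kgroup K n).
Hypothesis prodG : Kdirect_product G Gs.
Hypothesis sumG : lie_decomposition G Gs.

Lemma direct_product_to_alg : exists p : forall i, Kmorphism G (Gs i),
  direct_product (to_alg G) (fun i => to_alg (Gs i)) (fun i => mor_mx (p i)).
Proof.
have [sub _ [p [_ pB]]] := prodG; exists p.
have single i A k : Gs i A -> p k A = if k == i then A else 1%:M.
  move=> GA; rewrite -[RHS](pB (fun k => if k == i then A else 1%:M)).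
    by apply: (congr1 (Kmor_fun (p k))); apply: esym; exact: big_mulmx_single.
  by move=> l; case: eqP => [->|_]; [exact: GA | exact: Kgroup1].
split=> [//|i|i A GA|i k A ik GA]; first exact: morphism_mor_mx.
  by rewrite ev_mor_mx (single i) // eqxx.
by rewrite ev_mor_mx (single i) // eq_sym (negPf ik).
Qed.

Lemma ideal_decomposition_Lie :
  ideal_decomposition (tangent (to_alg G)) (fun i => tangent (to_alg (Gs i))).
Proof. by have [gE d aI] := sumG; split=> // i; have [] := aI i. Qed.

(** The projection is always algebraic, being the differential of the restriction to H
    of the projection of groups. *)
Lemma Kalgebraic_isoE (H : Kgroup K n) i : Ksubgroup H G ->
  Kalgebraic_iso H (Gs i) (summand_proj (fun i => Lie (Gs i)) i) <->
  lie_bijective (Lie H) (Lie (Gs i)) (summand_proj (fun i => Lie (Gs i)) i).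
Proof.
move=> HG; split=> [[]//|bij]; split=> //.
have aS := ideal_decomposition_Lie; have [p pP] := direct_product_to_alg.
have Hg : (Lie H <= Lie G)%VS by exact: (@tangent_sub _ _ _ (to_alg G) (to_alg H)).
have [into _ _] := bij; split.
  split=> [//|c X Y _ _|X Y HX HY]; first exact: linearP.
  by apply: (proj_bracket2 aS); exact: (subvP Hg).
have over := @Kmor_over _ _ _ _ _ _ (p i).
have inG A : H A -> Gs i (reg_map (Kmor_poly (p i)) A) by move=> /HG; exact: Kmor_in.
have mul A B : H A -> H B -> reg_map (Kmor_poly (p i)) (A *m B) =
    reg_map (Kmor_poly (p i)) A *m reg_map (Kmor_poly (p i)) B.
  by move=> /HG GA /HG; exact: Kmor_M.
exists (MkKmorphism over inG mul) => X HX.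
have gX : X \in tangent (to_alg G) by exact: (subvP Hg).
have := mdiff_proj pP aS i gX; rewrite mdiff_mor_mx => pE.
by rewrite [LHS](esym pE).
Qed.

End ComplexGroups.

Theorem theorem3p1 (R : realType) (K : divringClosed R[i]) (n r s : nat)
    (G : Kgroup K n) (Gs : 'I_r -> Kgroup K n) (Hs : 'I_s -> Kgroup K n)
    (prodG : Kdirect_product G Gs) (prodH : Kdirect_product G Hs)
    (sumG : lie_decomposition G Gs) (sumH : lie_decomposition G Hs)
    (nzG : forall i, Lie (Gs i) != 0%VS) (nzH : forall j, Lie (Hs j) != 0%VS)
    (indG : forall i, Kindecomposable (Gs i))
    (indH : forall j, Kindecomposable (Hs j)) :
  let g := fun i => Lie (Gs i) in
  let h := fun j => Lie (Hs j) in
  let pi := summand_proj g in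
  let rho := summand_proj h in
  exists e : r = s,
    let good := fun sigma : 'S_r =>
      forall i : 'I_r, let j := cast_ord e (sigma i) in
      [/\ Kalgebraic_iso (Hs j) (Gs i) (pi i),
          derived (g i) = derived (h j)
        & (h j <= g i + lie_center (\sum_(k < r | k != i) g k))%VS] in
    (exists sigma : 'S_r, good sigma) /\
    ((forall i, ~ lie_abelian (g i)) ->
     (exists! sigma : 'S_r, good sigma) /\
     (forall sigma : 'S_r, good sigma ->
        forall i : 'I_r, let j := cast_ord e (sigma i) in
        Kalgebraic_iso (Gs i) (Hs j) (rho j) /\
        (g i <= h j + lie_center (\sum_(k < s | k != j) h k))%VS)).
Proof.
move=> g h pi rho.
have [p pP] := direct_product_to_alg prodG; have [q qP] := direct_product_to_alg prodH.
have aS := ideal_decomposition_Lie sumG; have bS := ideal_decomposition_Lie sumH.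
have pg := complex_pigeonhole (R := R).
have iG i := indecomposable_to_alg (indG i); have iH j := indecomposable_to_alg (indH j).
have [GsG _ _] := prodG; have [HsG _ _] := prodH.
have e : r = s := same_length pg pP qP aS bS nzG nzH iG iH.
exists e => good.
have goodE sigma : good sigma <->
    matched_by (fun i => to_alg (Gs i)) (fun j => to_alg (Hs j)) e sigma.
  have isoE i := Kalgebraic_isoE prodG sumG i (HsG (cast_ord e (sigma i))).
  by split=> mP i; have [/isoE iso dE cE] := mP i; split.
have [sigma sP] := exists_matching pg pP qP aS bS nzG nzH iG iH e.
split; first by exists sigma; apply/goodE.
move=> na'; have na : forall i, ~ lie_abelian (tangent (to_alg (Gs i))) := na'.
split.
  exists sigma; split=> [|tau /goodE tP]; first exact/goodE.
  exact: (matching_unique bS na sP tP).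
move=> tau /goodE tP i j.
have [bij cE] := matching_converse pg pP qP aS bS iH na tP i.
by split=> //; apply/(Kalgebraic_isoE prodH sumH j (GsG i)).
Qed.
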